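(* Let $f$ and $g$ be two quasi-quadratic Fibonacci unimodal maps. If $\mathrm{dist}_T(f,g)=0$, then $f$ and $g$ are smoothly conjugate, i.e. the conjugacy between them is a $C^1$-diffeomorphism.
   Context: A unimodal map is a continuous self-map $f:T\to T$ of a compact interval $T\subset\mathbb{R}$ with a single turning point $c$ in the interior of $T$ (the critical point). It is quasi-quadratic if it is $C^2$-smooth and has a quadratic-like critical point; this is used in the form $f=h\circ\phi$, where $\phi(x)=(x-c)^2$ and $h$ is a $C^2$-diffeomorphism between appropriate intervals. The map $f$ is Fibonacci if the closest returns of the critical point occur exactly at the Fibonacci moments: for $n\ge 1$, one has $|f^n(c)-c|<|f^k(c)-c|$ for all $1\le k<n$ if and only if $n$ is one of the Fibonacci numbers $1,2,3,5,8,13,\dots$. Any two quasi-quadratic Fibonacci maps $f,g$ are conjugate by a quasi-symmetric homeomorphism $h$ of the corresponding intervals, $h\circ f=g\circ h$. The Teichm\''uller pseudo-distance is $\mathrm{dist}_T(f,g)=\inf\log K_{\hat h}$, the infimum being taken over all quasi-conformal extensions $\hat h$ of $h$ to the complex plane, where $K_{\hat h}\ge 1$ denotes the (maximal) dilatation of $\hat h$. *)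

(* Defs.v *)
From HB Require Import structures.
From mathcomp Require Import all_boot all_order all_algebra complex.
From mathcomp Require Import all_classical all_reals all_analysis.

Set Implicit Arguments.
Unset Strict Implicit.
Unset Printing Implicit Defensive.

Import Order.TTheory GRing.Theory Num.Theory.
Import numFieldNormedType.Exports.

Local Open Scope classical_set_scope.
Local Open Scope ring_scope.
Local Open Scope complex_scope.

Section Smoothness.
Variable R : realType.
Implicit Types (A B : set R) (u v : R -> R).

Fixpoint Ck (k : nat) (u : R -> R) : Prop :=
  if k is k'.+1 then (forall x, derivable u x 1) /\ Ck k' (derive1 u)
  else continuous u.

(* For a closed interval A this is the usual notion, with one-sided derivatives
   at the endpoints: such a function extends to the line by its Taylor
   polynomials at the endpoints. *)
Definition Ck_on k A u := exists2 U, Ck k U & forall x, A x -> u x = U x.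

Definition inverse_on A B u v :=
  [/\ forall x, A x -> B (u x), forall y, B y -> A (v y),
      forall x, A x -> v (u x) = x & forall y, B y -> u (v y) = y].

Definition homeo_on A B u := exists v,
  [/\ inverse_on A B u v, {within A, continuous u} & {within B, continuous v}].

Definition Ck_diffeo k A B u := exists v,
  [/\ inverse_on A B u v, Ck_on k A u & Ck_on k B v].

Definition quasi_symmetric A u := exists2 M : R, 1 <= M &
  forall x t, 0 < t -> A (x - t) -> A (x + t) ->
    M^-1 <= `|u (x + t) - u x| / `|u x - u (x - t)| <= M.

End Smoothness.

(* The values of umap outside [lend, rend] are irrelevant. *)
Record unimodal_map (R : realType) := UnimodalMap {
  lend : R;
  rend : R;
  crit : R;
  umap :> R -> R;
  unimodal_crit : lend < crit < rend;
  unimodal_self : forall x, lend <= x <= rend -> lend <= umap x <= rend;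
  unimodal_cont : {within `[lend, rend], continuous umap};
  unimodal_turn :
    ((forall x y, lend <= x -> x < y -> y <= crit -> umap x < umap y) /\
     (forall x y, crit <= x -> x < y -> y <= rend -> umap y < umap x)) \/
    ((forall x y, lend <= x -> x < y -> y <= crit -> umap y < umap x) /\
     (forall x y, crit <= x -> x < y -> y <= rend -> umap x < umap y))
}.

Definition dom (R : realType) (f : unimodal_map R) : set R :=
  `[lend f, rend f].

Definition quasi_quadratic (R : realType) (f : unimodal_map R) :=
  let phi := fun x : R => (x - crit f) ^+ 2 in
  Ck_on 2 (dom f) f /\
  exists2 h : R -> R, Ck_diffeo 2 (phi @` dom f) (f @` dom f) h &
    forall x, dom f x -> f x = h (phi x).

Fixpoint fib (n : nat) : nat :=
  if n is (m.+1 as p).+1 then (fib p + fib m)%N else n.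

Definition closest_return (R : realType) (f : unimodal_map R) (n : nat) :=
  forall k : nat, (1 <= k < n)%N ->
    `|iter n f (crit f) - crit f| < `|iter k f (crit f) - crit f|.

Definition is_fibonacci_map (R : realType) (f : unimodal_map R) :=
  forall n : nat, (1 <= n)%N ->
    (closest_return f n <-> exists m : nat, n = fib m).

Definition conjugacy (R : realType) (f g : unimodal_map R) (h : R -> R) :=
  homeo_on (dom f) (dom g) h /\ forall x, dom f x -> h (f x) = g (h x).

Section Quasiconformal.
Variable R : realType.
Local Notation C := (R[i]^o).
Implicit Types F : C -> C.

Definition plane_homeo F := continuous F /\
  exists G : C -> C, [/\ continuous G, cancel F G & cancel G F].

Definition abs_continuous (a b : R) (u : R -> R[i]) :=
  forall e : R, 0 < e -> exists2 d : R, 0 < d &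
    forall (n : nat) (l r : 'I_n -> R),
      (forall i, [/\ a <= l i, l i <= r i & r i <= b]) ->
      (forall i j, i != j -> r i <= l j \/ r j <= l i) ->
      \sum_i (r i - l i) < d -> \sum_i Normc.normc (u (r i) - u (l i)) < e.

Definition ACL F := forall a b c d : R, a < b -> c < d ->
  {ae lebesgue_measure,
    forall y : R, c <= y <= d -> abs_continuous a b (fun x => F (x +i* y))} /\
  {ae lebesgue_measure,
    forall x : R, a <= x <= b -> abs_continuous c d (fun y => F (x +i* y))}.

Definition partial_x F (x y : R) : R[i] :=
  derive1 (fun t : R => complex.Re (F (t +i* y))) x +i*
  derive1 (fun t : R => complex.Im (F (t +i* y))) x.

Definition partial_y F (x y : R) : R[i] :=
  derive1 (fun t : R => complex.Re (F (x +i* t))) y +i*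
  derive1 (fun t : R => complex.Im (F (x +i* t))) y.

Definition partial_z F (x y : R) : R[i] :=
  (partial_x F x y - 'i * partial_y F x y) / 2%:R.

Definition partial_zbar F (x y : R) : R[i] :=
  (partial_x F x y + 'i * partial_y F x y) / 2%:R.

(* Analytic definition (Ahlfors, Lectures on Quasiconformal Mappings, II.B).
   ACL gives the partial derivatives almost everywhere, and the dilatation
   inequality forces F to preserve orientation. *)
Definition K_quasiconformal (K : R) F :=
  [/\ 1 <= K, plane_homeo F, ACL F &
    {ae (lebesgue_measure \x lebesgue_measure)%E, forall p : R * R,
      Normc.normc (partial_zbar F p.1 p.2) <=
      (K - 1) / (K + 1) * Normc.normc (partial_z F p.1 p.2)}].

Definition quasiconformal F := exists K, K_quasiconformal K F.

Definition max_dilatation F : R := inf [set K | K_quasiconformal K F].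

Definition qc_extension (T : set R) (h : R -> R) F :=
  quasiconformal F /\ forall x, T x -> F (x%:C) = (h x)%:C.

End Quasiconformal.

Definition qs_conjugacy (R : realType) (f g : unimodal_map R) (h : R -> R) :=
  conjugacy f g h /\ quasi_symmetric (dom f) h.

(* The maps f and g enter only through their conjugacy h, defined on
   T = dom f.  The value is +oo when h has no quasiconformal extension. *)
Definition teich_dist (R : realType) (T : set R) (h : R -> R) : \bar R :=
  ereal_inf [set (ln (max_dilatation F))%:E | F in qc_extension T h].

(* Main.v *)
From HB Require Import structures.
Require Import Defs.
From mathcomp Require Import all_boot all_order all_algebra complex.
From mathcomp Require Import all_classical all_reals all_analysis.
From mathcomp Require Import measurable_realfun ring lra.

(** If [dist_T(f, g) = 0], the conjugacy [h] has extensions [F = u + i v] to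
    homeomorphisms of the plane of dilatation [1 + k] for arbitrarily small [k].
    This alone makes [h] affine.

    Off a null set such an [F] satisfies the Cauchy-Riemann equations up to an
    error [k |F_x|] and, for small [k], the area inequality
    [\int_D |F_x|^2 <= (11 / 10) area (F D)].  Hence a function of [|F - F(x0)|]
    that increases by 1 on each of [n] concentric annuli of ratio [9 / 8] has
    Dirichlet energy [O(n)].  This yields estimates uniform in [k]:
    - the length-area method bounds the distortion
      [max_{Q_r} |F - F(x0)| / min_{bd Q_2r} |F - F(x0)|] on squares [Q_r]
      centred at [x0]; so near a real point the modulus of continuity of [F] is
      controlled by that of [h];
    - pairing the gradient with the field [z / |z|^2] shows that
      [|F - F(x0)| = O(R^theta)] on [Q_R] with [theta < 2].
    For [x1 < x2 < x3] the second difference [D = \sum_i al_i h(x_i)] with weights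
    [x3 - x2], [x1 - x3], [x2 - x1] is the sum of the residues of
    [F(z) \sum_i al_i / (z - x_i)], whose kernel decays like [|z|^-3].  Integrating
    by parts on a large square bounds [D] by a boundary term [O(R^(theta - 2))] and
    the Cauchy-Riemann error, which is [O(k)] for fixed [R].  So [D = 0]. *)

(** The extensions for different [k] are unrelated and not normalised at infinity. Hence all scales
    are fixed before the extension is chosen, and every estimate has constants independent of it.

    The order of the difference decides the argument. A first difference has a kernel decaying like
    [|z|^-2] and would require [theta < 1], which fails for the identity. The second difference
    annihilates affine functions and leaves the room between 1 and 2; the ratio 9/8 and the loss
    11/10 are small enough to reach [theta = 3/2].

    The obstacle in the area inequality is that almost everywhere one has partial derivatives but no
    total differential. The points are therefore sorted into countably many closed sets on which [F]
    is uniformly close, along horizontal and vertical segments, to one conformal linear map. Up to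
    small measure, the four neighbours at distance [s] of a point lie in the same closed set; this
    controls [F] on the whole boundary of a square, and a continuity argument shows that the image
    of the square covers a slightly reduced linear image. *)

Set Implicit Arguments.
Unset Strict Implicit.
Unset Printing Implicit Defensive.

Import Order.TTheory GRing.Theory Num.Theory.
Import numFieldNormedType.Exports.

Local Open Scope classical_set_scope.
Local Open Scope ring_scope.

(** * Lebesgue measure on the line and the plane *)

(* [lebesgue_measure] is a measure on a type of generated measurable sets, not on
   the Borel structure of [R] itself; this copy lives on the latter, as the
   product structure on [R * R] does. *)
Definition leb (R : realType) : set R -> \bar R := @lebesgue_measure R.

HB.instance Definition _ (R : realType) := isMeasure.Build _ R R (@leb R)
  (@measure0 _ _ _ (@lebesgue_measure R)) (@measure_ge0 _ _ _ (@lebesgue_measure R))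
  (@measure_semi_sigma_additive _ _ _ (@lebesgue_measure R)).
Lemma leb_sfin (R : realType) : sigma_finite setT (@leb R).
Proof. exact: (@sigma_finiteT _ _ _ (@lebesgue_measure R)). Qed.

HB.instance Definition _ (R : realType) := @Measure_isSigmaFinite.Build _ R R (@leb R) (@leb_sfin R).
Notation lxl R := (@leb R \x @leb R)%E.
(** The measure of [K_quasiconformal], declared on the product Borel structure: there the uniqueness
    of product measures identifies it with [lxl R]. *)
Definition pleb (R : realType) : set (R * R) -> \bar R :=
  (@lebesgue_measure R \x @lebesgue_measure R)%E.
HB.instance Definition _ (R : realType) := isMeasure.Build _ (R * R)%type R (@pleb R)
  (@measure0 _ _ _ (@lebesgue_measure R \x @lebesgue_measure R)%E)
  (@measure_ge0 _ _ _ (@lebesgue_measure R \x @lebesgue_measure R)%E)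
  (@measure_semi_sigma_additive _ _ _ (@lebesgue_measure R \x @lebesgue_measure R)%E).
Lemma ae_lebesgue2 (R : realType) (P : R * R -> Prop) :
  {ae (@lebesgue_measure R \x @lebesgue_measure R)%E, forall p, P p} ->
  {ae lxl R, forall p, P p}.
Proof.
move=> [A [mA A0 AP]]; exists A; split => //.
suff -> : lxl R A = @pleb R A by exact: A0.
apply: product_measure_unique => //= X Y mX mY.
exact: (@product_measure1E _ _ _ _ _ (@lebesgue_measure R) (@lebesgue_measure R)).
Qed.

Lemma ae_lebesgue (R : realType) (P : R -> Prop) :
  {ae @lebesgue_measure R, forall p, P p} -> {ae @leb R, forall p, P p}.
Proof. by move=> [A [mA A0 AP]]; exists A. Qed.

Lemma leb_itv (R : realType) (i : interval R) :
  @leb R [set` i] = (if (i.1 < i.2)%E then ((i.2 : \bar R) - i.1)%E else 0%E).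
Proof. exact: lebesgue_measure_itv. Qed.

(** The transfer in the other direction, to the type on which [lebesgue_measure_unique] is
    stated. *)
Definition borel_copy (R : realType) (m : {measure set R -> \bar R}) :
  set (measurableTypeR R) -> \bar R := m.
HB.instance Definition _ (R : realType) (m : {measure set R -> \bar R}) :=
  isMeasure.Build _ (measurableTypeR R) R (borel_copy m)
  (@measure0 _ _ _ m) (@measure_ge0 _ _ _ m) (@measure_semi_sigma_additive _ _ _ m).

Lemma leb_unique (R : realType) (m : {measure set R -> \bar R}) :
  (forall a b : R, a < b -> m `]a, b]%classic = (b - a)%:E) ->
  forall A, measurable A -> @leb R A = m A.
Proof.
move=> H A mA.
have := @lebesgue_measure_unique R (borel_copy m).
apply => // X /ocitvP[->|[[a b] /= ab ->]]; first by rewrite /borel_copy !measure0.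
by rewrite /borel_copy H// lebesgue_measure_itv /= lte_fin ab EFinB.
Qed.

(** As a function of [A], the left-hand side is a measure that gives half-open intervals their
    length, so [leb_unique] applies. For [c < 0] the preimage is half-open on the other side. *)
Lemma leb_affine (R : realType) (c b : R) (A : set R) : c != 0 -> measurable A ->
  (`|c|%:E * @leb R ((fun x => (c * x + b)%R) @^-1` A) = @leb R A)%E.
Proof.
move=> c0 mA.
pose f x : R := c * x + b.
have mf : measurable_fun setT f.
  by apply: continuous_measurable_fun => x; apply: cvgD; [apply: cvgM|]; apply: cvg_cst || apply: cvg_id.
have := @leb_unique R (mscale (NngNum (normr_ge0 c)) (pushforward (@leb R) f)).
move=> /(_ mf) H; rewrite [RHS]H// => x y xy.
rewrite /mscale/= /pushforward.
suff : (`|c|%:E * @leb R (f @^-1` `]x, y]) = (y - x)%:E)%E by [].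
have c1 : `|c| != 0 by rewrite normr_eq0.
have /orP[cn|cp] := lt_total c0.
- have -> : f @^-1` `]x, y] = [set` `[(y - b) / c, (x - b) / c[].
    apply/seteqP; split => z /=; rewrite !in_itv/= /f ler_ndivrMr// ltr_ndivlMr//; lra.
  rewrite leb_itv/= lte_fin ltr_ndivlMr // divfK ?lt_eqF// ltrBlDr subrK xy.
  rewrite -EFinB -EFinM; congr EFin; rewrite ltr0_norm//; by field.
- have -> : f @^-1` `]x, y] = [set` `](x - b) / c, (y - b) / c]].
    apply/seteqP; split => z /=; rewrite !in_itv/= /f ltr_pdivrMr// ler_pdivlMr//; lra.
  rewrite leb_itv/= lte_fin ltr_pdivrMr // divfK ?gt_eqF// ltrBlDr subrK xy.
  rewrite -EFinB -EFinM; congr EFin; rewrite gtr0_norm//; by field.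
Qed.

(** * Borel sets of the plane and linear changes of variables *)

Section M0.
Variable R : realType.
Notation leb := (@leb R).

(** The product structure only knows rectangles; an open set is the union of the countably many
    squares with rational centre and radius [1 / (n + 1)] that it contains. *)
Lemma open_measurable2 (A : set (R * R)) : open A -> measurable A.
Proof.
move=> oA.
pose B (i : (rat * rat) * nat) : set (R * R) :=
  ball (ratr i.1.1 : R) (i.2.+1%:R^-1) `*` ball (ratr i.1.2 : R) (i.2.+1%:R^-1).
pose D (i : (rat * rat) * nat) : set (R * R) :=
  if `[< B i `<=` A >] then B i else set0.
have -> : A = \bigcup_i D i.
  apply/seteqP; split => [[x y] Axy|[x y] [i _]]; last first.
    by rewrite /D; case: asboolP => // h; exact: h.
  have [e /= e0 eA] := (nbhs_ballP _ _).1 (open_nbhs_nbhs (conj oA Axy)).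
  pose n := Num.bound (2 / e).
  have ne : (n.+1%:R^-1 : R) < e / 2.
    rewrite -[ltRHS]invrK ltf_pV2 ?posrE ?ltr0n ?invr_gt0 ?divr_gt0//.
    rewrite invf_div; apply: lt_trans (archi_boundP _) _.
      by rewrite divr_ge0// ltW.
    by rewrite ltr_nat.
  have n0 : 0 < (n.+1%:R^-1 : R) by [].
  have nn t : t - n.+1%:R^-1 < t + n.+1%:R^-1 :> R by rewrite ltrD2l gtrN.
  have [p] := rat_in_itvoo (nn x).
  have [q] := rat_in_itvoo (nn y).
  rewrite !in_itv/= => qb pb.
  exists ((p, q), n) => //=.
  have BA : B ((p, q), n) `<=` A.
    move=> [s t] [/= ]; rewrite /ball/= => sb tb; apply: eA; split => /=; rewrite /ball/=;
    move: ne sb tb pb qb; rewrite !ltr_distlC; move: (n.+1%:R^-1) => k ne /andP[? ?] /andP[? ?] /andP[? ?] /andP[? ?]; apply/andP; split; lra.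
  rewrite /D; case: asboolP => // _; split; rewrite /= /ball/= ltr_distlC; move: pb qb; move: (n.+1%:R^-1) => k
  /andP[? ?] /andP[? ?]; apply/andP; split; lra.
apply: countable_bigcupT_measurable => [|i]; first exact: countableP.
rewrite /D; case: asboolP => // _; apply: measurableX; apply: measurable_ball.
Qed.

Lemma closed_measurable2 (A : set (R * R)) : closed A -> measurable A.
Proof. by move=> cA; rewrite -[A]setCK; apply: measurableC; apply: open_measurable2; exact: closed_openC. Qed.

Lemma continuous_measurable2 (f : R * R -> R) : continuous f -> measurable_fun setT f.
Proof.
move=> cf; apply: (measurability (@RGenOpens.G R)).
  exact: RGenOpens.measurableE.
move=> _ [B [x [y ->]] <-]; rewrite setTI; apply: open_measurable2.
by apply: open_comp => //; exact: interval_open.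
Qed.

Lemma continuous_measurable22 (f : R * R -> R * R) : continuous f -> measurable_fun setT f.
Proof.
move=> cf; apply/measurable_fun_pairP; split; apply: continuous_measurable2 => z.
  by apply: continuous_comp; [exact: cf|exact: cvg_fst].
by apply: continuous_comp; [exact: cf|exact: cvg_snd].
Qed.

Definition swp (z : R * R) : R * R := (z.2, z.1).

Lemma measurable_swp : measurable_fun setT swp.
Proof. by apply: measurable_fun_pair; [exact: measurable_snd|exact: measurable_fst]. Qed.

Lemma lxl_swp (A : set (R * R)) : measurable A -> lxl R (swp @^-1` A) = lxl R A.
Proof.
move=> mA; have := @product_measure_unique _ _ _ _ _ leb leb (pushforward (lxl R) swp).
move=> /(_ measurable_swp) H; rewrite [RHS]H// => X Y mX mY.
rewrite /pushforward; transitivity (lxl R (Y `*` X)).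
  by congr (lxl R _); apply/seteqP; split => -[x y] [].
by rewrite product_measure1E// muleC.
Qed.

(** By Fubini this is [leb_affine] on each vertical line. Shears in the two directions generate the
    linear maps and translations needed below. *)
Lemma lxl_shear2 (c : R) (b : R -> R) (A : set (R * R)) : c != 0 ->
  measurable_fun setT b -> measurable A ->
  (`|c|%:E * lxl R ((fun z => (z.1, c * z.2 + b z.1)%R) @^-1` A) = lxl R A)%E.
Proof.
move=> c0 mb mA.
have mf : measurable_fun setT (fun z : R * R => (z.1, c * z.2 + b z.1)).
  apply: measurable_fun_pair; first exact: measurable_fst.
  apply: measurable_funD; first by apply: measurable_funM => //; exact: measurable_snd.
  by apply: measurableT_comp => //; exact: measurable_fst.
rewrite /product_measure1 -ge0_integralZl//=.
- apply: eq_integral => x _; rewrite -[RHS](leb_affine (b x) c0) //.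
    exact: measurable_xsection.
- apply: measurable_fun_xsection.
  by rewrite -[X in measurable X]setTI; exact: mf.
Qed.

Lemma lxl_shear1 (c : R) (b : R -> R) (A : set (R * R)) : c != 0 ->
  measurable_fun setT b -> measurable A ->
  (`|c|%:E * lxl R ((fun z => (c * z.1 + b z.2, z.2)%R) @^-1` A) = lxl R A)%E.
Proof.
move=> c0 mb mA.
have mA' : measurable (swp @^-1` A) by rewrite -[X in measurable X]setTI; exact: measurable_swp.
rewrite -(lxl_swp mA) -(lxl_shear2 c0 mb mA') -[in LHS]lxl_swp //.
rewrite -[X in measurable X]setTI.
have mf : measurable_fun setT (fun z : R * R => (c * z.1 + b z.2, z.2)).
  apply: measurable_fun_pair; last exact: measurable_snd.
  apply: measurable_funD; first by apply: measurable_funM => //; exact: measurable_fst.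
  by apply: measurableT_comp => //; exact: measurable_snd.
exact: mf.
Qed.

Lemma measurable_pre (f : R * R -> R * R) (A : set (R * R)) :
  measurable_fun setT f -> measurable A -> measurable (f @^-1` A).
Proof. by move=> mf mA; rewrite -[X in measurable X]setTI; exact: mf. Qed.

Definition cmul (a b : R) (z : R * R) : R * R := (a * z.1 - b * z.2, b * z.1 + a * z.2).

(** Multiplication by [a + i b] is the shear [x -> a x - b y] followed by [y -> d y + (b / a) x]
    with [d = (a^2 + b^2) / a]. This factorisation is the origin of the condition [a != 0] on the
    linear maps used in the area inequality. *)
Lemma lxl_cmul (a b : R) (A : set (R * R)) : a != 0 -> measurable A ->
  ((a ^+ 2 + b ^+ 2)%:E * lxl R (cmul a b @^-1` A) = lxl R A)%E.
Proof.
move=> a0 mA.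
have ab0 : 0 < a ^+ 2 + b ^+ 2 by rewrite ltr_pwDl ?sqr_ge0// exprn_even_gt0.
pose d := (a ^+ 2 + b ^+ 2) / a.
have d0 : d != 0 by rewrite mulf_neq0 ?invr_eq0// gt_eqF.
have ml k : measurable_fun setT (fun x : R => k * x) by exact: measurable_funM.
rewrite -(lxl_shear2 d0 (ml (b / a)) mA).
pose f2 := fun z : R * R => (z.1, d * z.2 + b / a * z.1).
have mf2 : measurable_fun setT f2.
  apply: measurable_fun_pair; apply: continuous_measurable2 => z; first exact: cvg_fst.
  by apply: cvgD; apply: cvgM; (exact: cvg_cst || exact: cvg_fst || exact: cvg_snd).
have := lxl_shear1 a0 (ml (- b)) (measurable_pre mf2 mA).
rewrite -/f2 => <-; rewrite muleA -EFinM -normrM; congr (_%:E * lxl R _)%E.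
  by rewrite /d divfK// ger0_norm// ltW.
apply/seteqP; split => -[x y]; rewrite /cmul /f2 /=; congr (A (_, _)); rewrite /d; by field.
Qed.

Lemma lxl_shift (s t : R) (A : set (R * R)) : measurable A ->
  lxl R ((fun z => (z.1 + s, z.2 + t)) @^-1` A) = lxl R A.
Proof.
move=> mA; rewrite -(lxl_shear2 (oner_neq0 _) (measurable_cst t) mA) normr1 mul1e.
pose f2 := fun z : R * R => (z.1, 1 * z.2 + t).
have mf2 : measurable_fun setT f2.
  apply: measurable_fun_pair; apply: continuous_measurable2 => z; first exact: cvg_fst.
  by apply: cvgD; [apply: cvgM|]; (exact: cvg_cst || exact: cvg_fst || exact: cvg_snd).
have := lxl_shear1 (oner_neq0 _) (measurable_cst s) (measurable_pre mf2 mA).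
rewrite normr1 mul1e -/f2 => <-; congr (lxl R _).
by apply/seteqP; split => -[x y]; rewrite /f2 /= !mul1r.
Qed.

Definition box (c : R * R) (r : R) : set (R * R) :=
  [set z | `|z.1 - c.1| <= r /\ `|z.2 - c.2| <= r].

Lemma boxE c r : box c r = `[c.1 - r, c.1 + r]%classic `*` `[c.2 - r, c.2 + r]%classic.
Proof.
by apply/seteqP; split => -[x y] /=; rewrite /box/= !in_itv/= !ler_distl; 
  move=> [/andP[-> ->] /andP[-> ->]].
Qed.

Lemma measurable_box c r : measurable (box c r).
Proof. by rewrite boxE; apply: measurableX; exact: measurable_itv. Qed.

Lemma lxl_box c r : 0 <= r -> lxl R (box c r) = (4 * r ^+ 2)%:E.
Proof.
move=> r0; rewrite boxE product_measure1E//=.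
rewrite !leb_itv/= !lte_fin; move: r0; rewrite le_eqVlt => /orP[/eqP <-|r0].
  by rewrite !subr0 !addr0 !ltxx mule0 expr0n mulr0.
have h (x : R) : x - r < x + r by lra.
by rewrite !h -!EFinB -EFinM; congr EFin; ring.
Qed.

Definition disc (r : R) : set (R * R) := [set z | z.1 ^+ 2 + z.2 ^+ 2 < r ^+ 2].

Lemma continuous_sq2 : continuous (fun z : R * R => z.1 ^+ 2 + z.2 ^+ 2).
Proof.
move=> z; apply: cvgD; rewrite expr2.
  by under eq_fun do rewrite expr2; apply: cvgM; exact: cvg_fst.
by under eq_fun do rewrite expr2; apply: cvgM; exact: cvg_snd.
Qed.

Lemma open_disc r : open (disc r).
Proof. by apply: (open_comp (D := [set t : R | t < r ^+ 2])) => [z _|]; [exact: continuous_sq2|exact: open_lt]. Qed.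

Lemma measurable_disc r : measurable (disc r).
Proof. by apply: open_measurable2; exact: open_disc. Qed.

Lemma le_lxl (A B : set (R * R)) : measurable A -> measurable B -> A `<=` B ->
  (lxl R A <= lxl R B)%E.
Proof. by move=> mA mB AB; apply: le_measure; rewrite ?inE. Qed.

Lemma disc_box r : 0 <= r -> disc r `<=` box (0, 0) r.
Proof.
by move=> r0 [x y]; rewrite /disc /box /= !subr0 => h; split;
  rewrite -(ler_pXn2r (n := 2)) ?nnegrE// real_normK ?num_real//; nra.
Qed.

Lemma lxl_disc_fin r : lxl R (disc r) \is a fin_num.
Proof.
wlog r0 : r / 0 <= r => [H|].
  have [/H//|r0] := leP 0 r; rewrite (_ : disc r = disc (- r)); last by rewrite /disc sqrrN.
  by apply: H; rewrite oppr_ge0 ltW.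
rewrite ge0_fin_numE//; apply: (le_lt_trans (y := lxl R (box (0,0) r))); last by rewrite lxl_box// ltry.
by apply: le_lxl; [exact: measurable_disc|exact: measurable_box|exact: disc_box].
Qed.

(** The number pi, defined as an area: all the estimates are homogeneous in it, so that its sign and
    the scaling law [lxl_disc] suffice. *)
Definition disc_area : R := fine (lxl R (disc 1)).

Lemma lxl_disc r : lxl R (disc r) = (disc_area * r ^+ 2)%:E.
Proof.
have [->|r0] := eqVneq r 0.
  rewrite (_ : disc 0 = set0) ?measure0 ?expr0n ?mulr0//.
  by apply/seteqP; split => // -[x y]; rewrite /disc /= expr0n/=; nra.
rewrite EFinM /disc_area fineK ?lxl_disc_fin// muleC.
have := lxl_cmul 0 r0 (measurable_disc r); rewrite expr0n addr0 => <-; congr (_ * lxl R _)%E.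
have r2 : 0 < r ^+ 2 by rewrite exprn_even_gt0.
have e (s : R) : (r ^+ 2 * s < r ^+ 2) = (s < 1) by rewrite -[ltRHS]mulr1 ltr_pM2l.
apply/seteqP; split => -[x y]; rewrite /disc /cmul /= !mul0r subr0 add0r !exprMn -mulrDr;
 by rewrite e expr1n.
Qed.

Lemma disc_area_gt0 : 0 < disc_area.
Proof.
rewrite -lte_fin -[disc_area]mulr1 -[X in _ * X](expr1n _ 2) -lxl_disc.
apply: (@lt_le_trans _ _ (lxl R (box (0, 0) (1 / 2)))).
  by rewrite lxl_box ?lte_fin ?divr_ge0//; lra.
apply: le_lxl; [exact: measurable_box|exact: measurable_disc|].
move=> [x y]; rewrite /box /disc /= !subr0 !ler_norml => -[/andP[? ?] /andP[? ?]]; nra.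
Qed.
End M0.

(** * Absolutely continuous functions *)

Section AC1.
Variable R : realType.
Implicit Types (a b : R) (u : R -> R) (s L : seq (R * R)).

(* an interval [[lo, hi]] is encoded as the pair [(hi, lo)] *)
Definition nonoverlap (I J : R * R) := (I.1 <= J.2) || (J.1 <= I.2).
Definition interval_in a b (I : R * R) := [&& a <= I.2, I.2 <= I.1 & I.1 <= b].
Definition nonoverlapping a b s := all (interval_in a b) s && pairwise nonoverlap s.
Definition total_length s := \sum_(I <- s) (I.1 - I.2).
Definition total_increment u s := \sum_(I <- s) `|u I.1 - u I.2|.
(** The real counterpart of [abs_continuous]. Lists replace indexed families because the proofs
    subdivide one interval of the family in place. *)
Definition AC a b u := forall e, 0 < e -> exists2 d, 0 < d &
  forall s, nonoverlapping a b s -> total_length s < d -> total_increment u s < e.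

Lemma total_increment_cat u s L : total_increment u (s ++ L) = total_increment u s + total_increment u L.
Proof. by rewrite /total_increment big_cat. Qed.

Lemma total_length_cat s L : total_length (s ++ L) = total_length s + total_length L.
Proof. by rewrite /total_length big_cat. Qed.

Lemma nonoverlapping_mid a b A B I L : nonoverlapping a b (A ++ I :: B) -> nonoverlapping I.2 I.1 L ->
  nonoverlapping a b (A ++ L ++ B).
Proof.
rewrite /nonoverlapping !all_cat !pairwise_cat /= => /and3P[/and3P[-> /and3P[aI _ Ib] ->]].
rewrite allrel_consr allrel_catr => /andP[AI ->] /and3P[-> IB ->] /andP[LI ->].
rewrite !andbT /=; apply/and3P; split.
- apply: sub_all LI => J /and3P[? h ?]; apply/and3P; split => //.
    exact: le_trans aI _. exact: le_trans Ib.
- apply/allrelP => J K JA KL; move/allP: AI => /(_ _ JA).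
  move/allP: LI => /(_ _ KL)/and3P[h1 h2 h3]; rewrite /nonoverlap => /orP[h|h]; apply/orP.
    by left; exact: le_trans h _.
  by right; exact: le_trans h3 _.
- apply/allrelP => K J KL JB; move/allP: IB => /(_ _ JB).
  move/allP: LI => /(_ _ KL)/and3P[h1 h2 h3]; rewrite /nonoverlap => /orP[h|h]; apply/orP.
    by left; exact: le_trans h3 _.
  by right; exact: le_trans h _.
Qed.

Lemma nonoverlapping_partition p q l : itv_partition p q l ->
  nonoverlapping p q (zip l (p :: l)) /\ total_length (zip l (p :: l)) = q - p.
Proof.
elim: l p => [p [_ /= /eqP <-]|x l IH p H]; first by rewrite /nonoverlapping /total_length big_nil subrr.
have /IH [/andP[h1 h2] h3] := itv_partition_cons H.
have px : p < x by case: H => /= /andP[].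
have xq : x <= q by apply: itv_partition_le (itv_partition_cons H).
rewrite [zip _ _]/=; split; last first.
  by rewrite /total_length big_cons /= -/(total_length _) h3; ring.
rewrite /nonoverlapping /= h2 andbT {1}/interval_in /= lexx (ltW px) xq /=; apply/andP; split.
  apply: sub_all h1 => J /and3P[? ? ?]; apply/and3P; split => //.
  by apply: le_trans (ltW px) _.
by apply: sub_all h1 => J /and3P[xJ ? ?]; rewrite /nonoverlap /= xJ.
Qed.

Lemma nonoverlapping1 a b I : interval_in a b I -> nonoverlapping a b [:: I].
Proof. by rewrite /nonoverlapping /= => ->. Qed.

Notation TV := total_variation.

(** Cutting an interval of the family by a partition changes neither disjointness nor the total
    length. By induction, the last interval of [A] is cut arbitrarily and moved to [B]; the supremum
    over the partitions then turns its increment into its variation. *)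
Lemma total_variation_nonoverlapping a b u (e d : R) :
  (forall s, nonoverlapping a b s -> total_length s < d -> total_increment u s < e) ->
  forall A B, nonoverlapping a b (A ++ B) -> total_length (A ++ B) < d ->
    (\sum_(I <- A) TV I.2 I.1 u + (total_increment u B)%:E <= e%:E)%E.
Proof.
move=> H; elim/last_ind => [B fB tB|A I IH B].
  by rewrite big_nil add0e lee_fin; apply/ltW/H.
rewrite cat_rcons => fB tB.
have I21 : I.2 <= I.1.
  by move: fB; rewrite /nonoverlapping all_cat /= => /andP[/and3P[_ /and3P[]]].
rewrite -cats1 big_cat big_seq1 /=.
have key l : itv_partition I.2 I.1 l ->
    (\sum_(I0 <- A) TV I0.2 I0.1 u + (variation I.2 I.1 u l + total_increment u B)%:E <= e%:E)%E.
  move=> pl; have [fL tL] := nonoverlapping_partition pl.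
  have fm := nonoverlapping_mid fB fL.
  have := IH _ fm; rewrite total_increment_cat [total_increment u (zip _ _)]/total_increment -(variation_zip u pl); apply.
  by move: tB; rewrite !total_length_cat tL /total_length big_cons.
have SA0 : (0 <= \sum_(I0 <- A) TV I0.2 I0.1 u)%E.
  rewrite big_seq; apply: sume_ge0 => J JA; apply: total_variation_ge0.
  move: fB; rewrite /nonoverlapping all_cat => /andP[/andP[/allP /(_ _ JA)/and3P[] //]].
(* One partition is needed to know that the sum over [A] is finite and can be moved to the other
   side. *)
have [l0 pl0] : exists l, itv_partition I.2 I.1 l.
  have [e12|n12] := eqVneq I.2 I.1; first by exists [::]; split => //=; apply/eqP.
  by exists [:: I.1]; apply: itv_partition1; rewrite lt_neqAle n12.
have SAf : (\sum_(I0 <- A) TV I0.2 I0.1 u)%E \is a fin_num.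
  rewrite ge0_fin_numE//; apply: le_lt_trans (ltry e); apply: le_trans (key _ pl0).
  by rewrite leeDl// lee_fin addr_ge0 ?variation_ge0// /total_increment sumr_ge0.
move: SAf key => /fineK <-; set S := fine _ => key.
suff : (TV I.2 I.1 u <= (e - S - total_increment u B)%:E)%E.
  move=> h; apply: (@le_trans _ _ (S%:E + (e - S - total_increment u B)%:E + (total_increment u B)%:E)%E).
    by rewrite leeD2r// leeD2l.
  by rewrite -!EFinD lee_fin; lra.
apply: ge_ereal_sup => _ [_ [l pl <-] <-]; rewrite lee_fin.
by have := key _ pl; rewrite -EFinD lee_fin; lra.
Qed.

(** The interval is cut into equal pieces shorter than the [d] that belongs to [e = 1]; the
    variation on each of them is at most 1. *)
Lemma AC_bounded_variation (a b : R) u : a <= b -> AC a b u -> bounded_variation a b u.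
Proof.
move=> ab ACu; have [d d0 H] := ACu 1 ltr01.
apply/bounded_variationP => //.
pose N := (Num.bound ((b - a) / d)).+1.
pose h := (b - a) / N%:R.
have hd : h < d.
  rewrite /h ltr_pdivrMr ?ltr0n// mulrC -ltr_pdivrMr//.
  apply: lt_trans (archi_boundP _) _; last by rewrite ltr_nat.
  by rewrite divr_ge0// ?subr_ge0// ltW.
have h0 : 0 <= h by rewrite divr_ge0// subr_ge0.
have hN : N%:R * h = b - a by rewrite mulrC divfK// pnatr_eq0.
have key k : (k <= N)%N -> (TV a (a + k%:R * h) u < +oo)%E.
  elim: k => [_|k IH kN]; first by rewrite mul0r addr0 total_variationxx ltry.
  have kb : a + k.+1%:R * h <= b.
    by rewrite -lerBrDl -hN ler_wpM2r// ler_nat.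
  have ka : a <= a + k%:R * h by rewrite lerDl mulr_ge0.
  have kk : a + k%:R * h <= a + k.+1%:R * h by rewrite lerD2l ler_wpM2r// ler_nat.
  rewrite (total_variationD _ ka kk) lte_add_pinfty ?IH ?(ltnW kN)//.
  apply: le_lt_trans (ltry 1).
  have := total_variation_nonoverlapping H (A := [:: (a + k.+1%:R * h, a + k%:R * h)]) (B := [::]).
  rewrite big_seq1 /= /total_increment big_nil adde0; apply.
    by apply: nonoverlapping1; apply/and3P.
  by rewrite /total_length big_seq1 /=; suff -> : a + k.+1%:R * h - (a + k%:R * h) = h by []; rewrite -natr1; ring.
rewrite ge0_fin_numE ?total_variation_ge0//.
by have := key _ (leqnn N); rewrite hN addrC subrK.
Qed.

(** Together with [AC_diff], this writes an absolutely continuous function as a difference of two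
    nondecreasing absolutely continuous ones, to which Radon-Nikodym applies. *)
Lemma AC_total_variation (a b : R) u : a <= b -> AC a b u -> AC a b (fun x => fine (TV a x u)).
Proof.
move=> ab ACu e e0; have e20 : 0 < e / 2 by rewrite divr_gt0.
have [d d0 H] := ACu _ e20; exists d => // s fs ts.
have := total_variation_nonoverlapping H (A := s) (B := [::]); rewrite cats0 /total_increment big_nil adde0 => /(_ fs ts) h.
have BVu := AC_bounded_variation ab ACu.
rewrite -lte_fin; apply: le_lt_trans (_ : ((e / 2)%:E < _)%E); last by rewrite lte_fin; lra.
apply: le_trans h; rewrite -sumEFin big_seq [leRHS]big_seq; apply: lee_sum => I Is.
move: fs => /andP[/allP /(_ _ Is)/and3P[aI I21 Ib] _].
have fx x : a <= x -> x <= b -> TV a x u \is a fin_num.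
  by move=> ax xb; apply/bounded_variationP => //; exact: bounded_variationl xb BVu.
have ab1 : TV a I.1 u = (TV a I.2 u + TV I.2 I.1 u)%E by exact: total_variationD.
have f1 := fx _ (le_trans aI I21) Ib.
have f2 := fx _ aI (le_trans I21 Ib).
have t0 : (0 <= TV I.2 I.1 u)%E by exact: total_variation_ge0.
have f3 : TV I.2 I.1 u \is a fin_num.
  by rewrite ge0_fin_numE//; apply: le_lt_trans (_ : (TV a I.1 u < +oo)%E); [rewrite ab1 leeDr// total_variation_ge0|rewrite -ge0_fin_numE// total_variation_ge0// (le_trans aI)].
rewrite ab1 fineD// [X in `|X|](_ : _ = fine (TV I.2 I.1 u)); last by rewrite addrAC subrr add0r.
by rewrite ger0_norm ?fine_ge0// fineK.
Qed.

Lemma AC_diff a b (u v : R -> R) : AC a b u -> AC a b v -> AC a b (fun x => u x - v x).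
Proof.
move=> hu hv e e0; have e20 : 0 < e / 2 by rewrite divr_gt0.
have [d1 d10 H1] := hu _ e20; have [d2 d20 H2] := hv _ e20.
exists (Num.min d1 d2) => [|s fs]; rewrite lt_min ?d10// => /andP[t1 t2].
have := H1 s fs t1; have := H2 s fs t2 => h2 h1.
apply: (@le_lt_trans _ _ (total_increment u s + total_increment v s)); last by lra.
rewrite /total_increment -big_split /=; apply: ler_sum => I _.
rewrite [X in `|X|](_ : _ = (u I.1 - u I.2) - (v I.1 - v I.2)); last by ring.
exact: ler_normB.
Qed.
End AC1.

(** * Monotone absolutely continuous functions have a density *)

Section AC2.
Variable R : realType.
Notation lam := (@lebesgue_measure R).

Lemma AC_continuous a b (u : R -> R) : AC a b u -> forall e, 0 < e -> exists2 d, 0 < d &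
  forall x y, a <= x -> x <= y -> y <= b -> y - x < d -> `|u y - u x| < e.
Proof.
move=> ACu e e0; have [d d0 H] := ACu e e0; exists d => // x y ax xy yb yx.
have := H [:: (y, x)]; rewrite /total_length /total_increment !big_seq1 /=; apply => //.
by apply: nonoverlapping1; apply/and3P.
Qed.

Lemma open_interval_hull a b (I : set R) : open I -> is_interval I -> I !=set0 ->
  I `<=` `]a, b[%classic -> exists x y, [/\ a <= x, x < y, y <= b, I `<=` `]x, y[%classic & `]x, y[%classic `<=` I].
Proof.
move=> oI iI [z Iz] ID.
have hu : has_ubound I by exists b => t /ID; rewrite /= in_itv/= => /andP[_ /ltW].
have hl : has_lbound I by exists a => t /ID; rewrite /= in_itv/= => /andP[/ltW].
have I0 : I !=set0 by exists z.
have sI : `]inf I, sup I[%classic `<=` I.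
  move=> t /=; rewrite in_itv/= => /andP[it ts].
  have [p Ip pt] := inf_lt I0 it.
  have [q Iq tq] := sup_gt I0 ts.
  by apply: (iI p q) => //; apply/andP; split; exact: ltW.
have Is : I `<=` `]inf I, sup I[%classic.
  move=> t It; rewrite /= in_itv/=.
  have [e /= e0 eI] := (nbhs_ballP _ _).1 (open_nbhs_nbhs (conj oI It)).
  apply/andP; split.
    apply: (@le_lt_trans _ _ (t - e / 2)); last lra.
    apply: ge_inf => //; apply: eI; rewrite /ball/= opprB addrC subrK gtr0_norm; lra.
  apply: (@lt_le_trans _ _ (t + e / 2)); first lra.
  apply: ub_le_sup => //; apply: eI; rewrite /ball/= opprD addNKr normrN gtr0_norm; lra.
exists (inf I), (sup I); split => //.
- by apply: lb_le_inf => // t /ID; rewrite /= in_itv/= => /andP[/ltW].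
- by have := Is _ Iz; rewrite /= in_itv/= => /andP[] /lt_trans; apply.
- by apply: ge_sup => // t /ID; rewrite /= in_itv/= => /andP[_ /ltW].
Qed.

Section mono.
Variables (a b : R) (v : R -> R).
Hypotheses (ab : a < b) (ndv : forall x y, a <= x -> x <= y -> y <= b -> v x <= v y)
  (ACv : AC a b v).

(** [W] extends [v] by constants to the whole line, where Stieltjes measures are defined. *)
Let cl (x : R) := Num.max a (Num.min x b).
Let W x := v (cl x).

Let cl_id x : a <= x -> x <= b -> cl x = x.
Proof. by move=> ax xb; rewrite /cl min_l// max_r. Qed.

Let cl_ge x : a <= cl x. Proof. by rewrite /cl le_max lexx. Qed.

Let cl_le x : cl x <= b. Proof. by rewrite /cl ge_max (ltW ab) ge_min lexx orbT. Qed.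

Let cl_nd x y : x <= y -> cl x <= cl y.
Proof. by move=> xy; rewrite /cl; case: (lerP x b) => ?; case: (lerP y b) => ?; case: (lerP a x) => ?; case: (lerP a y) => ?; case: (lerP a b) => ?; lra. Qed.

Let cl_lip x y : x <= y -> cl y - cl x <= y - x.
Proof. by move=> xy; rewrite /cl; case: (lerP x b) => ?; case: (lerP y b) => ?; case: (lerP a x) => ?; case: (lerP a y) => ?; case: (lerP a b) => ?; lra. Qed.

Let W_nd : nondecreasing W.
Proof. by move=> x y xy; apply: ndv => //; exact: cl_nd. Qed.

Let W_cont : continuous W.
Proof.
move=> x; apply/cvgrPdist_lt => e e0.
have [d d0 H] := AC_continuous ACv e0.
near=> y; have xy : `|x - y| < d by near: y; exact: cvgr_dist_lt.
have [h|h] := leP x y.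
  rewrite distrC; apply: H => //; first exact: cl_nd.
  apply: le_lt_trans (cl_lip h) _; apply: le_lt_trans xy; rewrite distrC; exact: ler_norm.
apply: H => //; first exact/cl_nd/ltW.
apply: le_lt_trans (cl_lip (ltW h)) _; apply: le_lt_trans xy; exact: ler_norm.
Unshelve. all: by end_near. Qed.

Let W_rc : right_continuous W. Proof. exact: right_continuousW. Qed.

Let WC : cumulative R R := HB.pack W (isCumulative.Build R _ R W W_nd W_rc).

Let sls := lebesgue_stieltjes_measure WC.

Let sls_oc x y : x <= y -> sls `]x, y]%classic = (W y - W x)%:E.
Proof.
move=> xy; rewrite /sls /lebesgue_stieltjes_measure /measure_extension measurable_mu_extE/=.
  by rewrite wlength_itv_bnd.
exact: is_ocitv.
Qed.

Let D : set R := `]a, b[%classic.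
Let mD : measurable (D : set (measurableTypeR R)). Proof. exact: measurable_itv. Qed.

Let sD : (sls D < +oo)%E.
Proof.
apply: (@le_lt_trans _ _ (sls `]a, b]%classic)); last by rewrite sls_oc ?ltry// ltW.
apply: le_measure; rewrite ?inE; [exact: measurable_itv|exact: measurable_itv|].
by move=> x; rewrite /D /= !in_itv/= => /andP[h1 h2]; rewrite h1 ltW.
Qed.

Let nu : {finite_measure set (measurableTypeR R) -> \bar R} := mfrestr mD sD.

Let slsI (x y : R) (I : set R) : x <= y -> measurable (I : set (measurableTypeR R)) ->
  I `<=` `]x, y[%classic -> (sls I <= (W y - W x)%:E)%E.
Proof.
move=> xy mI Ixy; rewrite -sls_oc//; apply: le_measure; rewrite ?inE; [exact: mI|exact: measurable_itv|].
by move=> z /Ixy; rewrite /= !in_itv/= => /andP[h1 h2]; rewrite h1 ltW.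
Qed.

(** A null set lies in an open set [U] of measure less than [d]. The components of [U] in []a, b[]
    are disjoint intervals; any finitely many of them have total length below [d], hence total
    increment below [e]. *)
Let nu_dom : nu `<< lam.
Proof.
apply/null_content_dominatesP => N mN N0.
apply/eqP; rewrite eq_le measure_ge0 andbT; apply/lee_addgt0Pr => e e0; rewrite add0e.
have [d d0 H] := ACv e0.
have [U [oU NU muU]] := lebesgue_regularity_outer mN (eq_ind_r (fun t => (t < +oo)%E) (ltry 0) N0) d0.
have lU : (lam U < d%:E)%E.
  rewrite -[X in lam X](setDUK NU).
  apply: le_lt_trans (measureU2 _ mN _) _; first by apply: measurableD => //; exact: open_measurable.
  by rewrite N0 add0e.
pose V := U `&` D.
have oV : open V by apply: openI => //; exact: interval_open.
pose I := open_disjoint_itv oV.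
have oI k : open (I k) := @open_disjoint_itv_open _ _ oV k.
have mI k : measurable (I k : set (measurableTypeR R)) by exact: open_measurable.
have VI : V = \bigcup_q I q := @open_disjoint_itv_bigcup _ _ oV.
have tI : trivIset setT I := @open_disjoint_itv_trivIset _ _ oV.
apply: (@le_trans _ _ (sls V)).
  change (sls (N `&` D) <= sls V)%E.
  apply: le_measure; rewrite ?inE; [by apply: measurableI|exact: open_measurable|].
  by move=> z [/NU ? ?].
have mV : measurable (\bigcup_q I q : set (measurableTypeR R)) by rewrite -VI; exact: open_measurable.
rewrite VI [leLHS](@measure_semi_bigcup _ _ _ (lebesgue_stieltjes_measure WC) I mI tI mV).
apply: lime_le; first by apply: is_cvg_nneseries => *; exact: measure_ge0.
near=> n.
have ID k : I k `<=` `]a, b[%classic.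
  by move=> z Iz; suff [] : V z by []; rewrite VI; exists k.
(* [p k] encodes the component [I k] by its endpoints. The default [(0, 0)] for an empty component
   is discarded by the filter in [ks]. *)
have [p pP] : exists p : nat -> R * R, forall k, I k !=set0 ->
    [/\ interval_in a b (p k), (p k).2 < (p k).1, I k `<=` `](p k).2, (p k).1[%classic
      & `](p k).2, (p k).1[%classic `<=` I k].
  suff /choice[p pP] : forall k, exists q : R * R, I k !=set0 ->
    [/\ interval_in a b q, q.2 < q.1, I k `<=` `]q.2, q.1[%classic
      & `]q.2, q.1[%classic `<=` I k] by exists p.
  move=> k; have [I0|I0] := pselect (I k !=set0); last by exists (0, 0).
  have [x [y [ax xy yb h1 h2]]] :=
    open_interval_hull (oI k) (open_disjoint_itv_is_interval (oU := oV) (i := k)) I0 (ID k).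
  by exists (y, x) => _; split => //; rewrite /interval_in /= ax yb ltW.
pose ks := [seq k <- iota 0 n | `[<I k !=set0>]].
have ksP k : k \in ks -> I k !=set0 by rewrite mem_filter => /andP[/asboolP].
have famp : nonoverlapping a b (map p ks).
  rewrite /nonoverlapping all_map pairwise_map; apply/andP; split.
    by apply/allP => k /ksP /pP[].
  have : pairwise [rel x y | x != y] ks by rewrite -uniq_pairwise filter_uniq ?iota_uniq.
  apply: sub_in_pairwise (allss ks) => k l kk lk /= kl.
  have [_ k21 _ kI] := pP _ (ksP _ kk).
  have [_ l21 _ lI] := pP _ (ksP _ lk).
  rewrite /relpre /= /nonoverlap; apply/negPn/negP; rewrite negb_or -!ltNge => /andP[h1 h2].
  move/trivIsetP : tI => /(_ k l Logic.I Logic.I kl); apply/eqP/set0P.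
  pose t := (Num.max (p k).2 (p l).2 + Num.min (p k).1 (p l).1) / 2.
  have : Num.max (p k).2 (p l).2 < Num.min (p k).1 (p l).1.
    by rewrite gt_max !lt_min k21 h1 h2 l21.
  exists t; split; [apply: kI|apply: lI]; rewrite /= in_itv/= /t; move: h1 h2 k21 l21;
    case: (lerP (p k).2 (p l).2) => ?; case: (lerP (p k).1 (p l).1) => ? *; apply/andP; split; lra.
have totp : total_length (map p ks) < d.
  rewrite -lte_fin; apply: le_lt_trans lU.
  apply: (@le_trans _ _ (lam V)); last first.
    by apply: le_measure; rewrite ?inE; [exact: open_measurable|exact: open_measurable|move=> z []].
  rewrite VI [leRHS](@measure_semi_bigcup _ _ _ lam I mI tI mV).
  apply: le_trans (nneseries_lim_ge n _); last by move=> *; exact: measure_ge0.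
  rewrite /total_length big_map big_filter -sumEFin /index_iota subn0 [leRHS](bigID (fun k => `[<I k !=set0>])) /=.
  apply: le_trans (leeDl _ _); last by apply: sume_ge0 => *; exact: measure_ge0.
  apply: lee_sum => k /asboolP /pP[_ k21 _ kI].
  apply: (@le_trans _ _ (lam `](p k).2, (p k).1[%classic)).
    by rewrite lebesgue_measure_itv/= lte_fin k21 EFinB.
  by apply: le_measure; rewrite ?inE; [exact: measurable_itv|exact: mI|exact: kI].
apply: (@le_trans _ _ (total_increment v (map p ks))%:E); last by rewrite lee_fin; exact/ltW/H.
rewrite /total_increment big_map big_filter -sumEFin /index_iota subn0 [leLHS](bigID (fun k => `[<I k !=set0>])) /=.
rewrite [X in (_ + X)%E]big1 ?adde0; last first.
  by move=> k /asboolP/set0P/negP/negPn/eqP ->; exact: measure0.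
apply: lee_sum => k /asboolP /pP[/and3P[h1 h2 h3] k21 Ik kI].
apply: le_trans (slsI (ltW k21) (mI k) Ik) _.
rewrite lee_fin /W !cl_id ?(le_trans h1)//; first exact: ler_norm.
exact: le_trans h3.
Unshelve. all: by end_near. Qed.

(** Radon-Nikodym for [nu]. The endpoint [b] is excluded because [nu] lives on the open interval. *)
Lemma AC_nondecreasing_density : exists f : R -> R, lam.-integrable setT (EFin \o f) /\
  forall x, a <= x -> x < b -> (\int[lam]_(t in `]a, x]) (f t)%:E = (v x - v a)%:E)%E.
Proof.
have [f [f0 ff fint fE]] := radon_nikodym_sigma_finite nu_dom.
have fineE : EFin \o (fine \o f) = f by apply/funext => x /=; rewrite fineK.
exists (fine \o f); split; first by rewrite fineE.
move=> x ax xb; under eq_integral do rewrite fineK//.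
rewrite -fE; last exact: measurable_itv.
rewrite /nu /= /mfrestr /mrestr.
have -> : (`]a, x] `&` D)%classic = `]a, x]%classic.
  apply/seteqP; split => [z []//|z zx]; split => //; move: zx; rewrite /D /= !in_itv/= => /andP[-> h].
  exact: le_lt_trans xb.
rewrite -/sls sls_oc// /W !cl_id//; exact/ltW.
Qed.

End mono.

End AC2.

Section bridge.
Variable R : realType.
Notation lam := (@lebesgue_measure R).
Notation leb := (@leb R).

Lemma ge0_integral_leb (D : set R) (f : R -> \bar R) : measurable D ->
  measurable_fun D f -> (forall x, D x -> 0 <= f x)%E ->
  (\int[leb]_(x in D) f x = \int[lam]_(x in D) f x)%E.
Proof.
move=> mD mf f0.
have mid : measurable_fun setT (idfun : measurableTypeR R -> R).
  by move=> _ B mB; rewrite setTI; exact: mB.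
have := @ge0_integral_pushforward _ _ (measurableTypeR R) R R _ mid lam D f mD mf.
rewrite /= => <-; last by move=> x; rewrite inE => /f0.
by apply: eq_measure_integral => B mB BD.
Qed.

Lemma integral_leb (D : set R) (f : R -> \bar R) : measurable D ->
  measurable_fun D f ->
  (\int[leb]_(x in D) f x = \int[lam]_(x in D) f x)%E.
Proof.
move=> mD mf; rewrite integralE [RHS]integralE; congr (_ - _)%E; apply: ge0_integral_leb => //.
  exact: measurable_funepos.
exact: measurable_funeneg.
Qed.

Lemma integrable_leb (D : set R) (f : R -> \bar R) : measurable D ->
  lam.-integrable D f -> leb.-integrable D f.
Proof.
move=> mD /integrableP[mf fi]; apply/integrableP; split; first exact: mf.
by rewrite ge0_integral_leb//; apply: measurableT_comp => //; exact: mf.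
Qed.
End bridge.

Section AC3.
Variable R : realType.
Notation lam := (@lebesgue_measure R).
Notation leb := (@leb R).
Notation TV := total_variation.

Lemma AC_density_lam (a b : R) u : a < b -> AC a b u ->
  exists f : R -> R, lam.-integrable setT (EFin \o f) /\
  forall x, a <= x -> x < b -> (\int[lam]_(t in `]a, x]) (f t)%:E = (u x - u a)%:E)%E.
Proof.
move=> ab ACu; pose V x := fine (TV a x u).
have ACV : AC a b V := AC_total_variation (ltW ab) ACu.
have BVu := AC_bounded_variation (ltW ab) ACu.
have fx x : a <= x -> x <= b -> TV a x u \is a fin_num.
  by move=> ax xb; apply/bounded_variationP => //; exact: bounded_variationl xb BVu.
have VE x y : a <= x -> x <= y -> y <= b -> `|u y - u x| <= V y - V x.
  move=> ax xy yb; have ay := le_trans ax xy; have xb := le_trans xy yb.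
  rewrite -lee_fin EFinB !fineK ?fx// (total_variationD u ax xy) addeAC subee ?fx// add0e.
  exact: total_variation_ge.
have V_nd x y : a <= x -> x <= y -> y <= b -> V x <= V y.
  by move=> ax xy yb; rewrite -subr_ge0; apply: le_trans (VE _ _ ax xy yb).
have [f [fi fE]] := AC_nondecreasing_density ab V_nd ACV.
have [|g [gi gE]] := @AC_nondecreasing_density _ a b (fun x => V x - u x) ab _ (AC_diff ACV ACu).
  by move=> x y ax xy yb; have := VE _ _ ax xy yb; rewrite ler_norml => /andP[]; lra.
exists (f \- g); split.
  have -> : EFin \o (f \- g) = ((EFin \o f) \- (EFin \o g))%E by apply/funext => x.
  exact: integrableB.
move=> x ax xb; under eq_integral do rewrite EFinB.
rewrite integralB//=.
- by rewrite fE// gE// -EFinB; congr EFin; ring.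
- exact: integrableS measurableT _ _ fi.
- exact: integrableS measurableT _ _ gi.
Qed.

(** Near an interior point [u] is a constant plus the primitive of [f], so Lebesgue's
    differentiation theorem yields the derivative. *)
Lemma AC_density (a b : R) u : a < b -> AC a b u ->
  exists f : R -> R, [/\ leb.-integrable setT (EFin \o f),
    forall x, a <= x -> x < b -> (\int[leb]_(t in `]a, x]) (f t)%:E = (u x - u a)%:E)%E &
    {ae leb, forall x, a < x < b -> is_derive x 1 u (f x)}].
Proof.
move=> ab ACu; have [f [fi fE]] := AC_density_lam ab ACu.
have mf : measurable_fun setT (EFin \o f) by case/integrableP: fi.
exists f; split; first exact: integrable_leb.
  move=> x ax xb; rewrite integral_leb ?fE//; exact: measurable_funS mf.
apply: ae_lebesgue.
have lf : locally_integrable setT f by apply: open_integrable_locally => //; exact: openT.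
have fiy (y : R) : lam.-integrable [set` Interval (BRight a) (BRight y)] (EFin \o f).
  by apply: integrableS fi => //; exact: measurable_itv.
have /= := @FTC1 R f (BRight a) fiy lf.
apply: filterS; first exact: (ae_filter_ringOfSetsType lam).
move=> x H /andP[ax xb]; have [dF FE] := H ltac:(by rewrite lte_fin).
set F := (X in derivable X x 1) in dF FE.
have uF : \forall y \near x, u y = u a + F y.
  near=> y; have /andP[ay yb] : a < y < b.
    by near: y; apply: near_in_itvoo; rewrite in_itv/= ax.
  have h : F y = u y - u a by exact: (congr1 fine (fE y (ltW ay) yb)).
  by rewrite h addrC subrK.
apply: (@near_eq_is_derive _ _ _ (fun y => u a + F y)).
- by near=> y; apply/esym; near: y.
have h : is_derive x 1 F (f x) by apply: DeriveDef; [exact: dF|rewrite -derive1E].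
by rewrite -[f x]add0r; apply: is_deriveD.
Unshelve. all: by end_near. Qed.
End AC3.

Section AC5.
Variable R : realType.
Notation leb := (@leb R).
Implicit Types (a b : R) (u v w g : R -> R).

Lemma nonoverlapping_sub a b a' b' s : a <= a' -> b' <= b -> nonoverlapping a' b' s -> nonoverlapping a b s.
Proof.
move=> aa bb /andP[h1 h2]; rewrite /nonoverlapping h2 andbT; apply: sub_all h1 => I /and3P[h1 h h3].
by apply/and3P; split => //; [exact: le_trans h1|exact: le_trans h3 _].
Qed.

Lemma AC_subinterval a b a' b' u : a <= a' -> b' <= b -> AC a b u -> AC a' b' u.
Proof. by move=> aa bb H e e0; have [d d0 h] := H e e0; exists d => // s /(nonoverlapping_sub aa bb); exact: h. Qed.

Lemma AC_bounded a b u : a <= b -> AC a b u ->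
  exists2 M, 0 <= M & forall x, a <= x -> x <= b -> `|u x| <= M.
Proof.
move=> ab ACu; have BVu := AC_bounded_variation ab ACu.
have fx x : a <= x -> x <= b -> total_variation a x u \is a fin_num.
  by move=> ax xb; apply/bounded_variationP => //; exact: bounded_variationl xb BVu.
exists (`|u a| + fine (total_variation a b u)).
  by rewrite addr_ge0// fine_ge0// total_variation_ge0.
move=> x ax xb; rewrite -[u x](subrK (u a)) addrC; apply: le_trans (ler_normD _ _) _.
rewrite lerD2l -lee_fin fineK ?fx//; apply: le_trans (total_variation_ge _ ax) _.
by rewrite (total_variationD u ax xb) leeDl// total_variation_ge0.
Qed.

(** A single criterion for sums, products, translates and clamped distances: the increments of [g]
    are dominated by those of two absolutely continuous functions. *)
Lemma AC_lip2 a b u v g C : 0 <= C -> AC a b u -> AC a b v ->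
  (forall x y, a <= x -> x <= y -> y <= b -> `|g y - g x| <= C * (`|u y - u x| + `|v y - v x|)) ->
  AC a b g.
Proof.
move=> C0 hu hv H e e0.
have k0 : 0 < 2 * C + 1 by lra.
have e20 : 0 < e / (2 * C + 1) by rewrite divr_gt0.
have [d1 d10 H1] := hu _ e20; have [d2 d20 H2] := hv _ e20.
exists (Num.min d1 d2) => [|s fs]; rewrite lt_min ?d10// => /andP[t1 t2].
have h1 := H1 s fs t1; have h2 := H2 s fs t2.
apply: (@le_lt_trans _ _ (C * (total_increment u s + total_increment v s))).
  rewrite /total_increment -big_split /= mulr_sumr big_seq [leRHS]big_seq; apply: ler_sum => I Is.
  by apply: H; move: fs => /andP[/allP /(_ _ Is)/and3P[]].
apply: (@le_lt_trans _ _ (C * (e / (2 * C + 1) + e / (2 * C + 1)))).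
  by rewrite ler_wpM2l// lerD// ltW.
rewrite [ltLHS](_ : _ = e * (2 * C / (2 * C + 1))); last by field; rewrite gt_eqF.
by rewrite -[ltRHS]mulr1 ltr_pM2l// ltr_pdivrMr// mul1r; lra.
Qed.

Lemma lip_AC a b w K : 0 <= K ->
  (forall x y, a <= x -> x <= y -> y <= b -> `|w y - w x| <= K * (y - x)) -> AC a b w.
Proof.
move=> K0 H e e0; exists (e / (K + 1)) => [|s fs ts]; first by rewrite divr_gt0//; lra.
apply: (@le_lt_trans _ _ (K * total_length s)).
  rewrite /total_increment mulr_sumr big_seq [leRHS]big_seq; apply: ler_sum => I Is.
  by apply: H; move: fs => /andP[/allP /(_ _ Is)/and3P[]].
apply: (@le_lt_trans _ _ (K * (e / (K + 1)))); first by rewrite ler_wpM2l// ltW.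
rewrite mulrCA -[ltRHS]mulr1 ltr_pM2l// ltr_pdivrMr ?mul1r; lra.
Qed.

Lemma AC_mul a b u w : a <= b -> AC a b u -> AC a b w -> AC a b (fun x => u x * w x).
Proof.
move=> ab hu hw; have [M M0 HM] := AC_bounded ab hu; have [B B0 HB] := AC_bounded ab hw.
apply: (@AC_lip2 a b u w _ (M + B)) => //; first by rewrite addr_ge0.
move=> x y ax xy yb; have ay := le_trans ax xy; have xb := le_trans xy yb.
rewrite [X in `|X|](_ : _ = (u y - u x) * w y + u x * (w y - w x)); last by ring.
apply: le_trans (ler_normD _ _) _; rewrite !normrM mulrDl addrC.
have := HM _ ax xb; have := HB _ ay yb => h1 h2.
have := normr_ge0 (u y - u x); have := normr_ge0 (w y - w x); nra.
Qed.

(** The density of [AC_density] coincides with [du] almost everywhere, by uniqueness of derivatives.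
    The margins [a < p] and [q < b] keep []p, q]] inside the open interval where both are known. *)
Lemma AC_integral a b u p q (du : R -> R) : AC a b u -> a < p -> p <= q -> q < b ->
  measurable_fun `]p, q] du -> {ae leb, forall x, a < x < b -> is_derive x 1 u (du x)} ->
  leb.-integrable `]p, q] (EFin \o du) /\
  (\int[leb]_(x in `]p, q]) (du x)%:E = (u q - u p)%:E)%E.
Proof.
move=> ACu ap pq qb mdu Hdu; have ab : a < b by lra.
have [f [fi fE fd]] := AC_density ab ACu.
have fipq : leb.-integrable `]p, q] (EFin \o f) by apply: integrableS fi.
have mf : measurable_fun `]p, q] f by apply/measurable_EFinP; case/integrableP: fipq.
have aeE : ae_eq leb `]p, q]%classic (EFin \o f) (EFin \o du).
  near=> x => /=; rewrite in_itv/= => /andP[px xq]; congr EFin.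
  have h : a < x < b by apply/andP; split; lra.
  have h1 : is_derive x 1 u (f x) by apply: (near fd x).
  have h2 : is_derive x 1 u (du x) by apply: (near Hdu x).
  have e1 : 'D_1 u x = f x by exact: (@derive_val _ _ _ _ _ _ _ h1).
  by rewrite -e1; exact: (@derive_val _ _ _ _ _ _ _ h2).
have mdu' : measurable_fun `]p, q] (EFin \o du) by exact/measurable_EFinP.
have mf' : measurable_fun `]p, q] (EFin \o f) by exact/measurable_EFinP.
split.
  apply/integrableP; split => //; case/integrableP: fipq => _.
  congr (_ < _)%E; apply: ae_eq_integral => //; [exact: measurableT_comp|exact: measurableT_comp|].
  exact: ae_eq_abse.
transitivity (\int[leb]_(x in `]p, q]) (f x)%:E)%E; first by apply/esym/ae_eq_integral.
have fiq : leb.-integrable `]a, q] (EFin \o f) by apply: integrableS fi.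
have : (\int[leb]_(x in `]a, q]) (f x)%:E = \int[leb]_(x in `]a, p]) (f x)%:E + \int[leb]_(x in `]p, q]) (f x)%:E)%E.
  rewrite (@itv_bndbnd_setU _ _ _ (BRight p)) ?bnd_simp//; last exact: ltW.
  rewrite integral_setU//=.
    by rewrite -itv_bndbnd_setU ?bnd_simp// ?ltW//; case/integrableP: fiq.
  by apply/disj_setPRL => z/=; rewrite !in_itv/= => /andP[? ?]; case/andP => ? ?; lra.
have ab' : a <= p by lra.
have pb : p < b by lra.
rewrite (fE _ (le_trans ab' pq) qb) (fE _ ab' pb).
have hf : (\int[leb]_(x in `]p, q]) (f x)%:E)%E \is a fin_num by apply: integrable_fin_num.
rewrite -(fineK hf) -EFinD => -[h]; congr EFin; lra.
Unshelve. all: by end_near. Qed.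
End AC5.

(** * Functions absolutely continuous on lines *)

Section D2.
Variable R : realType.
Notation leb := (@leb R).
Implicit Types (w g : R * R -> R).

(* [ACLx], [ACLy]: absolute continuity on almost every horizontal, vertical line *)
Definition ACLx w := {ae leb, forall y, forall n : nat,
  AC (- n%:R) n%:R (fun x => w (x, y))}.

(* an upper limit of difference quotients: it is measurable for continuous [w],
   and it is the partial derivative in [x] where that exists (junk elsewhere) *)
Definition Dx w (z : R * R) : R :=
  fine (limn_esup (fun n => ((w (z.1 + n.+1%:R^-1, z.2) - w z) * n.+1%:R)%:E)).

Lemma closed_le2 (f : R * R -> R) (c : R) : continuous f -> closed [set z | f z <= c].
Proof.
move=> cf; rewrite -openC.
have -> : ~` [set z | f z <= c] = f @^-1` [set t | c < t].
  by apply/seteqP; split => z /=; rewrite ltNge => /negP.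
by apply: open_comp => [z _|]; [exact: cf|exact: open_gt].
Qed.

Lemma continuous_shift w (s t : R) : continuous w ->
  continuous (fun z : R * R => w (z.1 + s, z.2 + t)).
Proof.
move=> cw z; apply: (@cvg_comp _ _ _ (fun z : R * R => (z.1 + s, z.2 + t)) w _ (nbhs (z.1 + s, z.2 + t))); last exact: cw.
apply: (@cvg_pair _ _ _ (nbhs z) (nbhs (z.1 + s)) (nbhs (z.2 + t)) _ _ _ (fun z : R * R => z.1 + s) (fun z : R * R => z.2 + t)).
  by apply: cvgD; [exact: cvg_fst|exact: cvg_cst].
by apply: cvgD; [exact: cvg_snd|exact: cvg_cst].
Qed.

Lemma continuous_swp w : continuous w -> continuous (w \o @swp R).
Proof.
move=> cw z; apply: (@cvg_comp _ _ _ (@swp R) w _ (nbhs (swp z))); last exact: cw.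
by apply: (@cvg_pair _ _ _ (nbhs z) (nbhs z.2) (nbhs z.1) _ _ _ snd fst); [exact: cvg_snd|exact: cvg_fst].
Qed.

Lemma measurable_Dx w : continuous w -> measurable_fun setT (Dx w).
Proof.
move=> cw; apply: measurableT_comp => //.
apply: measurable_fun_limn_esup => n; apply/measurable_EFinP.
apply: measurable_funM => //; apply: measurable_funB; last exact: continuous_measurable2.
apply: continuous_measurable2 => z.
have := @continuous_shift w (n.+1%:R^-1) 0 cw z.
by under [X in continuous_at _ X]eq_fun do rewrite addr0.
Qed.

Lemma invn_lt (e : R) : 0 < e -> exists n : nat, (n.+1%:R^-1 : R) < e.
Proof.
move=> e0; exists (Num.bound (e^-1)).
rewrite -[ltRHS]invrK ltf_pV2 ?posrE ?ltr0n ?invr_gt0//.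
by apply: lt_trans (archi_boundP _) _; rewrite ?invr_ge0 ?ltW// ltr_nat.
Qed.

Lemma invn_lt_le (e : R) (n m : nat) : (n.+1%:R^-1 : R) < e -> (n <= m)%N -> (m.+1%:R^-1 : R) < e.
Proof. by move=> h nm; apply: le_lt_trans h; rewrite lef_pV2 ?posrE ?ltr0n// ler_nat. Qed.

Lemma quotE (a e t d : R) : t != 0 ->
  (`|d - t^-1 *: a| <= e) = (`|a - t * d| <= e * `|t|).
Proof.
move=> t0; have tn : 0 < `|t| by rewrite normr_gt0.
rewrite -(ler_pM2r tn) -normrM -normrN; congr (`|_| <= _).
by rewrite /GRing.scale /=; field.
Qed.

Lemma is_derive_quot (f : R -> R) (x d : R) : is_derive x 1 f d ->
  forall e, 0 < e -> exists2 r, 0 < r & forall t, `|t| < r ->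
    `|f (x + t) - f x - t * d| <= e * `|t|.
Proof.
move=> [df fd] e e0.
have /cvgrPdist_le/(_ _ e0) := df; rewrite -/('D_1 f x) fd.
rewrite /dnbhs near_withinE => /nbhs_ballP[r /= r0 H]; exists r => // t tr.
have [->|t0] := eqVneq t 0; first by rewrite addr0 subrr mul0r subr0 normr0 mulr0.
have := H t; rewrite /ball /= sub0r normrN => /(_ tr t0).
by rewrite scaler1 /shift /= [t + x]addrC quotE.
Qed.

Lemma Dx_derive w (x y d : R) : is_derive x 1 (fun t => w (t, y)) d -> Dx w (x, y) = d.
Proof.
move=> /is_derive_quot H; rewrite /Dx /=.
suff h : ((w (x + n.+1%:R^-1, y) - w (x, y)) * n.+1%:R)%:E @[n --> \oo] --> d%:E.
  by rewrite (cvg_limn_einf_sup h).2.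
apply/cvg_EFin; first by near=> n.
apply/cvgrPdist_le => e e0; have [r r0 h] := H e e0.
have [n0 hn0] := invn_lt r0.
near=> n; have nr : `|n.+1%:R^-1 : R| < r.
  rewrite ger0_norm ?invr_ge0//; apply: invn_lt_le hn0 _; near: n; exact: nbhs_infty_ge.
have := h _ nr; rewrite -quotE ?invr_eq0 ?pnatr_eq0// invrK /= => hh.
by apply: le_trans hh; rewrite /GRing.scale /= mulrC.
Unshelve. all: by end_near. Qed.

(** Derivability means that for every [k] some rational slope [L] approximates the increments up to
    [|t| / (k + 1)] at some scale [1 / (m + 1)]. The parameters are countable, and each [P k m L] is
    closed because [w] is continuous. *)
Lemma measurable_derivable w : continuous w ->
  measurable [set z : R * R | derivable (fun t => w (t, z.2)) z.1 1].
Proof.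
move=> cw.
have dlt (d kk : R) : 0 < kk -> d - kk < d + kk by move=> ?; lra.
pose P (k m : nat) (L : rat) : set (R * R) := [set z | forall t, `|t| <= m.+1%:R^-1 ->
  `|w (z.1 + t, z.2) - w z - t * ratr L| <= k.+1%:R^-1 * `|t|].
have cP k m L : closed (P k m L).
  rewrite (_ : P k m L = \bigcap_(t in [set t | `|t| <= m.+1%:R^-1])
    [set z | `|w (z.1 + t, z.2) - w z - t * ratr L| <= k.+1%:R^-1 * `|t|]); last first.
    by apply/seteqP; split => z h t; apply: h.
  apply: closed_bigI => t _; apply: closed_le2 => z.
  apply: cvg_norm; apply: cvgB; last exact: cvg_cst.
  apply: cvgB; last exact: cw.
  have := @continuous_shift w t 0 cw z.
  by under [X in continuous_at _ X]eq_fun do rewrite addr0.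
rewrite (_ : [set z | _] = \bigcap_k \bigcup_m \bigcup_L P k m L); last first.
  apply/seteqP; split => [[x y]/= dw k _|[x y] H].
    have k0 : 0 < (k.+1%:R^-1 / 2 : R) by rewrite divr_gt0.
    have [d dd] : exists d : R, is_derive x 1 (fun t => w (t, y)) d by eexists; exact: (DeriveDef dw erefl).
    have [r r0 h] := is_derive_quot dd k0.
    have [m hm] := invn_lt r0.
    have [L] := @rat_in_itvoo R (d - k.+1%:R^-1 / 2) (d + k.+1%:R^-1 / 2) (dlt _ _ k0).
    rewrite in_itv /= => /andP[L1 L2].
    exists m => //; exists L => // t tm.
    have := h t (le_lt_trans tm hm) => {}h.
    rewrite [X in `|X|](_ : _ = (w (x + t, y) - w (x, y) - t * d) + t * (d - ratr L)); last by ring.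
    apply: le_trans (ler_normD _ _) _; rewrite normrM.
    have : `|d - ratr L| <= k.+1%:R^-1 / 2 by rewrite ler_norml; apply/andP; split; move: (k.+1%:R^-1) L1 L2 => kk ? ?; lra.
    have := normr_ge0 t; move: h; move: (k.+1%:R^-1) => kk; nra.
  apply: cauchy_cvg; apply: cauchy_exP => e e0.
  have [k hk] := invn_lt e0; have [m _ [L _ h]] := H k Logic.I.
  have key : \forall t \near (0 : R)^', t != 0 /\ `|t| < m.+1%:R^-1.
    near=> t; split; near: t; first exact: nbhs_dnbhs_neq.
    by apply: dnbhs0_lt; rewrite invr_gt0.
  exists (ratr L); apply: filterS key => t [t0 tm].
  rewrite /ball /=.
  have := h t (ltW tm); rewrite /= => {}h; apply: le_lt_trans hk.
  by rewrite scaler1 /shift /= [t + x]addrC quotE.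
apply: bigcapT_measurable => k; apply: bigcupT_measurable => m.
by apply: bigcupT_measurable_rat => L; apply: closed_measurable2.
Unshelve. all: by end_near. Qed.
End D2.

(** * Integration by parts *)

Section F2.
Variable R : realType.
Notation leb := (@leb R).
Implicit Types (w g : R * R -> R).

(** The product measure integrates the measures of the vertical sections; the coordinates are
    exchanged in order to use the horizontal ones. *)
Lemma null_ysec (A : set (R * R)) : measurable A ->
  {ae leb, forall y, {ae leb, forall x, ~ A (x, y)}} -> lxl R A = 0%E.
Proof.
move=> mA H; have mA' : measurable (@swp R @^-1` A).
  by apply: measurable_pre => //; exact: measurable_swp.
rewrite -(lxl_swp mA) /product_measure1.
rewrite (ge0_ae_eq_integral (g := cst 0%E)) ?integral0//=.
  exact: measurable_fun_xsection.
have : {ae leb, forall y, leb [set x | A (x, y)] = 0%E}.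
  near=> y; have Hy : {ae leb, forall x, ~ A (x, y)} by apply: (near H y).
  have mAy : measurable [set x | A (x, y)].
    by rewrite (_ : [set x | _] = ysection A y); [exact: measurable_ysection|rewrite /ysection; apply/seteqP; split => x /=; rewrite inE].
  case: Hy => B [mB B0 AB].
  apply/eqP; rewrite eq_le measure_ge0 andbT -B0; apply: le_measure; rewrite ?inE//.
  by move=> x Ax; apply: AB => /=; exact.
apply: filterS => y h _; rewrite /= -h; congr (leb _).
by apply/seteqP; split => x /=; rewrite /xsection /= inE.
Unshelve. all: by end_near. Qed.

(** Going from almost every line to almost every point needs a measurable set; for differentiability
    it is provided by [measurable_derivable]. *)
Lemma ae_ysec (P : R * R -> Prop) : measurable [set z | P z] ->
  {ae leb, forall y, {ae leb, forall x, P (x, y)}} -> {ae lxl R, forall z, P z}.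
Proof.
move=> mP H; exists (~` [set z | P z]); split => //; first exact: measurableC.
apply: null_ysec; first exact: measurableC.
apply: filterS H => y; apply: filterS => x Px; exact.
Qed.

Definition dx_ok w (z : R * R) : Prop :=
  is_derive (z.1 : R) (1 : R) (fun t : R => w (t, z.2)) (Dx w z).

Lemma ACx_derivable w (y : R) : (forall n : nat, AC (- n%:R) n%:R (fun x => w (x, y))) ->
  {ae leb, forall x, dx_ok w (x, y)}.
Proof.
move=> H.
have : {ae leb, forall x, forall n : nat, - n.+1%:R < x < n.+1%:R -> dx_ok w (x, y)}.
  apply: ae_foralln => n; have n0 : - n.+1%:R < n.+1%:R :> R by rewrite gtrN.
  have [f [_ _ +]] := AC_density n0 (H n.+1); apply: filterS => x h /h dx.
  by rewrite /dx_ok (Dx_derive dx).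
apply: filterS => x; apply; rewrite -ltr_norml.
have : `|x| < (Num.bound `|x|)%:R by apply: archi_boundP.
by move=> /lt_trans; apply; rewrite ltr_nat.
Qed.

Lemma dx_okE w : dx_ok w = fun z => derivable (fun t : R => w (t, z.2)) z.1 1.
Proof.
apply/funext => -[x y]; apply/propext; split => [[]//|h].
have dd : is_derive (x : R) (1 : R) (fun t : R => w (t, y)) ('D_1 (fun t : R => w (t, y)) x) by exact: (DeriveDef h erefl).
by rewrite /dx_ok (Dx_derive dd).
Qed.

Lemma measurable_dx_ok w : continuous w -> measurable [set z | dx_ok w z].
Proof. by move=> cw; rewrite dx_okE; exact: measurable_derivable. Qed.

Lemma ae_derivable w : continuous w -> ACLx w -> {ae lxl R, forall z, dx_ok w z}.
Proof.
move=> cw H; apply: ae_ysec; first exact: measurable_dx_ok.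
by apply: filterS H => y; exact: ACx_derivable.
Qed.

Definition rect (p q : R * R) : set (R * R) :=
  `]p.1, q.1]%classic `*` `]p.2, q.2]%classic.

Lemma measurable_rect p q : measurable (rect p q).
Proof. by apply: measurableX; exact: measurable_itv. Qed.

Lemma bound_nat (x : R) : exists n : nat, `|x| < n%:R.
Proof. by exists (Num.bound `|x|); apply: archi_boundP. Qed.

Lemma itv_nat (p q : R) : exists n : nat, - n%:R < p /\ q < n%:R.
Proof.
have [n hn] := bound_nat p; have [m hm] := bound_nat q; exists (maxn n m).
have : n%:R <= (maxn n m)%:R :> R by rewrite ler_nat leq_maxl.
have : m%:R <= (maxn n m)%:R :> R by rewrite ler_nat leq_maxr.
by move: hn hm; rewrite !ltr_norml => /andP[? ?] /andP[? ?]; split; lra.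
Qed.

(** Fubini, and on almost every horizontal line the fundamental theorem for [w g], which is
    absolutely continuous because [g] is Lipschitz. *)
Lemma byparts_x w g gx (K : R) p q : p.1 <= q.1 -> 0 <= K ->
  continuous w -> ACLx w -> measurable_fun setT g -> measurable_fun setT gx ->
  (forall x x' y, x <= x' -> `|g (x', y) - g (x, y)| <= K * (x' - x)) ->
  {ae leb, forall y, {ae leb, forall x : R, is_derive (x : R) (1 : R) (fun t : R => g (t, y)) (gx (x, y))}} ->
  (lxl R).-integrable (rect p q) (fun z => (Dx w z * g z + w z * gx z)%:E) ->
  (\int[lxl R]_(z in rect p q) (Dx w z * g z + w z * gx z)%:E =
   \int[leb]_(y in `]p.2, q.2]) (w (q.1, y) * g (q.1, y) - w (p.1, y) * g (p.1, y))%:E)%E.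
Proof.
move=> pq K0 cw ACw mg mgx lg dg intf.
pose f z := (Dx w z * g z + w z * gx z)%:E.
have mw := continuous_measurable2 cw.
have mf : measurable_fun setT (fun z => Dx w z * g z + w z * gx z).
  by apply: measurable_funD; apply: measurable_funM => //; exact: measurable_Dx.
rewrite integral_mkcond -integral21_prod_meas1/=; last by rewrite -integrable_mkcond//; exact: measurable_rect.
rewrite [RHS]integral_mkcond.
apply: ae_eq_integral => //=.
- have := @measurable_fubini_G _ _ R R R leb leb (f \_ (rect p q)).
  by apply; rewrite -integrable_mkcond//; exact: measurable_rect.
- apply/(measurable_restrictT _ _).1 => //; apply: measurable_funTS; apply/measurable_EFinP.
  by apply: measurable_funB; apply: measurable_funM;
    apply: measurable_fun_pair2.
near=> y => _.
rewrite /fubini_G patchE; case: ifPn => yq; last first.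
  apply: integral0_eq => x _; rewrite patchE memNset// => -[_ /= h].
  by move/negP: yq; apply; rewrite inE.
transitivity (\int[leb]_(x in `]p.1, q.1]) (f (x, y)))%E.
  rewrite [RHS]integral_mkcond; apply: eq_integral => x _; rewrite !patchE.
  suff -> : ((x, y) \in rect p q) = (x \in `]p.1, q.1]%classic) by [].
  apply/idP/idP => /set_mem h; apply/mem_set; first by case: h.
  by split => //; exact: set_mem yq.
(* Absolute continuity is known on the intervals [[-n, n]]; [AC_integral] wants the endpoints
   strictly inside. *)
have [n [n1 n2]] := itv_nat p.1 q.1.
have ACy : AC (- n%:R) n%:R (fun x => w (x, y) * g (x, y)).
  apply: AC_mul; first by lra.
    by apply: (near ACw y).
  by apply: (@lip_AC _ _ _ _ K) => // x x' _ xx' _; exact: lg.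
apply: (AC_integral ACy n1 pq n2 _ _).2.
  by apply: measurable_funTS; apply: measurable_fun_pair1 mf.
have d1 : {ae leb, forall x, dx_ok w (x, y)} by apply: ACx_derivable; apply: (near ACw y).
have d2 : {ae leb, forall x : R, is_derive (x : R) (1 : R) (fun t : R => g (t, y)) (gx (x, y))} by apply: (near dg y).
near=> x => _.
have e1 : dx_ok w (x, y) by apply: (near d1 x).
have e2 : is_derive (x : R) (1 : R) (fun t : R => g (t, y)) (gx (x, y)) by apply: (near d2 x).
rewrite /dx_ok /= in e1; have := is_deriveM e1 e2.
by rewrite /GRing.scale /= addrC [g _ * _]mulrC.
Unshelve. all: by end_near. Qed.
End F2.

(** * Exchange of the two coordinates *)

Section SW.
Variable R : realType.
Notation leb := (@leb R).
Notation swp := (@swp R).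
Implicit Types (w g : R * R -> R).

Lemma swpK : involutive swp. Proof. by case. Qed.

Lemma measurable_pre_swp (A : set (R * R)) : measurable A -> measurable (swp @^-1` A).
Proof. by apply: measurable_pre; exact: measurable_swp. Qed.

Lemma ae_swp (P : R * R -> Prop) : {ae lxl R, forall z, P z} -> {ae lxl R, forall z, P (swp z)}.
Proof.
move=> [A [mA A0 AP]]; exists (swp @^-1` A); split; first exact: measurable_pre_swp.
  by rewrite lxl_swp.
by move=> z h; apply: AP.
Qed.

Lemma measurable_fun_swp d (T : measurableType d) (f : R * R -> T) : measurable_fun setT f ->
  measurable_fun setT (f \o swp).
Proof. by move=> mf; apply: measurableT_comp => //; exact: measurable_swp. Qed.

Lemma swp_measure_eq (f : R * R -> \bar R) (D : set (R * R)) : measurable D ->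
  (\int[pushforward (lxl R) swp]_(z in D) f z = \int[lxl R]_(z in D) f z)%E.
Proof. by move=> mD; apply: (eq_measure_integral (lxl R)) => [|mf A mA AD]; [exact: measurable_swp|exact: lxl_swp]. Qed.

Lemma ge0_integral_swp (f : R * R -> \bar R) (D : set (R * R)) : measurable D ->
  measurable_fun D f -> (forall z, D z -> 0 <= f z)%E ->
  (\int[lxl R]_(z in swp @^-1` D) f (swp z) = \int[lxl R]_(z in D) f z)%E.
Proof.
move=> mD mf f0; have := ge0_integral_pushforward (@measurable_swp R) (lxl R) mD mf.
by move=> <-; [exact: swp_measure_eq|move=> z; rewrite inE => /f0].
Qed.

Lemma integral_swp (f : R * R -> \bar R) (D : set (R * R)) : measurable D ->
  measurable_fun D f ->
  (\int[lxl R]_(z in swp @^-1` D) f (swp z) = \int[lxl R]_(z in D) f z)%E.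
Proof.
move=> mD mf; rewrite integralE [RHS]integralE; congr (_ - _)%E.
- have mpos : measurable_fun D (f^\+)%E by exact: measurable_funepos.
  by rewrite -(ge0_integral_swp mD mpos) => [|z _]; [by apply: eq_integral => z _; rewrite !funeposE|exact: funepos_ge0].
- have mneg : measurable_fun D (f^\-)%E by exact: measurable_funeneg.
  by rewrite -(ge0_integral_swp mD mneg) => [|z _]; [by apply: eq_integral => z _; rewrite !funenegE|exact: funeneg_ge0].
Qed.

Lemma integrable_swp (f : R * R -> \bar R) (D : set (R * R)) : measurable D ->
  (lxl R).-integrable D f -> (lxl R).-integrable (swp @^-1` D) (f \o swp).
Proof.
move=> mD /integrableP[mf fi]; apply/integrableP; split.
  apply: (measurable_comp (F := D)) => //; first by move=> _ [z Dz <-].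
  by apply: measurable_funTS; exact: measurable_swp.
by rewrite (@ge0_integral_swp (fun z => `|f z|%E))//; exact: measurableT_comp.
Qed.

(** The vertical notions are the horizontal ones of [w \o swp], so each statement in [y] is obtained
    from the one in [x] by transport. *)
Definition Dy w z := Dx (w \o swp) (swp z).
Definition ACLy w := ACLx (w \o swp).
Definition dy_ok w z := dx_ok (w \o swp) (swp z).

Lemma measurable_Dy w : continuous w -> measurable_fun setT (Dy w).
Proof. by move=> cw; apply: measurable_fun_swp; apply: measurable_Dx; exact: continuous_swp. Qed.

Lemma ae_derivable_y w : continuous w -> ACLy w -> {ae lxl R, forall z, dy_ok w z}.
Proof. by move=> cw H; apply: ae_swp; apply: ae_derivable => //; exact: continuous_swp. Qed.

Lemma rect_swp p q : swp @^-1` (rect p q) = rect (swp p) (swp q).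
Proof. by apply/seteqP; split => -[x y] []. Qed.

Lemma byparts_y w g gy (K : R) p q : p.2 <= q.2 -> 0 <= K ->
  continuous w -> ACLy w -> measurable_fun setT g -> measurable_fun setT gy ->
  (forall y y' x, y <= y' -> `|g (x, y') - g (x, y)| <= K * (y' - y)) ->
  {ae leb, forall x, {ae leb, forall y : R, is_derive (y : R) (1 : R) (fun t : R => g (x, t)) (gy (x, y))}} ->
  (lxl R).-integrable (rect p q) (fun z => (Dy w z * g z + w z * gy z)%:E) ->
  (\int[lxl R]_(z in rect p q) (Dy w z * g z + w z * gy z)%:E =
   \int[leb]_(x in `]p.1, q.1]) (w (x, q.2) * g (x, q.2) - w (x, p.2) * g (x, p.2))%:E)%E.
Proof.
move=> pq K0 cw ACw mg mgy lg dg intf.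
have mR := measurable_rect p q.
have := @byparts_x R (w \o swp) (g \o swp) (gy \o swp) K (swp p) (swp q) pq K0 (continuous_swp cw) ACw
  (measurable_fun_swp mg) (measurable_fun_swp mgy) (fun x x' y => lg x x' y) dg.
rewrite -rect_swp => H.
have fE (z : R * R) : (Dx (w \o swp) z * (g \o swp) z + (w \o swp) z * (gy \o swp) z)%:E =
  (fun z => (Dy w z * g z + w z * gy z)%:E) (swp z) by rewrite /Dy swpK.
have := H; under eq_fun do rewrite fE; move=> /(_ (integrable_swp mR intf)) <-.
under [RHS]eq_integral do rewrite fE.
have mf : measurable_fun (rect p q) (fun z => (Dy w z * g z + w z * gy z)%:E) by case/integrableP: intf.
exact/esym/(integral_swp mR mf).
Qed.
End SW.

(** * The area inequality *)

Section path.
Variable R : realType.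

Lemma cont_path (h : R * R -> R) (al be : R -> R) : continuous h -> continuous al ->
  continuous be -> continuous (fun t => h (al t, be t)).
Proof.
move=> ch ca cb t; apply: (@cvg_comp _ _ _ (fun t => (al t, be t)) h _ (nbhs (al t, be t))); last exact: ch.
by apply: (@cvg_pair _ _ _ (nbhs t) (nbhs (al t)) (nbhs (be t)) _ _ _ al be); [exact: ca|exact: cb].
Qed.

Lemma cont_fst (h : R * R -> R * R) : continuous h -> continuous (fun z => (h z).1).
Proof. by move=> ch z; apply: cvg_comp; [exact: ch|exact: cvg_fst]. Qed.

Lemma cont_snd (h : R * R -> R * R) : continuous h -> continuous (fun z => (h z).2).
Proof. by move=> ch z; apply: cvg_comp; [exact: ch|exact: cvg_snd]. Qed.

Lemma cont_affine (p q : R) : continuous (fun t : R => q + t * p).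
Proof. by move=> t; apply: cvgD; [exact: cvg_cst|apply: cvgM; [exact: cvg_id|exact: cvg_cst]]. Qed.

Lemma cont_max (f g : R -> R) : continuous f -> continuous g -> continuous (fun t => Num.max (f t) (g t)).
Proof. by move=> cf cg t; apply: (@continuous_max _ _ f g); [exact: cf|exact: cg]. Qed.

Lemma cont_normB (f : R -> R) (c : R) : continuous f -> continuous (fun t => `|f t - c|).
Proof. by move=> cf t; apply: cvg_norm; apply: cvgB; [exact: cf|exact: cvg_cst]. Qed.

Lemma path_box (al : R -> R * R) (c : R * R) (s : R) : 0 < s ->
  continuous (fun t => (al t).1) -> continuous (fun t => (al t).2) -> al 0 = c ->
  ~ box c s (al 1) -> exists2 t, 0 <= t <= 1 &
   (`|(al t).1 - c.1| = s /\ `|(al t).2 - c.2| <= s) \/ (`|(al t).1 - c.1| <= s /\ `|(al t).2 - c.2| = s).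
Proof.
move=> s0 c1 c2 a0 nb.
pose phi t := Num.max `|(al t).1 - c.1| `|(al t).2 - c.2|.
have cphi : continuous phi by apply: cont_max; exact: cont_normB.
have p0 : phi 0 = 0 by rewrite /phi a0 !subrr normr0 maxxx.
have p1 : s < phi 1.
  rewrite ltNge; apply/negP => h; apply: nb; move: h; rewrite /phi ge_max => /andP[? ?]; by split.
have [|t /[!in_itv]/= t01 pt] := @IVT R phi 0 1 s ler01 (continuous_subspaceT cphi).
  by rewrite p0 ge_min ltW//= le_max (ltW p1) orbT.
exists t => //; move: pt; rewrite /phi; case: (lerP `|(al t).1 - c.1| `|(al t).2 - c.2|) => h <-; [right|left]; split => //; exact: ltW.
Qed.
End path.

Section cover.
Variable R : realType.
Variables (F G : R * R -> R * R).
Hypotheses (cG : continuous G) (FK : cancel F G) (GK : cancel G F).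
Let u z := (F z).1.
Let v z := (F z).2.

(* the points where [F] is within [d |t|] of the conformal linear map [a + i b]
   along horizontal and vertical segments of length [|t| <= 1 / (m + 1)] *)
Definition piece (a b d : R) (m : nat) : set (R * R) := [set z | forall t : R, `|t| <= m.+1%:R^-1 ->
  [/\ `|u (z.1 + t, z.2) - u z - t * a| <= d * `|t|, `|v (z.1 + t, z.2) - v z - t * b| <= d * `|t|,
      `|u (z.1, z.2 + t) - u z + t * b| <= d * `|t| & `|v (z.1, z.2 + t) - v z - t * a| <= d * `|t|]].

(* A straight path in the image that left [F (box z0 s)] would come back through
   the boundary of the box, where [F] is close to the linear map. *)
Lemma image_cover a b d m (z0 : R * R) (s : R) : 0 < s -> s <= m.+1%:R^-1 -> 0 < a ^+ 2 + b ^+ 2 ->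
  0 <= d -> 10000 * d ^+ 2 <= a ^+ 2 + b ^+ 2 ->
  piece a b d m z0 -> piece a b d m (z0.1 + s, z0.2) -> piece a b d m (z0.1 - s, z0.2) ->
  piece a b d m (z0.1, z0.2 + s) -> piece a b d m (z0.1, z0.2 - s) ->
  forall p, box (0, 0) (97 / 100 * s) p ->
    box z0 s (G ((F z0).1 + (cmul a b p).1, (F z0).2 + (cmul a b p).2)).
Proof.
move=> s0 sm A0 d0 dA H0 H1 H2 H3 H4 p [/= p1 p2]; rewrite !subr0 in p1 p2.
apply: contrapT.
pose al t := G ((F z0).1 + t * (cmul a b p).1, (F z0).2 + t * (cmul a b p).2).
have ca1 : continuous (fun t => (al t).1).
  by apply: (@cont_path R (fun z => (G z).1)); [exact: cont_fst|exact: cont_affine|exact: cont_affine].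
have ca2 : continuous (fun t => (al t).2).
  by apply: (@cont_path R (fun z => (G z).2)); [exact: cont_snd|exact: cont_affine|exact: cont_affine].
have al0 : al 0 = z0 by rewrite /al !mul0r !addr0 -surjective_pairing FK.
have := path_box s0 ca1 ca2 al0; rewrite {1}/al !mul1r => /[apply] -[t /andP[t0 t1]].
set z := al t; have Fz : F z = ((F z0).1 + t * (cmul a b p).1, (F z0).2 + t * (cmul a b p).2) by rewrite /z /al GK.
have q1 : `|t * p.1| <= 97 / 100 * s.
  by rewrite normrM ger0_norm//; apply: le_trans p1; rewrite ler_piMl.
have q2 : `|t * p.2| <= 97 / 100 * s.
  by rewrite normrM ger0_norm//; apply: le_trans p2; rewrite ler_piMl.
(* [t p] is the value of [z - z0] predicted by the linear map, and [(d1, d2)] is the deviation. At a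
   boundary point of the box one coordinate deviates by at least [3 s / 100], whereas the pieces
   bound the image of the deviation by [2 d s] in each coordinate. With [10000 d^2 <= a^2 + b^2]
   this would give [9 <= 8]. *)
pose d1 := z.1 - z0.1 - t * p.1; pose d2 := z.2 - z0.2 - t * p.2.
have fin : `|a * d1 - b * d2| <= 2 * (d * s) -> `|b * d1 + a * d2| <= 2 * (d * s) ->
    (3 / 100 * s) ^+ 2 <= d1 ^+ 2 + d2 ^+ 2 -> False.
  move=> h1 h2 h3.
  have k1 : (a * d1 - b * d2) ^+ 2 <= (2 * (d * s)) ^+ 2 by rewrite -real_normK ?num_real// ler_pXn2r ?nnegrE// !mulr_ge0// ltW.
  have k2 : (b * d1 + a * d2) ^+ 2 <= (2 * (d * s)) ^+ 2 by rewrite -real_normK ?num_real// ler_pXn2r ?nnegrE// !mulr_ge0// ltW.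
  have k3 : (a ^+ 2 + b ^+ 2) * (d1 ^+ 2 + d2 ^+ 2) <= 8 * d ^+ 2 * s ^+ 2.
    rewrite [leLHS](_ : _ = (a * d1 - b * d2) ^+ 2 + (b * d1 + a * d2) ^+ 2); last by ring.
    rewrite [leRHS](_ : _ = (2 * (d * s)) ^+ 2 + (2 * (d * s)) ^+ 2); last by ring.
    exact: lerD.
  have s2 : 0 < s ^+ 2 by rewrite exprn_gt0.
  have k4 : (a ^+ 2 + b ^+ 2) * (3 / 100 * s) ^+ 2 <= 8 * d ^+ 2 * s ^+ 2.
    by apply: le_trans k3; rewrite ler_wpM2l// ltW.
  have k5 : (10000 * d ^+ 2) * s ^+ 2 <= (a ^+ 2 + b ^+ 2) * s ^+ 2 by rewrite ler_wpM2r// ltW.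
  have k6 : 0 < (a ^+ 2 + b ^+ 2) * s ^+ 2 by rewrite mulr_gt0.
  move: k4 k5 k6; rewrite exprMn; move: (s ^+ 2) (a ^+ 2 + b ^+ 2) (d ^+ 2) => S A D; nra.
have sq (x y : R) : 3 / 100 * s <= `|x| -> (3 / 100 * s) ^+ 2 <= x ^+ 2 + y ^+ 2.
  move=> h; apply: (@le_trans _ _ (x ^+ 2)); last by rewrite lerDl sqr_ge0.
  by rewrite -[leRHS]real_normK ?num_real// ler_pXn2r ?nnegrE// mulr_ge0//; lra.
have du : u z - u z0 = a * (t * p.1) - b * (t * p.2) by rewrite /u Fz /cmul /=; ring.
have dv : v z - v z0 = b * (t * p.1) + a * (t * p.2) by rewrite /v Fz /cmul /=; ring.
have corner (zc : R * R) : forall dx dy : R, z.1 - z0.1 = dx -> z.2 - z0.2 = dy ->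
   `|dx| <= s -> `|dy| <= s ->
   `|u z - u z0 - (a * dx - b * dy)| <= 2 * (d * s) -> `|v z - v z0 - (b * dx + a * dy)| <= 2 * (d * s) ->
   (3 / 100 * s) ^+ 2 <= d1 ^+ 2 + d2 ^+ 2 -> False.
  move=> dx dy e1 e2 _ _ h1 h2; apply: fin.
    by move: h1; rewrite du -normrN; congr (is_true (`|_| <= _)); rewrite /d1 /d2 -e1 -e2; ring.
  by move: h2; rewrite dv -normrN; congr (is_true (`|_| <= _)); rewrite /d1 /d2 -e1 -e2; ring.
have zE : z = (z0.1 + (z.1 - z0.1), z0.2 + (z.2 - z0.2)) by rewrite [z0.1 + _]addrC [z0.2 + _]addrC !subrK -surjective_pairing.
move: corner; rewrite /d1 /d2; move: zE; move: (z.1 - z0.1) (z.2 - z0.2) => dx dy zE corner [[hx hy]|[hx hy]].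
(* On a vertical side, [z] is reached from [z0] by a horizontal step to the middle of the side and
   then a vertical one; each step costs [d s]. The middles of the four sides are the neighbours
   required to lie in the piece. *)
- have Pc : piece a b d m (z0.1 + dx, z0.2).
    have [dx0|dx0] := lerP 0 dx; first by move: hx; rewrite ger0_norm// => ->.
    by move: hx; rewrite ltr0_norm// => /(congr1 -%R); rewrite opprK => ->.
  have [a1 a2 _ _] := H0 dx ltac:(by rewrite hx).
  have [_ _ b1 b2] := Pc dy (le_trans hy sm).
  have dy' : d * `|dy| <= d * s by rewrite ler_wpM2l.
  rewrite hx in a1 a2; apply: (corner z0 dx dy) => //; rewrite ?hx//.
  + rewrite [X in `|X|](_ : _ = (u (z0.1 + dx, z0.2 + dy) - u (z0.1 + dx, z0.2) + dy * b) + (u (z0.1 + dx, z0.2) - u z0 - dx * a)); last by rewrite zE; ring.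
    by rewrite mulr_natl mulr2n; apply: le_trans (ler_normD _ _) _; apply: lerD; [exact: le_trans b1 dy'|exact: a1].
  + rewrite [X in `|X|](_ : _ = (v (z0.1 + dx, z0.2 + dy) - v (z0.1 + dx, z0.2) - dy * a) + (v (z0.1 + dx, z0.2) - v z0 - dx * b)); last by rewrite zE; ring.
    by rewrite mulr_natl mulr2n; apply: le_trans (ler_normD _ _) _; apply: lerD; [exact: le_trans b2 dy'|exact: a2].
  + apply: sq; have := lerB_dist dx (t * p.1); lra.
- have Pc : piece a b d m (z0.1, z0.2 + dy).
    have [dx0|dx0] := lerP 0 dy; first by move: hy; rewrite ger0_norm// => ->.
    by move: hy; rewrite ltr0_norm// => /(congr1 -%R); rewrite opprK => ->.
  have [_ _ a1 a2] := H0 dy ltac:(by rewrite hy).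
  have [b1 b2 _ _] := Pc dx (le_trans hx sm).
  have dx' : d * `|dx| <= d * s by rewrite ler_wpM2l.
  rewrite hy in a1 a2; apply: (corner z0 dx dy) => //; rewrite ?hy//.
  + rewrite [X in `|X|](_ : _ = (u (z0.1 + dx, z0.2 + dy) - u (z0.1, z0.2 + dy) - dx * a) + (u (z0.1, z0.2 + dy) - u z0 + dy * b)); last by rewrite zE; ring.
    by rewrite mulr_natl mulr2n; apply: le_trans (ler_normD _ _) _; apply: lerD; [exact: le_trans b1 dx'|exact: a1].
  + rewrite [X in `|X|](_ : _ = (v (z0.1 + dx, z0.2 + dy) - v (z0.1, z0.2 + dy) - dx * b) + (v (z0.1, z0.2 + dy) - v z0 - dy * a)); last by rewrite zE; ring.
    by rewrite mulr_natl mulr2n; apply: le_trans (ler_normD _ _) _; apply: lerD; [exact: le_trans b2 dx'|exact: a2].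
  + rewrite addrC; apply: sq; have := lerB_dist dy (t * p.2); lra.
Qed.
End cover.

Section shrink.
Variable R : realType.

Lemma open_lt2 (f : R * R -> R) (c : R) : continuous f -> open [set z | f z < c].
Proof.
move=> cf; apply: (@open_comp _ _ f [set t | t < c]) => [z _|]; [exact: cf|exact: open_lt].
Qed.

(** A point of [X] that a short translation takes out of [X] lands here. *)
Definition collar (X : set (R * R)) (k : nat) : set (R * R) :=
  [set w | ~ X w /\ exists2 z, X z & `|w.1 - z.1| < k.+1%:R^-1 /\ `|w.2 - z.2| < k.+1%:R^-1].

Lemma measurable_collar X k : closed X -> measurable (collar X k).
Proof.
move=> cX; rewrite (_ : collar X k = ~` X `&` \bigcup_(z in X)
   ([set w | `|w.1 - z.1| < k.+1%:R^-1] `&` [set w | `|w.2 - z.2| < k.+1%:R^-1])); last first.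
  by apply/seteqP; split => w [nX [z Xz h]]; split => //; exists z.
apply: open_measurable2; apply: openI; first exact: closed_openC.
apply: bigcup_open => z _; apply: openI; apply: open_lt2 => w.
  by apply: cvg_norm; apply: cvgB; [exact: cvg_fst|exact: cvg_cst].
by apply: cvg_norm; apply: cvgB; [exact: cvg_snd|exact: cvg_cst].
Qed.

Lemma collar_nonincr X k l : (k <= l)%N -> collar X l `<=` collar X k.
Proof.
move=> kl w [nX [z Xz [h1 h2]]]; split => //; exists z => //.
have h : (l.+1%:R^-1 : R) <= k.+1%:R^-1 by rewrite lef_pV2 ?posrE ?ltr0n// ler_nat.
by split; [exact: lt_le_trans h1 h|exact: lt_le_trans h2 h].
Qed.

(** The collars decrease, and their intersection is empty because [X] is closed; the box makes their
    measures finite, so these tend to 0. This plays the part of a density theorem: most points of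
    [X] keep their close translates in [X]. *)
Lemma collar_small X (M e : R) : closed X -> 0 <= M -> 0 < e ->
  exists k0, forall k, (k0 <= k)%N -> (lxl R (collar X k `&` box (0%R, 0%R) M) < e%:E)%E.
Proof.
move=> cX M0 e0; pose N k := collar X k `&` box (0, 0) M.
have mN k : measurable (N k) by apply: measurableI; [exact: measurable_collar|exact: measurable_box].
have N0 : \bigcap_k N k = set0.
  apply/seteqP; split => // w H; have [[nX _] _] := H 0%N Logic.I.
  have oX : open (~` X) by exact: closed_openC.
  have [r /= r0 rX] := (nbhs_ballP _ _).1 (open_nbhs_nbhs (conj oX nX)).
  have [k hk] := invn_lt r0.
  have [[_ [z Xz [h1 h2]]] _] := H k Logic.I.
  by have := rX z; apply => //; split; rewrite /ball /=; [exact: lt_trans h1 hk|exact: lt_trans h2 hk].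
have fin : (lxl R (N 0%N) < +oo)%E.
  apply: (@le_lt_trans _ _ (lxl R (box (0, 0) M))); last by rewrite lxl_box// ltry.
  by apply: le_lxl => // [|w []//]; exact: measurable_box.
have := nonincreasing_cvg_mu fin mN; rewrite N0 measure0 => /(_ measurable0).
have nd : nonincreasing_seq N.
  by move=> k l kl; apply/subsetPset => w [h1 h2]; split => //; exact: collar_nonincr kl _ h1.
move=> /(_ nd) /fine_cvgP[_ /cvgrPdist_lt/(_ e e0)][k0 _ H]; exists k0 => k kk.
have := H k kk; rewrite /= sub0r normrN.
have fk : lxl R (N k) \is a fin_num.
  rewrite ge0_fin_numE ?measure_ge0//; apply: (@le_lt_trans _ _ (lxl R (N 0%N))); last exact: fin.
  by apply: le_lxl; [exact: mN|exact: mN|move=> w [h1 h2]; split => //; exact: collar_nonincr h1].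
by rewrite -lte_fin; move/fineK: fk => <-; apply: le_lt_trans; rewrite lee_fin ler_norm.
Qed.
End shrink.

(* [lxl R] with a canonical sigma-finite structure of its own, so that it can in
   turn be a factor of a product measure *)
Definition plane (R : realType) : set (R * R) -> \bar R := lxl R.
HB.instance Definition _ (R : realType) := isMeasure.Build _ (R * R)%type R (@plane R)
  (@measure0 _ _ _ (lxl R)) (@measure_ge0 _ _ _ (lxl R))
  (@measure_semi_sigma_additive _ _ _ (lxl R)).
Lemma plane_sfin (R : realType) : sigma_finite setT (@plane R).
Proof.
exists (fun n => box (0, 0) n%:R).
  apply/seteqP; split => // z _.
  have h (x : R) : exists n : nat, `|x| < n%:R by exists (Num.bound `|x|); apply: archi_boundP.
  have [n hn] := h z.1; have [m hm] := h z.2; exists (maxn n m) => //.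
  split; rewrite /= subr0.
    by apply: le_trans (ltW hn) _; rewrite ler_nat leq_maxl.
  by apply: le_trans (ltW hm) _; rewrite ler_nat leq_maxr.
by move=> n; split; [exact: measurable_box|rewrite /plane lxl_box// ltry].
Qed.

HB.instance Definition _ (R : realType) := @Measure_isSigmaFinite.Build _ _ R (@plane R) (@plane_sfin R).

Section area.
Variable R : realType.
Variables (F G : R * R -> R * R).
Hypotheses (cF : continuous F) (cG : continuous G) (FK : cancel F G) (GK : cancel G F).

(** Both sides measure the set of pairs [(z, w)] with [w] in [O] and [G w] in [box z s]; for fixed
    [w] the section is the box centred at [G w]. *)
Lemma fubini_box (O : set (R * R)) (s : R) : 0 <= s -> measurable O ->
  measurable_fun setT (fun z => lxl R (O `&` G @^-1` (box z s))) /\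
  (\int[lxl R]_z lxl R (O `&` G @^-1` (box z s)) = (4 * s ^+ 2)%:E * lxl R O)%E.
Proof.
move=> s0 mO; pose Om : set ((R * R) * (R * R)) := [set zw | O zw.2 /\ box zw.1 s (G zw.2)].
have mG := continuous_measurable22 cG.
have mOm : measurable Om.
  rewrite (_ : Om = (snd @^-1` O) `&` (fun zw : (R * R) * (R * R) => ((G zw.2).1 - zw.1.1, (G zw.2).2 - zw.1.2)) @^-1` (box (0, 0) s)); last first.
    by apply/seteqP; split => -[z w] [/= h1 h2]; split => //; move: h2; rewrite /box /= !subr0.
  apply: measurableI.
    by rewrite -[X in measurable X]setTI; exact: measurable_snd.
  rewrite -[X in measurable X]setTI.
  have mf : measurable_fun setT (fun zw : (R * R) * (R * R) => ((G zw.2).1 - zw.1.1, (G zw.2).2 - zw.1.2)).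
    have mG2 : measurable_fun setT (fun zw : (R * R) * (R * R) => G zw.2) by apply: measurableT_comp => //; exact: measurable_snd.
    have m1 : measurable_fun setT (fun zw : (R * R) * (R * R) => zw.1) by exact: measurable_fst.
    apply: measurable_fun_pair; apply: measurable_funB;
      (apply: measurableT_comp; [exact: measurable_fst|by []]) || (apply: measurableT_comp; [exact: measurable_snd|by []]).
  by apply: mf => //; exact: measurable_box.
have mx := measurable_fun_xsection (@plane R) mOm.
have H : (\int[@plane R]_z plane (xsection Om z) = \int[@plane R]_w plane (ysection Om w))%E.
  have h := indic_fubini_tonelli (@plane R) (@plane R) mOm.
  have e1 := indic_fubini_tonelli_FE (@plane R) mOm.
  have e2 := indic_fubini_tonelli_GE (@plane R) mOm.
  by move: h; rewrite e1 e2.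
have Ex : (fun z => lxl R (O `&` G @^-1` (box z s))) = (fun z => plane (xsection Om z)).
  apply/funext => z; rewrite /plane; congr (lxl R _).
  by apply/seteqP; split => w; rewrite /xsection /= inE.
split; first by rewrite Ex.
transitivity (\int[lxl R]_z plane (xsection Om z))%E.
  by apply: eq_integral => z _; exact: (congr1 (@^~ z) Ex).
transitivity (\int[lxl R]_w plane (ysection Om w))%E; first exact: H.
transitivity (\int[lxl R]_w ((4 * s ^+ 2)%:E * (\1_O w)%:E))%E.
  apply: eq_integral => w _; rewrite /plane indicE.
  have [wO|wO] := boolP (w \in O).
    rewrite mule1 -(lxl_box (G w) s0); congr (lxl R _); apply/seteqP; split => z; rewrite /ysection /= inE /Om /box /=.
      by rewrite distrC [`|_ - z.2|]distrC => -[].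
    by move=> h; split; [exact: set_mem|rewrite distrC [`|_ - z.2|]distrC].
  rewrite mule0; transitivity (lxl R (set0 : set (R * R))); last exact: measure0.
  congr (lxl R _).
  rewrite -subset0 => z; rewrite /ysection /= inE => -[h _].
  by move: wO; rewrite (mem_set h).
rewrite ge0_integralZl; [|exact: measurableT| | |].
- by congr (_ * _)%E; rewrite integral_indic ?setIT//; exact: measurableT.
- by apply/measurable_EFinP; exact: measurable_indic.
- by move=> w _; rewrite lee_fin.
- have h : 0 <= 4 * s ^+ 2 by exact: (mulr_ge0 (ler0n _ 4) (sqr_ge0 s)).
  rewrite lee_fin; exact: h.
Qed.
End area.

Section area.
Variable R : realType.
Variables (F G : R * R -> R * R).
Hypotheses (cF : continuous F) (cG : continuous G) (FK : cancel F G) (GK : cancel G F).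

Lemma piece_closed a b d m : closed (piece F a b d m).
Proof.
pose u z := (F z).1; pose v z := (F z).2.
have cu : continuous u by exact: cont_fst.
have cv : continuous v by exact: cont_snd.
have cx (w : R * R -> R) t c : continuous w -> continuous (fun z : R * R => `|w (z.1 + t, z.2) - w z - c|).
  move=> cw z; apply: cvg_norm; apply: cvgB; last exact: cvg_cst.
  apply: cvgB; last exact: cw.
  have := @continuous_shift R w t 0 cw z.
  by under [X in continuous_at _ X]eq_fun do rewrite addr0.
have cy (w : R * R -> R) t c : continuous w -> continuous (fun z : R * R => `|w (z.1, z.2 + t) - w z - c|).
  move=> cw z; apply: cvg_norm; apply: cvgB; last exact: cvg_cst.
  apply: cvgB; last exact: cw.
  have := @continuous_shift R w 0 t cw z.
  by under [X in continuous_at _ X]eq_fun do rewrite addr0.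
rewrite (_ : piece F a b d m = \bigcap_(t in [set t : R | `|t| <= m.+1%:R^-1])
  (([set z | `|u (z.1 + t, z.2) - u z - t * a| <= d * `|t|] `&`
   [set z | `|v (z.1 + t, z.2) - v z - t * b| <= d * `|t|]) `&`
   ([set z | `|u (z.1, z.2 + t) - u z - - (t * b)| <= d * `|t|] `&`
   [set z | `|v (z.1, z.2 + t) - v z - t * a| <= d * `|t|]))); last first.
  apply/seteqP; split => z h t /= tm; rewrite ?opprK.
    by have [? ? ? ?] := h t tm; split; split => //=; rewrite opprK.
  by have [[? ?] [+ ?]] := h t tm; rewrite /= opprK; split.
apply: closed_bigI => t _; do !apply: closedI; apply: closed_le2.
- exact: cx.
- exact: cx.
- exact: cy.
- exact: cy.
Qed.

(* [F (box z0 s)] contains a slightly smaller image of the box by the linear map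
   [a + i b]; integrating over [z0] with [fubini_box] gives [area_finite] *)
Lemma image_box_ge a b d m (z0 : R * R) (s : R) (O : set (R * R)) : measurable O ->
  0 < s -> s <= m.+1%:R^-1 -> a != 0 -> 0 <= d -> 10000 * d ^+ 2 <= a ^+ 2 + b ^+ 2 ->
  piece F a b d m z0 -> piece F a b d m (z0.1 + s, z0.2) -> piece F a b d m (z0.1 - s, z0.2) ->
  piece F a b d m (z0.1, z0.2 + s) -> piece F a b d m (z0.1, z0.2 - s) ->
  box z0 s `<=` F @^-1` O ->
  (((97 / 100) ^+ 2 * (a ^+ 2 + b ^+ 2) * (4 * s ^+ 2))%:E <= lxl R (O `&` G @^-1` (box z0 s)))%E.
Proof.
move=> mO s0 sm a0 d0 dA H0 H1 H2 H3 H4 bO.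
have A0 : 0 < a ^+ 2 + b ^+ 2 by rewrite ltr_pwDl ?sqr_ge0// exprn_even_gt0.
have mB : measurable (O `&` G @^-1` (box z0 s)).
  apply: measurableI => //; apply: measurable_pre; last exact: measurable_box.
  exact: continuous_measurable22.
set B := O `&` _ in mB *.
rewrite -(lxl_shift (F z0).1 (F z0).2 mB).
have mB' : measurable ((fun z => (z.1 + (F z0).1, z.2 + (F z0).2)) @^-1` B).
  apply: measurable_pre => //; apply: measurable_fun_pair; apply: measurable_funD => //.
rewrite -(lxl_cmul b a0 mB').
rewrite (_ : _ * _ * _ = (a ^+ 2 + b ^+ 2) * (4 * (97 / 100 * s) ^+ 2)); last by ring.
have r0 : 0 <= 97 / 100 * s by rewrite mulr_ge0// ltW.
rewrite EFinM; apply: lee_wpmul2l; first by rewrite lee_fin ltW.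
rewrite -(lxl_box (0, 0) r0); apply: le_lxl.
- exact: measurable_box.
- apply: measurable_pre => //; apply: continuous_measurable22 => z.
  apply: (@cvg_pair _ _ _ (nbhs z) (nbhs (a * z.1 - b * z.2)) (nbhs (b * z.1 + a * z.2)) _ _ _ (fun z : R * R => a * z.1 - b * z.2) (fun z : R * R => b * z.1 + a * z.2)).
    by apply: cvgB; apply: cvgM; (exact: cvg_cst || exact: cvg_fst || exact: cvg_snd).
  by apply: cvgD; apply: cvgM; (exact: cvg_cst || exact: cvg_fst || exact: cvg_snd).
- move=> p pb; have h := image_cover cG FK GK s0 sm A0 d0 dA H0 H1 H2 H3 H4 pb.
  have : B ((F z0).1 + (cmul a b p).1, (F z0).2 + (cmul a b p).2).
    by split => //; have := bO _ h; rewrite /= GK.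
  by rewrite /= [_ + (F z0).1]addrC [_ + (F z0).2]addrC.
Qed.

Section fin.
Variables (a b d : nat -> R) (m : nat -> nat).
Hypothesis (valid : forall n, [/\ a n != 0, 0 <= d n & 10000 * (d n) ^+ 2 <= (a n) ^+ 2 + (b n) ^+ 2]).
Let P n := piece F (a n) (b n) (d n) (m n).
Let P' := seqDU P.

Lemma measurable_seqDU_piece n : measurable (P' n).
Proof.
have mP k : measurable (P k) by apply: closed_measurable2; exact: piece_closed.
by apply: measurableD => //; exact: bigsetU_measurable.
Qed.

Let c n := (97 / 100) ^+ 2 * ((a n) ^+ 2 + (b n) ^+ 2).

(** [image_box_ge] bounds the integrand of [fubini_box] below by [4 s^2 c n] at the points of [P' n]
    outside a set [Bad n] of small measure. The [P' n] are disjoint, so these bounds add up, and the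
    factor [4 s^2] cancels. *)
Lemma area_finite (O D : set (R * R)) (M : R) N : open O -> measurable D -> 0 <= M ->
  D `<=` F @^-1` O -> D `<=` box (0, 0) M ->
  (\sum_(n < N) (c n)%:E * lxl R (P' n `&` D) <= lxl R O)%E.
Proof.
move=> oO mD M0 DO DM; apply/lee_addgt0Pr => e e0.
have mO := open_measurable2 oO.
pose Y0 := ~` (F @^-1` O).
have cY0 : closed Y0.
  by apply: open_closedC; apply: open_comp => // z _; exact: cF.
have M10 : 0 <= M + 1 by rewrite addr_ge0.
pose S := \sum_(n < N) c n.
have c0 n : 0 <= c n by rewrite mulr_ge0 ?sqr_ge0// addr_ge0 ?sqr_ge0.
have S0 : 0 <= S by apply: sumr_ge0.
(* Each [Bad n] is made of five sets of measure at most [e1], and the weights [c n] add up to [S]: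
   the loss is at most [e]. *)
pose e1 := e / (5 * (S + 1)).
have e10 : 0 < e1 by rewrite divr_gt0// mulr_gt0//; lra.
have cP n : closed (P n) by exact: piece_closed.
have [k0 hk0] := collar_small cY0 M10 e10.
have [kk hkk] := choice (fun n => collar_small (cP n) M10 e10).
pose k := maxn k0 (\max_(n < N) maxn (kk n) (m n)).
have kk0 : (k0 <= k)%N by exact: leq_maxl.
have kkn (n : 'I_N) : (kk n <= k)%N.
  by apply: leq_trans (leq_maxr _ _); apply: leq_trans (leq_bigmax n); exact: leq_maxl.
have kmn (n : 'I_N) : (m n <= k)%N.
  by apply: leq_trans (leq_maxr _ _); apply: leq_trans (leq_bigmax n); exact: leq_maxr.
(* With [k + 2] in place of [k + 1], a displacement by [s] stays strictly within the width of the
   collars; it is also below the scale [1 / (m n + 1)] of every piece. *)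
pose s : R := k.+2%:R^-1.
have s0 : 0 < s by rewrite invr_gt0.
have sk : s < k.+1%:R^-1 by rewrite ltf_pV2 ?posrE ?ltr0n// ltr_nat.
have s1 : s <= 1 by rewrite invf_le1 ?ler1n.
pose Z (X : set (R * R)) := collar X k `&` box (0, 0) (M + 1).
have mZ X : closed X -> measurable (Z X).
  by move=> cX; apply: measurableI; [exact: measurable_collar|exact: measurable_box].
pose sh (x y : R) (X : set (R * R)) := (fun z : R * R => (z.1 + x, z.2 + y)) @^-1` X.
have msh x y X : measurable X -> measurable (sh x y X).
  move=> mX; apply: measurable_pre => //; apply: measurable_fun_pair; apply: measurable_funD => //.
(* The points with a neighbour at distance [s] outside the piece, or whose box of radius [s] is not
   contained in [F @^-1] [O]. *)
pose Bad n := sh s 0 (Z (P n)) `|` (sh (- s) 0 (Z (P n)) `|` (sh 0 s (Z (P n)) `|` (sh 0 (- s) (Z (P n)) `|` Z Y0))).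
have mBad n : measurable (Bad n) by do !apply: measurableU; do ?apply: msh; exact: mZ.
have BadE (n : 'I_N) : (lxl R (Bad n) <= (5 * e1)%:E)%E.
  have h x y : (lxl R (sh x y (Z (P n))) <= e1%:E)%E.
    by rewrite lxl_shift; [exact/ltW/hkk|exact: mZ].
  rewrite (_ : 5 * e1 = e1 + (e1 + (e1 + (e1 + e1)))); last by ring.
  rewrite !EFinD; do 4 (apply: le_trans (measureU2 _ _ _) _; [by apply: msh; exact: mZ|by do ?[apply: measurableU|apply: msh|apply: mZ]|apply: leeD; first exact: h]).
  exact/ltW/hk0.
pose T n := (P' n `&` D) `\` Bad n.
have mT n : measurable (T n).
  by apply: measurableD => //; apply: measurableI => //; exact: measurable_seqDU_piece.
have [mg gE] := fubini_box cG (ltW s0) mO.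
set g := (fun z => _) in mg gE.
have g0 z : (0 <= g z)%E by exact: measure_ge0.
have tT : trivIset setT T.
  apply/trivIsetP => i j _ _ ij; have /trivIsetP/(_ i j Logic.I Logic.I ij) := trivIset_seqDU P.
  move=> h; apply/seteqP; split => // z [[[z1 _] _] [[z2 _] _]].
  by have : (P' i `&` P' j) z by []; rewrite /P' h.
have bx z dx dy : D z -> `|dx| <= 1 -> `|dy| <= 1 -> box (0, 0) (M + 1) (z.1 + dx, z.2 + dy).
  move=> /DM [/= h1 h2] x1 y1; rewrite !subr0 in h1 h2; split; rewrite /= subr0;
  by apply: le_trans (ler_normD _ _) _; rewrite lerD.
have key (n : 'I_N) z : T n z -> ((c n * (4 * s ^+ 2))%:E <= g z)%E.
  move=> [[[Pz _] Dz] nB]; have [an dn vn] := valid n.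
  have sn : s <= (m n).+1%:R^-1.
    by apply: le_trans (ltW sk) _; rewrite lef_pV2 ?posrE ?ltr0n// ler_nat ltnS.
  have ns : `|s| <= 1 by rewrite ger0_norm// ltW.
  have nms : `|- s| <= 1 by rewrite normrN.
  have n00 : `|0 : R| <= 1 by rewrite normr0.
  have ab0 : `|0 : R| < k.+1%:R^-1 by rewrite normr0 invr_gt0.
  have abs_ : `|s| < k.+1%:R^-1 by rewrite gtr0_norm.
  have pt x y : ~ sh x y (Z (P n)) z -> `|x| <= 1 -> `|y| <= 1 -> `|x| < k.+1%:R^-1 ->
      `|y| < k.+1%:R^-1 -> P n (z.1 + x, z.2 + y).
    move=> nZ x1 y1 xk yk; apply: contrapT => nP; apply: nZ; split; last exact: bx.
    by split => //; exists z => //=; rewrite ![_ + _ - _]addrAC !subrr !add0r.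
  have p1 : P n (z.1 + s, z.2).
    by rewrite -[z.2]addr0; apply: pt => // h; apply: nB; left.
  have p2 : P n (z.1 - s, z.2).
    by rewrite -[z.2]addr0; apply: pt => //; rewrite ?normrN// => h; apply: nB; right; left.
  have p3 : P n (z.1, z.2 + s).
    by rewrite -[z.1]addr0; apply: pt => // h; apply: nB; right; right; left.
  have p4 : P n (z.1, z.2 - s).
    by rewrite -[z.1]addr0; apply: pt => //; rewrite ?normrN// => h; apply: nB; right; right; right; left.
  apply: (image_box_ge mO s0 sn an dn vn Pz p1 p2 p3 p4).
  move=> z' [h1 h2]; apply: contrapT => nO; apply: nB; right; right; right; right; split.
    split; first by move=> h; apply: h; exact: DO.
    by exists z' => //; rewrite distrC [`|z.2 - _|]distrC; split; apply: le_lt_trans sk.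
  by have := bx z 0 0 Dz n00 n00; rewrite !addr0 -surjective_pairing.
have s2 : 0 < 4 * s ^+ 2 by rewrite mulr_gt0// exprn_gt0.
have step : (\sum_(n < N) (c n)%:E * lxl R (T n) <= lxl R O)%E.
  have p4 : (0 < (4 * s ^+ 2)%:E)%E by rewrite lte_fin.
  have f4 : (4 * s ^+ 2)%:E \is a fin_num by [].
  rewrite -(lee_pmul2l f4 p4).
  rewrite -gE.
  pose U := \big[setU/set0]_(n < N) T n.
  have mU : measurable U by apply: bigsetU_measurable.
  apply: (@le_trans _ _ (\int[lxl R]_(z in U) g z)%E); last first.
    apply: (@ge0_subset_integral _ _ _ (lxl R)) => //.
  rewrite [leRHS](ge0_integral_bigsetU (lxl R) (F := fun n : 'I_N => T n))//; last 3 first.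
  - exact: index_enum_uniq.
  - by apply/trivIsetP => i j _ _ ij; move/trivIsetP : tT; apply.
  - exact: measurable_funTS.
  rewrite ge0_sume_distrr; last by move=> n _; rewrite mule_ge0// lee_fin.
  apply: lee_sum => n _; rewrite muleA -EFinM mulrC -integral_cst//.
  apply: ge0_le_integral => //.
  - by move=> z _; rewrite lee_fin mulr_ge0// ltW.
  - exact: measurable_funTS.
  - by move=> z; exact: key.
apply: (@le_trans _ _ (\sum_(n < N) ((c n)%:E * lxl R (T n) + (c n * (5 * e1))%:E))%E).
  apply: lee_sum => n _; rewrite [(c n * (5 * e1))%:E]EFinM -muleDr//; last by rewrite ge0_adde_def// inE ?measure_ge0// lee_fin mulr_ge0// ltW.
  apply: lee_wpmul2l; first by rewrite lee_fin.
  apply: (@le_trans _ _ (lxl R (T n `|` Bad n))).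
    apply: le_lxl; first by apply: measurableI => //; exact: measurable_seqDU_piece.
      exact: measurableU.
    by move=> z h; have [?|?] := pselect (Bad n z); [right|left].
  apply: (le_trans (measureU2 (lxl R) (mT n) (mBad n))).
  by apply: leeD2l; exact: BadE.
rewrite big_split /= leeD//; rewrite sumEFin lee_fin -mulr_suml -/S /e1.
have -> : S * (5 * (e / (5 * (S + 1)))) = e * (S / (S + 1)) by field; lra.
by rewrite ler_piMr ?(ltW e0)// ler_pdivrMr ?mul1r; lra.
Qed.
End fin.

End area.

(** * Points at which [F] is nearly conformal *)

Section pt.
Variable R : realType.

Lemma is_derive_lip (f : R -> R) (x l a d r : R) : is_derive x 1 f l -> 0 < r ->
  (forall t, `|t| <= r -> `|f (x + t) - f x - t * a| <= d * `|t|) -> `|l - a| <= d.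
Proof.
move=> fl r0 H; apply/ler_addgt0Pr => e e0.
have [r' r'0 h] := is_derive_quot fl e0.
pose t := Num.min r (r' / 2).
have t0 : 0 < t by rewrite lt_min r0 divr_gt0.
have tr : `|t| <= r by rewrite gtr0_norm// ge_min lexx.
have tr' : `|t| < r'.
  rewrite gtr0_norm// (@le_lt_trans _ _ (r' / 2)) ?ge_min ?lexx ?orbT//; lra.
have h1 := H t tr; have h2 := h t tr'.
rewrite -(ler_pM2r t0) -{1}(gtr0_norm t0) -normrM.
rewrite [X in `|X|](_ : _ = (f (x + t) - f x - t * a) - (f (x + t) - f x - t * l)); last by ring.
apply: le_trans (ler_normB _ _) _; rewrite (gtr0_norm t0) in h1 h2; lra.
Qed.

Lemma ex_rat_between (x y : R) : x < y -> exists q : rat, x < ratr q < y.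
Proof. by move=> /rat_in_itvoo[q]; rewrite in_itv /=; exists q. Qed.

Lemma sqr_le_abs (x c : R) : 0 <= c -> x ^+ 2 <= c ^+ 2 -> `|x| <= c.
Proof. by move=> c0; rewrite -[x ^+ 2]real_normK ?num_real// ler_pXn2r ?nnegrE. Qed.

Lemma abs_le_sqr (x c : R) : `|x| <= c -> x ^+ 2 <= c ^+ 2.
Proof. by move=> h; rewrite -[x ^+ 2]real_normK ?num_real// ler_pXn2r ?nnegrE// (le_trans _ h). Qed.

Lemma ex_rat_near (x e : R) : 0 < e -> exists a : rat, ratr a != 0 :> R /\ `|x - ratr a| <= e.
Proof.
move=> e0; have [h|h] := leP 0 x.
  have [|a /andP[a1 a2]] := @ex_rat_between x (x + e); first by lra.
  by exists a; split; [rewrite gt_eqF//; lra|rewrite ler_norml; apply/andP; split; lra].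
have [|a /andP[a1 a2]] := @ex_rat_between (x - e) x; first by lra.
by exists a; split; [rewrite lt_eqF//; lra|rewrite ler_norml; apply/andP; split; lra].
Qed.

Lemma capture_num (s x y a b d : R) : 0 < s -> s ^+ 2 = x ^+ 2 + y ^+ 2 ->
  `|x - a| <= s / 2000 -> `|y - b| <= s / 2000 -> 0 <= d -> d < s / 150 ->
  10000 * d ^+ 2 <= a ^+ 2 + b ^+ 2.
Proof.
move=> s0 e2 ha hb d0 d1.
have xs : `|x| <= s by apply: sqr_le_abs; [exact: ltW|rewrite e2 lerDl sqr_ge0].
have ys : `|y| <= s by apply: sqr_le_abs; [exact: ltW|rewrite e2 lerDr sqr_ge0].
have k1 : d ^+ 2 <= (s / 150) ^+ 2 by apply: abs_le_sqr; rewrite ger0_norm// ltW.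
have k2 (p q : R) : `|p| <= s -> `|p - q| <= s / 2000 -> p ^+ 2 <= q ^+ 2 + s ^+ 2 / 1000.
  move=> ps pq; have h : `|p * (p - q)| <= s * (s / 2000) by rewrite normrM ler_pM.
  have h2 := ler_norm (p * (p - q)); have h3 := sqr_ge0 (p - q); clear -h h2 h3; nra.
have k3 := k2 _ _ xs ha; have k4 := k2 _ _ ys hb.
clear -e2 k1 k3 k4; move: e2 k1 k3 k4; rewrite expr_div_n; have := sqr_ge0 s; lra.
Qed.

Variables (F : R * R -> R * R).
Let u z := (F z).1.
Let v z := (F z).2.

Definition energy z := Dx u z ^+ 2 + Dx v z ^+ 2.
(* [conf k z]: [|F_y - i F_x| <= k |F_x|] *)
Definition conf (k : R) z := (Dy u z + Dx v z) ^+ 2 + (Dy v z - Dx u z) ^+ 2 <= k ^+ 2 * energy z.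
Definition all_derivable z := [/\ dx_ok u z, dx_ok v z, dy_ok u z & dy_ok v z].

Lemma div300_lt_div150 (s : R) : 0 < s -> s / 300 < s / 150. Proof. by move=> ?; lra. Qed.

(** Partial derivatives at [z] suffice because a piece tests horizontal and vertical segments only;
    control on a full square comes later, from requiring the four neighbours to lie in the same
    piece. *)
Lemma capture k z : 0 <= k -> k <= 1 / 1000 -> all_derivable z -> conf k z -> 0 < energy z ->
  exists (a b d : rat) (m : nat), [/\ ratr a != 0 :> R, 0 <= ratr d :> R,
    10000 * (ratr d : R) ^+ 2 <= (ratr a) ^+ 2 + (ratr b) ^+ 2 & piece F (ratr a) (ratr b) (ratr d) m z].
Proof.
move=> k0 k1 [ok1 ok2 ok3 ok4] cz e0; pose s := Num.sqrt (energy z).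
have s0 : 0 < s by rewrite sqrtr_gt0.
have s2 : s ^+ 2 = energy z by rewrite sqr_sqrtr// ltW.
move: cz; rewrite /conf -s2 => cz.
set ux := Dx u z in cz ok1; set vx := Dx v z in cz ok2; set uy := Dy u z in cz ok3; set vy := Dy v z in cz ok4.
have e2 : s ^+ 2 = ux ^+ 2 + vx ^+ 2 by rewrite s2.
have ks : (k * s) ^+ 2 <= (s / 1000) ^+ 2.
  by apply: abs_le_sqr; rewrite ger0_norm ?mulr_ge0 ?(ltW s0)// mulrC ler_wpM2l ?(ltW s0)//; lra.
have s1000 : 0 <= s / 1000 by apply: divr_ge0; [exact: ltW|rewrite ler0n].
have cr1 : `|uy + vx| <= s / 1000.
  apply: sqr_le_abs; first exact: s1000.
  by apply: le_trans ks; rewrite exprMn; apply: le_trans cz; rewrite lerDl sqr_ge0.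
have cr2 : `|vy - ux| <= s / 1000.
  apply: sqr_le_abs; first exact: s1000.
  by apply: le_trans ks; rewrite exprMn; apply: le_trans cz; rewrite lerDr sqr_ge0.
have s20 : 0 < s / 2000 by apply: divr_gt0; [exact: s0|rewrite ltr0n].
have [a [a0 aE]] := ex_rat_near ux s20.
have [b [_ bE]] := ex_rat_near vx s20.
(* [s / 300] leaves room for three errors: [s / 2000] in the difference quotient, [s / 2000] in the
   choice of rational [a] and [b], and [s / 1000] in the Cauchy-Riemann equations. [s / 150] is
   small enough for [10000 d^2 <= a^2 + b^2]. *)
have [d /andP[d1 d2]] := @ex_rat_between (s / 300) (s / 150) (div300_lt_div150 s0).
have d0 : 0 <= (ratr d : R) by apply/ltW; apply: lt_trans d1; apply: divr_gt0; [exact: s0|rewrite ltr0n].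
have [r1 r10 h1] := is_derive_quot ok1 s20.
have [r2 r20 h2] := is_derive_quot ok2 s20.
have [r3 r30 h3] := is_derive_quot ok3 s20.
have [r4 r40 h4] := is_derive_quot ok4 s20.
have [|m hm] := @invn_lt R (Num.min (Num.min r1 r2) (Num.min r3 r4)).
  by rewrite !lt_min r10 r20 r30 r40.
exists a, b, d, m; split; [exact: a0|exact: d0|exact: (capture_num s0 e2 aE bE d0 d2)|].
move=> t tm; have := le_lt_trans tm hm; rewrite !lt_min => /andP[/andP[t1 t2] /andP[t3 t4]].
have tn := normr_ge0 t.
have tri (x y c1 c2 : R) : `|x| <= c1 -> `|y| <= c2 -> `|x + y| <= c1 + c2.
  by move=> hx hy; apply: le_trans (ler_normD _ _) _; exact: lerD.
have l1 : s / 2000 + s / 2000 <= s / 300 by clear -s0; lra.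
have l2 : s / 2000 + (s / 1000 + s / 2000) <= s / 300 by clear -s0; lra.
have td (c : R) : c <= s / 300 -> c * `|t| <= ratr d * `|t|.
  by move=> hc; rewrite ler_wpM2r//; apply/ltW; exact: le_lt_trans d1.
split.
- rewrite [X in `|X|](_ : _ = (u (z.1 + t, z.2) - u (z.1, z.2) - t * ux) + t * (ux - ratr a)); last by rewrite -surjective_pairing; ring.
  apply: le_trans (tri _ _ _ _ (h1 t t1) (_ : _ <= `|t| * (s / 2000))) _; first by rewrite normrM ler_wpM2l.
  by rewrite [`|t| * _]mulrC -mulrDl; exact: td.
- rewrite [X in `|X|](_ : _ = (v (z.1 + t, z.2) - v (z.1, z.2) - t * vx) + t * (vx - ratr b)); last by rewrite -surjective_pairing; ring.
  apply: le_trans (tri _ _ _ _ (h2 t t2) (_ : _ <= `|t| * (s / 2000))) _; first by rewrite normrM ler_wpM2l.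
  by rewrite [`|t| * _]mulrC -mulrDl; exact: td.
- rewrite [X in `|X|](_ : _ = (u (z.1, z.2 + t) - u (z.1, z.2) - t * uy) + t * ((uy + vx) + (ratr b - vx))); last by rewrite -surjective_pairing; ring.
  apply: le_trans (tri _ _ _ _ (h3 t t3) (_ : _ <= `|t| * (s / 1000 + s / 2000))) _.
    by rewrite normrM ler_wpM2l//; apply: tri => //; rewrite distrC.
  by rewrite [`|t| * _]mulrC -mulrDl; exact: td.
- rewrite [X in `|X|](_ : _ = (v (z.1, z.2 + t) - v (z.1, z.2) - t * vy) + t * ((vy - ux) + (ux - ratr a))); last by rewrite -surjective_pairing; ring.
  apply: le_trans (tri _ _ _ _ (h4 t t4) (_ : _ <= `|t| * (s / 1000 + s / 2000))) _.
    by rewrite normrM ler_wpM2l//; apply: tri.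
  by rewrite [`|t| * _]mulrC -mulrDl; exact: td.
Qed.

Lemma piece_energy a b d m z : 0 <= d -> 10000 * d ^+ 2 <= a ^+ 2 + b ^+ 2 ->
  piece F a b d m z -> all_derivable z -> energy z <= 1031 / 1000 * (a ^+ 2 + b ^+ 2).
Proof.
move=> d0 dA Pz [ok1 ok2 _ _].
have m0 : 0 < (m.+1%:R^-1 : R) by rewrite invr_gt0.
have h1 : `|Dx u z - a| <= d.
  apply: (is_derive_lip ok1 m0) => t tm; have [+ _ _ _] := Pz t tm.
  by rewrite /u -surjective_pairing.
have h2 : `|Dx v z - b| <= d.
  apply: (is_derive_lip ok2 m0) => t tm; have [_ + _ _] := Pz t tm.
  by rewrite /v -surjective_pairing.
rewrite /energy; have := abs_le_sqr h1; have := abs_le_sqr h2.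
move: (Dx u z) (Dx v z) => X Y k2 k1.
have : 0 <= (100 * (X - a) - a) ^+ 2 by exact: sqr_ge0.
have : 0 <= (100 * (Y - b) - b) ^+ 2 by exact: sqr_ge0.
nra.
Qed.
End pt.

(** The factor 97/100 is lost by [image_box_ge] in each direction and 1031/1000 by [piece_energy];
    together they fit into 11/10. *)
Lemma area_const (R : realType) (q : R) : 0 <= q ->
  1031 / 1000 * q <= 11 / 10 * ((97 / 100) ^+ 2 * q).
Proof. by move=> q0; lra. Qed.

Section ai.
Variable R : realType.
Variables (F G : R * R -> R * R) (k : R).
Hypotheses (cF : continuous F) (cG : continuous G) (FK : cancel F G) (GK : cancel G F).
Hypotheses (k0 : 0 <= k) (k1 : k <= 1 / 1000).
Hypotheses (aok : {ae lxl R, forall z, all_derivable F z}) (acf : {ae lxl R, forall z, conf F k z}).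

Lemma measurable_energy : measurable_fun setT (energy F).
Proof.
apply: measurable_funD; apply: measurable_funX; apply: measurable_Dx; [exact: cont_fst|exact: cont_snd].
Qed.

Lemma energy_ge0 z : 0 <= energy F z.
Proof. by rewrite addr_ge0 ?sqr_ge0. Qed.

(* countably many pieces with rational parameters cover almost every point of
   positive energy *)
Let I := (((rat * rat) * rat) * nat)%type.
Let dec (n : nat) : I := odflt (1, 0, 0, 0%N) (unpickle n).
Let ok (i : I) := [&& (ratr i.1.1.1 : R) != 0, 0 <= (ratr i.1.2 : R) &
  10000 * (ratr i.1.2 : R) ^+ 2 <= ratr i.1.1.1 ^+ 2 + ratr i.1.1.2 ^+ 2].
(** Invalid codes are replaced by the parameters of the identity map with tolerance 0, so that every
    index gives a valid piece. *)
Let dec' n : I := if ok (dec n) then dec n else (1, 0, 0, 0%N).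
Let a n : R := ratr (dec' n).1.1.1.
Let b n : R := ratr (dec' n).1.1.2.
Let d n : R := ratr (dec' n).1.2.
Let m n : nat := (dec' n).2.

Let valid n : [/\ a n != 0, 0 <= d n & 10000 * (d n) ^+ 2 <= (a n) ^+ 2 + (b n) ^+ 2].
Proof.
rewrite /a /b /d /dec'; case: ifPn => [/and3P[]//|_] /=.
by rewrite !rmorph0 !rmorph1 lexx oner_neq0; split=> //; rewrite !expr0n mulr0 expr1n addr0.
Qed.

Let P n := piece F (a n) (b n) (d n) (m n).
Let P' := seqDU P.

Let mP' n : measurable (P' n). Proof. exact: measurable_seqDU_piece. Qed.

(** Points of zero energy contribute nothing, and almost every other point of [D] lies in a piece.
    On a piece the energy is compared with the constant [a^2 + b^2], and the finite sums are bounded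
    by [area_finite]. *)
Lemma area_ineq (O D : set (R * R)) (M : R) : open O -> measurable D -> 0 <= M ->
  D `<=` F @^-1` O -> D `<=` box (0, 0) M ->
  (\int[lxl R]_(z in D) (energy F z)%:E <= (11 / 10)%:E * lxl R O)%E.
Proof.
move=> oO mD M0 DO DM.
have me : measurable_fun setT (fun z => (energy F z)%:E) by apply/measurable_EFinP; exact: measurable_energy.
have e0 z : (0 <= (energy F z)%:E)%E by rewrite lee_fin energy_ge0.
pose W := \bigcup_n (P' n `&` D).
have mW : measurable W by apply: bigcupT_measurable => n; exact: measurableI.
have WD : W `<=` D by move=> z [n _ []].
have tP : trivIset setT (fun n => P' n `&` D).
  apply/trivIsetP => i j _ _ ij; have /trivIsetP/(_ i j Logic.I Logic.I ij) h := trivIset_seqDU P.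
  rewrite -subset0 => z [[z1 _] [z2 _]].
  by have : (P' i `&` P' j) z by []; rewrite /P' h.
have -> : (\int[lxl R]_(z in D) (energy F z)%:E = \int[lxl R]_(z in W) (energy F z)%:E)%E.
  rewrite -[in LHS](setDUK WD) ge0_integral_setU//.
  - rewrite [X in (_ + X)%E](_ : _ = 0%E) ?adde0//.
    rewrite (@ge0_ae_eq_integral _ _ _ (lxl R) _ _ (cst 0%E)) ?integral0//.
    + exact: measurableD.
    + exact: measurable_funTS.
    + near=> z; move=> [Dz nW] /=; congr EFin; apply/eqP/negPn/negP => ez.
      have ze : 0 < energy F z by rewrite lt_neqAle eq_sym ez energy_ge0.
      have okz : all_derivable F z by apply: (near aok z).
      have cfz : conf F k z by apply: (near acf z).
      have [qa [qb [qd [qm [v1 v2 v3 pz]]]]] := capture k0 k1 okz cfz ze.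
      pose i : I := (qa, qb, qd, qm).
      have di : dec' (pickle i) = i.
        by rewrite /dec' /dec pickleK /= ifT// /ok /= v1 v2.
      apply: nW; suff : (\bigcup_n P' n) z by move=> [n _ h]; exists n.
      by rewrite -seqDU_bigcup_eq; exists (pickle i) => //; rewrite /P /a /b /d /m di.
  - exact: measurableD.
  - exact: measurable_funTS.
  - by apply/disj_setPRL => z [].
rewrite ge0_integral_bigcup//; [|by move=> n; exact: measurableI|exact: measurable_funTS].
apply: lime_le.
  by apply: is_cvg_nneseries => n _ _; exact: integral_ge0.
near=> N; rewrite big_mkord.
have H := @area_finite R F G cF cG FK GK a b d m valid O D M N oO mD M0 DO DM.
apply: (@le_trans _ _ ((11 / 10)%:E * \sum_(n < N) ((97 / 100) ^+ 2 * (a n ^+ 2 + b n ^+ 2))%:E * lxl R (P' n `&` D))%E); last first.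
  by apply: lee_wpmul2l => //; rewrite lee_fin divr_ge0.
have A0 n : 0 <= a n ^+ 2 + b n ^+ 2 by rewrite addr_ge0 ?sqr_ge0.
rewrite ge0_sume_distrr; last by move=> n _; rewrite mule_ge0// lee_fin mulr_ge0// sqr_ge0.
apply: lee_sum => n _.
apply: (@le_trans _ _ (\int[lxl R]_(z in P' n `&` D) cst (1031 / 1000 * (a n ^+ 2 + b n ^+ 2))%:E z)%E).
  have [v1 v2 v3] := valid n.
  apply: ae_ge0_le_integral => //.
  - exact: measurableI.
  - exact: measurable_funTS.
  - by move=> z _; rewrite lee_fin; apply: mulr_ge0; [apply: divr_ge0; exact: ler0n|exact: A0].
  - near=> z; move=> [[Pz _] _]; rewrite lee_fin.
    have okz : all_derivable F z by apply: (near aok z).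
    exact: piece_energy v2 v3 Pz okz.
rewrite integral_cst; last exact: measurableI.
rewrite muleA -EFinM; apply: lee_wpmul2r => //.
by rewrite lee_fin; exact: area_const.
Unshelve. all: by end_near. Qed.
End ai.

(** * Dirichlet energy of the layer functions *)

Section clamp.
Variable R : realType.

Definition clamp (p q x : R) : R := Num.max 0 (Num.min 1 ((x - p) / (q - p))).

Lemma clamp_ge0 p q x : 0 <= clamp p q x.
Proof. by rewrite /clamp le_max lexx. Qed.

Lemma clamp_le1 p q x : clamp p q x <= 1.
Proof. by rewrite /clamp ge_max ler01 ge_min lexx. Qed.

Lemma clamp0 p q x : p < q -> x <= p -> clamp p q x = 0.
Proof.
move=> pq xp; rewrite /clamp max_l// ge_min; apply/orP; right.
by rewrite ler_pdivrMr ?subr_gt0// mul0r subr_le0.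
Qed.

Lemma clamp1 p q x : p < q -> q <= x -> clamp p q x = 1.
Proof.
move=> pq qx; rewrite /clamp min_l ?max_r//.
by rewrite ler_pdivlMr ?subr_gt0// mul1r lerB.
Qed.

Lemma clamp_id p q x : p < q -> p <= x -> x <= q -> clamp p q x = (x - p) / (q - p).
Proof.
move=> pq px xq; rewrite /clamp min_r ?max_r//.
  by rewrite divr_ge0 ?subr_ge0// ltW.
by rewrite ler_pdivrMr ?subr_gt0// mul1r lerB.
Qed.

Lemma clamp_lip p q x y : p < q -> `|clamp p q y - clamp p q x| <= (q - p)^-1 * `|y - x|.
Proof.
move=> pq; wlog xy : x y / x <= y => [H|].
  by have [/H//|/ltW/H] := leP x y; rewrite distrC [`|x - y|]distrC.
have q0 : 0 < q - p by rewrite subr_gt0.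
rewrite [`|y - x|]ger0_norm ?subr_ge0// [_^-1 * _]mulrC.
have e : (y - x) / (q - p) = (y - p) / (q - p) - (x - p) / (q - p) by rewrite -mulrBl; congr (_ / _); ring.
have l : (x - p) / (q - p) <= (y - p) / (q - p) by rewrite ler_pM2r ?invr_gt0// lerB.
rewrite e /clamp; move: l; set A := (x - p) / _; set B := (y - p) / _ => l.
rewrite ler_norml; apply/andP; split;
  case: (leP 1 A) => ?; case: (leP 1 B) => ?; (case: (leP 0 A) => ? || idtac);
  (case: (leP 0 B) => ? || idtac); rewrite ?(max_r (@ler01 R)); lra.
Qed.

Lemma derive_max0 (f : R -> R) (x d : R) : is_derive x 1 f d -> (forall t, f t <= f x) -> d = 0.
Proof.
move=> fd fx; apply/eqP/negPn/negP => d0.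
have n0 : 0 < `|d| / 2 by rewrite divr_gt0 ?normr_gt0.
have [r r0 h] := is_derive_quot fd n0.
have t0 : 0 < r / 2 by rewrite divr_gt0.
have e : `|Num.sg d * (r / 2)| = r / 2 by rewrite normrM normr_sg d0 mul1r gtr0_norm.
have := h (Num.sg d * (r / 2)); rewrite e => H.
have /H : r / 2 < r by lra.
rewrite ler_norml => /andP[h1 _]; have := fx (x + Num.sg d * (r / 2)).
move: h1; rewrite [_ * _ * d]mulrAC -normrEsg => h1 h2.
have : 0 < `|d| * (r / 2) by rewrite mulr_gt0// normr_gt0.
nra.
Qed.

Lemma derive_min0 (f : R -> R) (x d : R) : is_derive x 1 f d -> (forall t, f x <= f t) -> d = 0.
Proof.
move=> fd fx; have h := is_deriveN fd.
apply/eqP; rewrite -oppr_eq0; apply/eqP.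
by apply: (derive_max0 h) => t; rewrite lerN2.
Qed.

(** Off []p, q[] the composite is at its minimum 0 or its maximum 1, so that its derivative, if
    there is one, vanishes. Existence is a hypothesis: it holds almost everywhere by absolute
    continuity, and the kinks need no separate treatment. *)
Lemma derive_clamp (a b : R -> R) (x da db d p q : R) : p < q ->
  is_derive x 1 a da -> is_derive x 1 b db ->
  let s := fun t => a t ^+ 2 + b t ^+ 2 in
  is_derive x 1 (fun t => clamp p q (s t)) d ->
  d = if (p < s x) && (s x < q) then 2 * (a x * da + b x * db) / (q - p) else 0.
Proof.
move=> pq ha hb s hd; case: ifPn => [/andP[h1 h2]|].
  have hs : is_derive x 1 s (2 * (a x * da + b x * db)).
    apply: is_derive_eq; rewrite /GRing.scale /=; ring.
  have hs2 : is_derive x 1 (fun t => (s t - p) / (q - p)) (2 * (a x * da + b x * db) / (q - p)).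
    have h := @is_deriveZ R R R (s - cst p) ((q - p)^-1) x 1 _ (is_deriveB hs (is_derive_cst p x 1)).
    rewrite (_ : (fun t => (s t - p) / (q - p)) = (q - p)^-1 *: (s - cst p)); last first.
      by apply/funext => t; rewrite /= mulrC.
    by apply: is_derive_eq; rewrite subr0 /GRing.scale /= mulrC.
  have cs : {for x, continuous s}.
    apply: differentiable_continuous; apply/derivable1_diffP; exact: (@ex_derive _ _ _ _ _ _ _ hs).
  have hs3 : is_derive x 1 (fun t => clamp p q (s t)) (2 * (a x * da + b x * db) / (q - p)).
    apply: near_eq_is_derive hs2; near=> t.
    have i1 : p < s t by near: t; exact: (cvgr_gt (s x) cs).
    have i2 : s t < q by near: t; exact: (cvgr_lt (s x) cs).
    by rewrite clamp_id// ltW.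
  by rewrite -(@derive_val _ _ _ _ _ _ _ hd) (@derive_val _ _ _ _ _ _ _ hs3).
rewrite negb_and -!leNgt => /orP[h|h].
  by apply: (derive_min0 hd) => t; rewrite (clamp0 pq h) clamp_ge0.
by apply: (derive_max0 hd) => t; rewrite (clamp1 pq h) clamp_le1.
Unshelve. all: by end_near. Qed.

(* [A + i B = (u' + i v')(u - i v)], so the first two squares add up to [n e];
   [(e1, e2)] is the defect in the Cauchy-Riemann equations *)
Lemma chain_num (u v x y e1 e2 k : R) : 0 <= k ->
  e1 ^+ 2 + e2 ^+ 2 <= k ^+ 2 * (x ^+ 2 + y ^+ 2) ->
  (u * x + v * y) ^+ 2 + (u * (e1 - y) + v * (e2 + x)) ^+ 2 <=
  (u ^+ 2 + v ^+ 2) * ((1 + k) ^+ 2 * (x ^+ 2 + y ^+ 2)).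
Proof.
move=> k0 h; pose n := u ^+ 2 + v ^+ 2; pose e := x ^+ 2 + y ^+ 2.
have n0 : 0 <= n by rewrite addr_ge0 ?sqr_ge0.
pose B := v * x - u * y; pose E := u * e1 + v * e2.
have c1 : E ^+ 2 <= k ^+ 2 * (n * e).
  have -> : k ^+ 2 * (n * e) = n * (k ^+ 2 * e) by ring.
  apply: (le_trans _ (ler_wpM2l n0 h)); rewrite -subr_ge0.
  by rewrite (_ : _ - _ = (u * e2 - v * e1) ^+ 2) ?sqr_ge0// /n /E; ring.
have c2 : B ^+ 2 <= n * e.
  by rewrite -subr_ge0 (_ : _ - _ = (u * x + v * y) ^+ 2) ?sqr_ge0// /n /e /B; ring.
have ne0 : 0 <= n * e by rewrite mulr_ge0// addr_ge0 ?sqr_ge0.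
have c3 : B * E <= k * (n * e).
  have : `|B * E| <= k * (n * e); last exact/le_trans/ler_norm.
  apply: sqr_le_abs; first exact: mulr_ge0.
  have -> : (k * (n * e)) ^+ 2 = (n * e) * (k ^+ 2 * (n * e)) by ring.
  by rewrite exprMn ler_pM ?sqr_ge0.
have -> : (u * x + v * y) ^+ 2 + (u * (e1 - y) + v * (e2 + x)) ^+ 2 = n * e + 2 * (B * E) + E ^+ 2.
  by rewrite /n /e /B /E; ring.
rewrite -/n -/e; have -> : n * ((1 + k) ^+ 2 * e) = n * e + 2 * (k * (n * e)) + k ^+ 2 * (n * e) by ring.
by rewrite lerD// lerD2l ler_pM2l.
Qed.
End clamp.

(** * Squared distances and their clamped compositions *)

Section sqdist.
Variable R : realType.
Implicit Types (u v w : R * R -> R) (c : R * R).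

Definition sqd c (z : R * R) : R := (z.1 - c.1) ^+ 2 + (z.2 - c.2) ^+ 2.

Lemma sqd_ge0 c z : 0 <= sqd c z.
Proof. by rewrite addr_ge0 ?sqr_ge0. Qed.

Lemma sqdE c : sqd c = (fun z : R * R => z.1 ^+ 2 + z.2 ^+ 2) \o (fun z => (z.1 - c.1, z.2 - c.2)).
Proof. by []. Qed.

Lemma continuous_sqd c : continuous (sqd c).
Proof.
move=> z; rewrite sqdE; apply: continuous_comp; last exact: continuous_sq2.
apply: (@cvg_pair _ _ _ (nbhs z) (nbhs (z.1 - c.1)) (nbhs (z.2 - c.2)) _ _ _ (fun z => z.1 - c.1) (fun z => z.2 - c.2)).
  by apply: cvgB; [exact: cvg_fst|exact: cvg_cst].
by apply: cvgB; [exact: cvg_snd|exact: cvg_cst].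
Qed.

Lemma disc_sqd c r : (fun z : R * R => (z.1 - c.1, z.2 - c.2)) @^-1` (disc r) = [set z | sqd c z < r ^+ 2].
Proof. by []. Qed.

Lemma measurable_sqd_lt c (q : R) : measurable [set z | sqd c z < q].
Proof. by apply: open_measurable2; apply: open_lt2; exact: continuous_sqd. Qed.

Lemma measurable_sqd_le c (q : R) : measurable [set z | sqd c z <= q].
Proof. by apply: closed_measurable2; apply: closed_le2; exact: continuous_sqd. Qed.

Lemma lxl_sqd_lt c (r : R) : lxl R [set z | sqd c z < r ^+ 2] = (disc_area R * r ^+ 2)%:E.
Proof. by rewrite -disc_sqd lxl_shift ?lxl_disc//; exact: measurable_disc. Qed.

Lemma lxl_annulus c (r s : R) : 0 <= r -> r < s ->
  (lxl R [set z | (r ^+ 2 < sqd c z < s ^+ 2)%R] <= (disc_area R * (s ^+ 2 - r ^+ 2))%:E)%E.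
Proof.
move=> r0 rs; set A := [set z | _].
have rs2 : r ^+ 2 < s ^+ 2 by rewrite ltr_pXn2r ?nnegrE// (le_trans r0)// ltW.
have AE : A = [set z | sqd c z < s ^+ 2] `\` [set z | sqd c z <= r ^+ 2].
  by apply/seteqP; split => z; rewrite /A /=; [move=> /andP[h1 h2]; split => //; apply/negP; rewrite -ltNge
    |move=> [-> /negP]; rewrite -ltNge => ->].
have mA : measurable A by rewrite AE; apply: measurableD; [exact: measurable_sqd_lt|exact: measurable_sqd_le].
have mB : measurable [set z | sqd c z < r ^+ 2] by exact: measurable_sqd_lt.
have fB : lxl R [set z | sqd c z < r ^+ 2] \is a fin_num by rewrite lxl_sqd_lt.
rewrite mulrBr EFinB -!(lxl_sqd_lt c) leeBrDr//.
rewrite -measureU//; last first.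
  by rewrite -subset0 => z [/andP[h1 _] h2]; move: (lt_trans h1 h2); rewrite ltxx.
apply: le_lxl; [exact: measurableU|exact: measurable_sqd_lt|].
by move=> z [/andP[]//|h]; exact: lt_trans h rs2.
Qed.

Lemma AC_clamp (a b : R) (u v : R -> R) (c : R * R) (p q : R) : p < q -> a <= b ->
  AC a b u -> AC a b v -> AC a b (fun x => clamp p q (sqd c (u x, v x))).
Proof.
move=> pq ab hu hv.
have sh (w : R -> R) (d : R) : AC a b w -> AC a b (fun x => w x - d).
  move=> h; apply: (@AC_lip2 R a b w w _ 1 ler01 h h) => x y _ _ _; rewrite mul1r.
  by rewrite (_ : w y - d - (w x - d) = w y - w x) ?lerDl//; ring.
have hu2 := AC_mul ab (sh u c.1 hu) (sh u c.1 hu); have hv2 := AC_mul ab (sh v c.2 hv) (sh v c.2 hv).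
have i0 : 0 <= (q - p)^-1 by rewrite invr_ge0 subr_ge0 ltW.
apply: (AC_lip2 i0 hu2 hv2) => x y _ _ _.
apply: le_trans (clamp_lip _ _ pq) _; rewrite ler_wpM2l//.
by rewrite /sqd /= !expr2; set A := _ * _; set B := _ * _; set A' := (u x - _) * _; set B' := (v x - _) * _;
  rewrite (_ : _ - _ = (A - A') + (B - B')) ?ler_normD//; ring.
Qed.

Lemma AC_add (a b : R) (u v : R -> R) : AC a b u -> AC a b v -> AC a b (fun x => u x + v x).
Proof.
move=> hu hv; apply: (@AC_lip2 R a b u v _ 1 ler01 hu hv) => x y _ _ _.
by rewrite mul1r (_ : _ - _ = (u y - u x) + (v y - v x)) ?ler_normD//; ring.
Qed.

Lemma opp_nat_le (n : nat) : (- n%:R : R) <= n%:R.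
Proof. by rewrite -subr_ge0 opprK addr_ge0. Qed.

Lemma ACLx_clamp u v c p q : p < q -> ACLx u -> ACLx v ->
  ACLx (fun z => clamp p q (sqd c (u z, v z))).
Proof.
move=> pq; apply: filterS2 => y hu hv n.
exact: (AC_clamp c pq (opp_nat_le n) (hu n) (hv n)).
Qed.

Lemma ACLy_clamp u v c p q : p < q -> ACLy u -> ACLy v ->
  ACLy (fun z => clamp p q (sqd c (u z, v z))).
Proof. by move=> pq hu hv; exact: (ACLx_clamp c pq hu hv). Qed.

Lemma ACLx_add u v : ACLx u -> ACLx v -> ACLx (fun z => u z + v z).
Proof. by apply: filterS2 => y hu hv n; exact: (AC_add (hu n) (hv n)). Qed.

Lemma ACLy_add u v : ACLy u -> ACLy v -> ACLy (fun z => u z + v z).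
Proof. by move=> hu hv; exact: (ACLx_add hu hv). Qed.

Lemma ACLx_cst (a : R) : ACLx (fun=> a).
Proof.
apply: aeW => y n; apply: (@lip_AC R _ _ _ 0) => // x x' _ _ _.
by rewrite subrr normr0 mul0r.
Qed.

Lemma ACLy_cst (a : R) : ACLy (fun=> a).
Proof. exact: ACLx_cst. Qed.

Lemma dx_ok_add u v z : dx_ok u z -> dx_ok v z -> Dx (fun z => u z + v z) z = Dx u z + Dx v z.
Proof. by case: z => x y hu hv; apply: Dx_derive; exact: (is_deriveD hu hv). Qed.

Lemma dy_ok_add u v z : dy_ok u z -> dy_ok v z -> Dy (fun z => u z + v z) z = Dy u z + Dy v z.
Proof. by move=> hu hv; exact: (dx_ok_add hu hv). Qed.

Lemma Dx_cst (a : R) z : Dx (fun=> a) z = 0.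
Proof. by case: z => x y; apply: Dx_derive; exact: is_derive_cst. Qed.

Lemma Dy_cst (a : R) z : Dy (fun=> a) z = 0.
Proof. exact: (Dx_cst a). Qed.

Lemma Dx_clamp u v c p q z : p < q -> dx_ok u z -> dx_ok v z ->
  dx_ok (fun z => clamp p q (sqd c (u z, v z))) z ->
  Dx (fun z => clamp p q (sqd c (u z, v z))) z =
  if p < sqd c (u z, v z) < q then
    2 * ((u z - c.1) * Dx u z + (v z - c.2) * Dx v z) / (q - p) else 0.
Proof.
case: z => x y pq hu hv hw.
have sh w (d : R) : dx_ok w (x, y) -> is_derive x 1 (fun t => w (t, y) - d) (Dx w (x, y)).
  by move=> h; have h2 := is_deriveB h (is_derive_cst d x 1); rewrite -[Dx w _]subr0.
exact: (derive_clamp pq (sh u c.1 hu) (sh v c.2 hv) hw).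
Qed.

Lemma Dy_clamp u v c p q z : p < q -> dy_ok u z -> dy_ok v z ->
  dy_ok (fun z => clamp p q (sqd c (u z, v z))) z ->
  Dy (fun z => clamp p q (sqd c (u z, v z))) z =
  if p < sqd c (u z, v z) < q then
    2 * ((u z - c.1) * Dy u z + (v z - c.2) * Dy v z) / (q - p) else 0.
Proof. by case: z => x y pq hu hv hw; exact: (Dx_clamp pq hu hv hw). Qed.
End sqdist.

(** A ramp that is affine in the squared distance costs [4 * (81 / 64) / (17 / 64) = 324 / 17] times
    [disc_area]; rounding up to 22 absorbs the area loss 11/10 and the factor [(1 + k)^2]. *)
Lemma layer_const (R : realType) (p q k K : R) : 0 < p -> q = 81 / 64 * p -> 0 <= k -> k <= 1 / 1000 -> 0 <= K ->
  4 * q * (1 + k) ^+ 2 / (q - p) ^+ 2 * (11 / 10 * (K * (q - p))) <= 22 * K.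
Proof.
move=> p0 -> k0 k1 K0.
have -> : 4 * (81 / 64 * p) * (1 + k) ^+ 2 / (81 / 64 * p - p) ^+ 2 * (11 / 10 * (K * (81 / 64 * p - p))) =
  324 / 17 * (11 / 10) * (1 + k) ^+ 2 * K by field; rewrite gt_eqF//; lra.
rewrite ler_wpM2r//.
have h : (1 + k) ^+ 2 <= (1 + 1 / 1000) ^+ 2 by have := ler_wpM2r k0 k1; rewrite !expr2; lra.
by lra.
Qed.

Section layer.
Variable R : realType.
Variables (F G : R * R -> R * R) (k : R).
Hypotheses (cF : continuous F) (cG : continuous G) (FK : cancel F G) (GK : cancel G F).
Hypotheses (k0 : 0 <= k) (k1 : k <= 1 / 1000).
Hypotheses (aok : {ae lxl R, forall z, all_derivable F z}) (acf : {ae lxl R, forall z, conf F k z}).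
Let u z := (F z).1.
Let v z := (F z).2.
Hypotheses (ux : ACLx u) (vx : ACLx v) (uy : ACLy u) (vy : ACLy v).

Definition grad2 (U : R * R -> R) z := Dx U z ^+ 2 + Dy U z ^+ 2.

Lemma grad2_ge0 U z : 0 <= grad2 U z.
Proof. by rewrite addr_ge0 ?sqr_ge0. Qed.

Lemma measurable_grad2 U : continuous U -> measurable_fun setT (grad2 U).
Proof.
by move=> cU; apply: measurable_funD; apply: measurable_funX; [exact: measurable_Dx|exact: measurable_Dy].
Qed.

Lemma continuous_clampF c p q : p < q -> continuous (fun z => clamp p q (sqd c (F z))).
Proof.
move=> pq z; rewrite /clamp.
have h : (fun z => sqd c (F z)) @ z --> sqd c (F z).
  by apply: (@continuous_comp _ _ _ F (sqd c)); [exact: cF|exact: continuous_sqd].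
apply: (@continuous_comp _ _ _ (fun z => (sqd c (F z) - p) / (q - p)) (fun t : R => Num.max 0 (Num.min 1 t))).
  by apply: cvgM; [apply: cvgB => //; exact: cvg_cst|exact: cvg_cst].
by apply: continuous_max => //; [exact: cvg_cst|apply: continuous_min => //; exact: cvg_cst].
Qed.

(** The bound is [chain_num] with [|F - c|^2 < q] on the annulus. The second clause is kept apart
    because it makes the gradients of different layers disjointly supported. *)
Lemma grad2_clamp c p q : 0 <= p -> p < q -> {ae lxl R, forall z,
  grad2 (fun z => clamp p q (sqd c (F z))) z <=
    (if p < sqd c (F z) < q then 4 * q * (1 + k) ^+ 2 / (q - p) ^+ 2 * energy F z else 0) /\
  (~~ (p < sqd c (F z) < q) -> Dx (fun z => clamp p q (sqd c (F z))) z = 0 /\ Dy (fun z => clamp p q (sqd c (F z))) z = 0)}.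
Proof.
move=> p0 pq; have cw := continuous_clampF (c := c) pq.
have E : (fun z => clamp p q (sqd c (F z))) = (fun z => clamp p q (sqd c (u z, v z))).
  by apply/funext => z; rewrite /u /v -surjective_pairing.
have wx := ae_derivable cw; have wy := ae_derivable_y cw; rewrite E in wx wy *.
have := wx (ACLx_clamp c pq ux vx); have := wy (ACLy_clamp c pq uy vy).
move=> ay ax; near=> z.
have [d1 d2 d3 d4] : all_derivable F z by apply: (near aok z).
have hx : dx_ok (fun z => clamp p q (sqd c (u z, v z))) z by apply: (near ax z).
have hy : dy_ok (fun z => clamp p q (sqd c (u z, v z))) z by apply: (near ay z).
have e1 := Dx_clamp pq d1 d2 hx; have e2 := Dy_clamp pq d3 d4 hy.
rewrite /grad2 e1 // e2 // /u /v -surjective_pairing.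
case: ifPn => [/andP[l1 l2]|_]; last by rewrite expr0n addr0.
split=> //.
have cz : conf F k z by apply: (near acf z).
have := @chain_num R ((F z).1 - c.1) ((F z).2 - c.2) (Dx u z) (Dx v z) (Dy u z + Dx v z) (Dy v z - Dx u z) k k0 cz.
rewrite addrK subrK -/(sqd c (F z)) => H.
have q0 : 0 < q - p by rewrite subr_gt0.
rewrite !expr_div_n -mulrDl !exprMn -mulrDr.
rewrite [X in _ <= X]mulrAC ler_pM2r ?invr_gt0 ?exprn_gt0//.
rewrite (_ : 4 * q * _ * _ = 2 ^+ 2 * (q * ((1 + k) ^+ 2 * energy F z))); last by ring.
rewrite ler_pM2l//; apply: le_trans H _.
by rewrite ler_wpM2r ?(ltW l2)// mulr_ge0 ?sqr_ge0// energy_ge0.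
Unshelve. all: by end_near. Qed.

Lemma energy_clamp c (r : R) (D : set (R * R)) (M : R) : 0 < r -> measurable D -> 0 <= M ->
  D `<=` box (0, 0) M ->
  (\int[lxl R]_(z in D) (grad2 (fun z => clamp (r ^+ 2) ((9 / 8 * r) ^+ 2) (sqd c (F z))) z)%:E <=
   (22 * disc_area R)%:E)%E.
Proof.
move=> r0 mD M0 DM; set p := r ^+ 2; set q := (9 / 8 * r) ^+ 2.
have p0 : 0 < p by rewrite exprn_gt0.
have qE : q = 81 / 64 * p by rewrite /q /p; field.
have pq : p < q by rewrite qE; lra.
set w := fun z => _; pose O := [set z | p < sqd c z < q]; pose A := D `&` F @^-1` O.
have oO : open O.
  rewrite (_ : O = [set z | - sqd c z < - p] `&` [set z | sqd c z < q]); last first.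
    by apply/seteqP; split => z; rewrite /O /= ltrN2 => /andP.
  by apply: openI; apply: open_lt2 => z; [apply: cvgN|]; exact: continuous_sqd.
have mA : measurable A.
  by apply: measurableI => //; apply: measurable_pre; [exact: continuous_measurable22|exact: open_measurable2].
pose C := 4 * q * (1 + k) ^+ 2 / (q - p) ^+ 2.
have C0 : 0 <= C by rewrite divr_ge0 ?sqr_ge0// mulr_ge0 ?sqr_ge0// mulr_ge0// qE ltW// mulr_gt0.
have me : measurable_fun setT (fun z => (C * energy F z)%:E).
  by apply/measurable_EFinP; apply: measurable_funM => //; exact: measurable_energy.
apply: (@le_trans _ _ (\int[lxl R]_(z in A) (C * energy F z)%:E)%E).
  rewrite /A setIC integral_mkcondl; apply: ae_ge0_le_integral => //.
  - by move=> z _; rewrite lee_fin grad2_ge0.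
  - by apply: measurable_funTS; apply/measurable_EFinP; apply: measurable_grad2; exact: continuous_clampF.
  - by move=> z _; apply: erestrict_ge0 => y _; rewrite lee_fin mulr_ge0// energy_ge0.
  - apply: measurable_funTS; apply/(measurable_restrictT _ _).1; last exact: measurable_funTS.
    by apply: measurable_pre; [exact: continuous_measurable22|exact: open_measurable2].
  - have := grad2_clamp c (ltW p0) pq; apply: filterS => z [h _] Dz.
    rewrite /patch; case: ifPn => [|]; rewrite ?inE ?notin_setE => hz.
      by move: h; rewrite [X in if X then _ else _]hz lee_fin.
    by move: h; rewrite ifF ?lee_fin//; apply/negP.
rewrite (_ : (fun z => (C * energy F z)%:E) = (fun z => C%:E * (energy F z)%:E)%E); last by apply/funext.
rewrite ge0_integralZl//; last 2 first.
- by apply: measurable_funTS; apply/measurable_EFinP; exact: measurable_energy.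
- by move=> z _; rewrite lee_fin energy_ge0.
apply: (@le_trans _ _ (C%:E * ((11 / 10)%:E * lxl R O))%E).
  apply: lee_wpmul2l; first by rewrite lee_fin.
  by apply: (area_ineq cF cG FK GK k0 k1 aok acf oO mA M0) => z []// /DM.
apply: (@le_trans _ _ (C%:E * ((11 / 10)%:E * (disc_area R * (q - p))%:E))%E).
  apply: lee_wpmul2l; first by rewrite lee_fin.
  apply: lee_wpmul2l; first by rewrite lee_fin divr_ge0.
  by apply: lxl_annulus; [exact: ltW|lra].
rewrite -!EFinM lee_fin; apply: layer_const => //; exact/ltW/disc_area_gt0.
Qed.
End layer.

Section layers.
Variable R : realType.

Definition zero_grad (U : R * R -> R) z := Dx U z = 0 /\ Dy U z = 0.

(* [layered F c r n U]: [U] climbs from 0 to [n] as [|F - c|] crosses the annuli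
   of radii [(9 / 8)^j r] and [(9 / 8)^(j + 1) r], [j < n] *)
Definition layered (F : R * R -> R * R) (c : R * R) (r : R) (n : nat) (U : R * R -> R) :=
  [/\ [/\ continuous U, ACLx U & ACLy U],
   forall z, sqd c (F z) <= r ^+ 2 -> U z = 0,
   forall z, ((9 / 8) ^+ n * r) ^+ 2 <= sqd c (F z) -> U z = n%:R,
   {ae lxl R, forall z, ((9 / 8) ^+ n * r) ^+ 2 <= sqd c (F z) -> zero_grad U z} &
   forall (D : set (R * R)) (M : R), measurable D -> 0 <= M -> D `<=` box (0, 0) M ->
   (\int[lxl R]_(z in D) (grad2 U z)%:E <= (22 * disc_area R * n%:R)%:E)%E].

Variables (F G : R * R -> R * R) (k : R).
Hypotheses (cF : continuous F) (cG : continuous G) (FK : cancel F G) (GK : cancel G F).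
Hypotheses (k0 : 0 <= k) (k1 : k <= 1 / 1000).
Hypotheses (aok : {ae lxl R, forall z, all_derivable F z}) (acf : {ae lxl R, forall z, conf F k z}).
Let u z := (F z).1.
Let v z := (F z).2.
Hypotheses (ux : ACLx u) (vx : ACLx v) (uy : ACLy u) (vy : ACLy v).

(** At almost every point at most one layer has a nonzero gradient. There are thus no cross terms,
    and the energy grows linearly in [n]. *)
Lemma layers c r n : 0 < r -> exists U, layered F c r n U.
Proof.
move=> r0; elim: n => [|n [U [[cU Ux Uy] U0 Un Ug Ue]]].
  exists (fun=> 0); split=> //.
  - by split; [exact: cst_continuous|exact: ACLx_cst|exact: ACLy_cst].
  - by apply: aeW => z _; split; [exact: Dx_cst|exact: Dy_cst].
  - move=> D M mD M0 DM; rewrite mulr0; rewrite (eq_integral (cst 0%E)) ?integral0// => z _.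
    by rewrite /grad2 Dx_cst Dy_cst expr0n addr0.
have l1 : (1 : R) < 9 / 8 by lra.
have l0 : (0 : R) < 9 / 8 by lra.
pose s := (9 / 8) ^+ n * r; have s0 : 0 < s by rewrite mulr_gt0// exprn_gt0.
have sS : (9 / 8) ^+ n.+1 * r = 9 / 8 * s by rewrite exprS mulrA.
have ss : s ^+ 2 < (9 / 8 * s) ^+ 2.
  by rewrite [(9 / 8 * s) ^+ 2]exprMn ltr_pMl ?exprn_gt0// exprn_egt1.
pose w z := clamp (s ^+ 2) ((9 / 8 * s) ^+ 2) (sqd c (F z)).
have wE : w = fun z => clamp (s ^+ 2) ((9 / 8 * s) ^+ 2) (sqd c (u z, v z)).
  by apply/funext => z; rewrite /w /u /v -surjective_pairing.
have cw : continuous w by exact: continuous_clampF.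
have wx : ACLx w by rewrite wE; exact: ACLx_clamp.
have wy : ACLy w by rewrite wE; exact: ACLy_clamp.
have rs : r ^+ 2 <= s ^+ 2.
  by rewrite ler_pXn2r ?nnegrE ?(ltW r0) ?(ltW s0)// ler_peMl ?(ltW r0)// exprn_ege1// ltW.
have gw := grad2_clamp cF k0 aok acf ux vx uy vy c (sqr_ge0 s) ss; rewrite -/w in gw.
have ox := ae_derivable cU Ux; have oy := ae_derivable_y cU Uy.
have px := ae_derivable cw wx; have py := ae_derivable_y cw wy.
have ag : {ae lxl R, forall z, [/\ Dx (fun z => U z + w z) z = Dx U z + Dx w z,
   Dy (fun z => U z + w z) z = Dy U z + Dy w z & zero_grad U z \/ zero_grad w z]}.
  near=> z.
  have o1 : dx_ok U z by apply: (near ox). have o2 : dy_ok U z by apply: (near oy).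
  have o3 : dx_ok w z by apply: (near px). have o4 : dy_ok w z by apply: (near py).
  split; [exact: dx_ok_add|exact: dy_ok_add|].
  have [h|h] := lerP (s ^+ 2) (sqd c (F z)).
    by left; move: h; apply: (near Ug).
  right; have := near gw z; case=> // _; apply.
  by rewrite negb_and -leNgt ltW.
exists (fun z => U z + w z); split.
- split; [by move=> z; apply: cvgD; [exact: cU|exact: cw]|exact: ACLx_add|exact: ACLy_add].
- by move=> z h; rewrite U0// /w clamp0 ?addr0// (le_trans h).
- move=> z; rewrite sS => h; rewrite Un ?(le_trans _ h) ?(ltW ss)//.
  by rewrite /w clamp1// -natr1.
- near=> z; rewrite sS => h; have h' : s ^+ 2 <= sqd c (F z) by exact: le_trans (ltW ss) h.
  have [e1 e2 _] : [/\ Dx (fun z => U z + w z) z = Dx U z + Dx w z,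
   Dy (fun z => U z + w z) z = Dy U z + Dy w z & zero_grad U z \/ zero_grad w z] by apply: (near ag).
  rewrite /zero_grad e1 e2.
  have [-> ->] : zero_grad U z by move: h'; apply: (near Ug).
  rewrite !add0r; have := near gw z; case=> // _; apply.
  by rewrite negb_and -!leNgt h orbT.
- move=> D M mD M0 DM.
  have m1 : measurable_fun D (fun z => (grad2 U z)%:E).
    by apply: measurable_funTS; apply/measurable_EFinP; exact: measurable_grad2.
  have m2 : measurable_fun D (fun z => (grad2 w z)%:E).
    by apply: measurable_funTS; apply/measurable_EFinP; exact: measurable_grad2.
  apply: (@le_trans _ _ (\int[lxl R]_(z in D) ((grad2 U z)%:E + (grad2 w z)%:E))%E); last first.
    rewrite ge0_integralD//; [|by move=> z _; rewrite lee_fin grad2_ge0|by move=> z _; rewrite lee_fin grad2_ge0].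
    rewrite -[X in (22 * _ * X)%:E]natr1 mulrDr mulr1 EFinD; apply: leeD; first exact: Ue mD M0 DM.
    exact: (energy_clamp cF cG FK GK k0 k1 aok acf ux vx uy vy c s0 mD M0 DM).
  apply: ae_ge0_le_integral => //.
  + by move=> z _; rewrite lee_fin grad2_ge0.
  + apply: measurable_funTS; apply/measurable_EFinP; apply: measurable_grad2.
    by move=> z; apply: cvgD; [exact: cU|exact: cw].
  + by move=> z _; rewrite adde_ge0// lee_fin grad2_ge0.
  + exact: emeasurable_funD.
  + near=> z => _; rewrite -EFinD lee_fin /grad2; have [e1 e2 e3] : [/\ Dx (fun z => U z + w z) z = Dx U z + Dx w z,
      Dy (fun z => U z + w z) z = Dy U z + Dy w z & zero_grad U z \/ zero_grad w z] by apply: (near ag).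
    rewrite e1 e2; case: e3 => -[-> ->]; by rewrite ?addr0 ?add0r expr0n ?addr0 ?add0r.
Unshelve. all: by end_near. Qed.
End layers.

(** * The length-area method *)

Section goodline.
Variable R : realType.
Notation leb := (@leb R).
Notation swp := (@swp R).
Implicit Types (U f : R * R -> R).

Lemma ge0_integral_rect f p q : measurable_fun setT f -> (forall z, 0 <= f z) ->
  (\int[lxl R]_(z in rect p q) (f z)%:E =
   \int[leb]_(y in `]p.2, q.2]) \int[leb]_(x in `]p.1, q.1]) (f (x, y))%:E)%E.
Proof.
move=> mf f0; have mf' : measurable_fun setT (EFin \o f) by exact/measurable_EFinP.
rewrite integral_mkcond fubini_tonelli2; last 2 first.
- by apply/(measurable_restrictT _ _).1; [exact: measurable_rect|exact: measurable_funTS].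
- by move=> z; apply: erestrict_ge0 => t _; rewrite lee_fin.
rewrite [RHS]integral_mkcond; apply: eq_integral => y _.
rewrite /fubini_G patchE; case: ifPn => yq; last first.
  apply: integral0_eq => x _; rewrite patchE memNset// => -[_ /= h].
  by move/negP: yq; apply; rewrite inE.
rewrite [RHS]integral_mkcond; apply: eq_integral => x _; rewrite !patchE.
suff -> : ((x, y) \in rect p q) = (x \in `]p.1, q.1]%classic) by [].
apply/idP/idP => /set_mem h; apply/mem_set; first by case: h.
by split => //; exact: set_mem yq.
Qed.

Lemma measurable_section_integral f p q : measurable_fun setT f -> (forall z, 0 <= f z) ->
  measurable_fun setT (fun y => \int[leb]_(x in `]p, q]) (f (x, y))%:E)%E.
Proof.
move=> mf f0; pose S : set (R * R) := `]p, q]%classic `*` setT.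
have mS : measurable S by exact: measurableX.
have mf' : measurable_fun setT (EFin \o f) by exact/measurable_EFinP.
have m1 : measurable_fun setT ((EFin \o f) \_ S).
  by apply/(measurable_restrictT _ _).1 => //; exact: measurable_funTS.
have p1 z : (0 <= ((EFin \o f) \_ S) z)%E by apply: erestrict_ge0 => t _; rewrite lee_fin.
have := @measurable_fun_fubini_tonelli_G _ _ _ _ R leb _ m1 p1.
rewrite (_ : fubini_G leb _ = fun y => \int[leb]_(x in `]p, q]) (f (x, y))%:E)%E//.
apply/funext => y; rewrite /fubini_G [RHS]integral_mkcond; apply: eq_integral => x _.
rewrite !patchE; suff -> : ((x, y) \in S) = (x \in `]p, q]%classic) by [].
by apply/idP/idP => /set_mem h; apply/mem_set; [case: h|].
Qed.

Lemma good_point (phi : R -> \bar R) (P : R -> Prop) (p q A : R) : p < q -> 0 <= A ->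
  measurable_fun setT phi -> (forall x, 0 <= phi x)%E -> {ae leb, forall x, P x} ->
  (\int[leb]_(x in `]p, q]) phi x < (A * (q - p))%:E)%E ->
  exists x, [/\ p < x, x <= q, P x & (phi x <= A%:E)%E].
Proof.
move=> pq A0 mphi phi0 aP; apply: contraPP => H.
apply/negP; rewrite -leNgt.
apply: (@le_trans _ _ (\int[leb]_(x in `]p, q]) (cst A%:E) x)%E).
  by rewrite integral_cst//= leb_itv /= lte_fin pq -EFinB -EFinM.
apply: ae_ge0_le_integral => //; first exact: measurable_funTS.
apply: filterS aP => x Px; rewrite /= in_itv/= => /andP[px xq].
by rewrite leNgt; apply/negP => h; apply: H; exists x; split => //; exact: ltW.
Qed.

(** The length-area step: on average over [y], the integral of [|Dx U|] along the line is less than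
    [A], so it is at most [A] on some line on which moreover [U] is absolutely continuous. *)
Lemma good_hline U p q (B A : R) : p.2 < q.2 -> p.1 <= q.1 -> 0 <= A -> continuous U -> ACLx U ->
  (\int[lxl R]_(z in rect p q) `|Dx U z|%:E <= B%:E)%E -> B < A * (q.2 - p.2) ->
  exists y, [/\ p.2 < y, y <= q.2 & forall x x', p.1 <= x -> x <= x' -> x' <= q.1 ->
    `|U (x', y) - U (x, y)| <= A].
Proof.
move=> pq2 pq1 A0 cU aU iB BA.
have mD : measurable_fun setT (fun z => `|Dx U z|).
  by apply: measurableT_comp => //; exact: measurable_Dx.
have D0 z : 0 <= `|Dx U z| by [].
have := iB; rewrite ge0_integral_rect// => iB'.
have iA := le_lt_trans iB' (_ : (B%:E < (A * (q.2 - p.2))%:E)%E).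
have := good_point pq2 A0 (measurable_section_integral p.1 q.1 mD D0) _ aU (iA _).
case=> [x|//|y [y1 y2 ACy hy]]; first by apply: integral_ge0 => t _; rewrite lee_fin.
exists y; split=> // x x' px xx' xq.
have [n [n1 n2]] := itv_nat p.1 q.1.
have nx : - n%:R < x by lra.
have xn : x' < n%:R by lra.
have md : measurable_fun `]x, x'] (fun t => Dx U (t, y)).
  by apply: measurable_funTS; apply: measurable_fun_pair1; exact: measurable_Dx.
have d1 : {ae leb, forall t : R, - n%:R < t < n%:R -> is_derive (t : R) (1 : R) (fun t : R => U (t, y)) (Dx U (t, y))}.
  by have := ACx_derivable ACy; apply: filterS.
have [ii iE] := AC_integral (ACy n) nx xx' xn md d1.
rewrite -lee_fin (_ : (`|U (x', y) - U (x, y)|)%:E = `|(U (x', y) - U (x, y))%:E|)%E// -iE.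
apply: le_trans (le_abse_integral _ _ _) _ => //; first exact/measurable_EFinP.
apply: le_trans hy; apply: ge0_subset_integral => //.
- by apply/measurable_EFinP; apply: measurableT_comp => //; apply: measurable_funTS;
    apply: measurable_fun_pair1; exact: measurable_Dx.
- by move=> t /=; rewrite !in_itv /= => /andP[t1 t2]; apply/andP; split; lra.
Qed.

Lemma good_vline U p q (B A : R) : p.1 < q.1 -> p.2 <= q.2 -> 0 <= A -> continuous U -> ACLy U ->
  (\int[lxl R]_(z in rect p q) `|Dy U z|%:E <= B%:E)%E -> B < A * (q.1 - p.1) ->
  exists x, [/\ p.1 < x, x <= q.1 & forall y y', p.2 <= y -> y <= y' -> y' <= q.2 ->
    `|U (x, y') - U (x, y)| <= A].
Proof.
move=> pq1 pq2 A0 cU aU iB BA.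
have cU' : continuous (U \o swp) by exact: continuous_swp.
have mD : measurable_fun (rect p q) (fun z => `|Dy U z|%:E).
  by apply: measurable_funTS; apply/measurable_EFinP; apply: measurableT_comp => //; exact: measurable_Dy.
have D0 z : rect p q z -> (0 <= `|Dy U z|%:E)%E by rewrite lee_fin.
have H := ge0_integral_swp (measurable_rect _ _) mD D0.
have iB' : (\int[lxl R]_(z in rect (swp p) (swp q)) `|Dx (U \o swp) z|%:E <= B%:E)%E.
  rewrite -rect_swp; apply: le_trans iB; rewrite -H le_eqVlt; apply/orP; left; apply/eqP.
  by apply: eq_integral => z _; rewrite /Dy swpK.
exact: (@good_hline (U \o swp) (swp p) (swp q) B A pq1 pq2 A0 cU' aU iB' BA).
Qed.
End goodline.

(** * Crossing the boundary of a rectangle along rays in the image *)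

Section link.
Variable R : realType.
Implicit Types (p q z c w : R * R).

(* negative inside the rectangle with corners [p] and [q], zero on its boundary *)
Definition gauge p q z : R :=
  Num.max (Num.max (p.1 - z.1) (z.1 - q.1)) (Num.max (p.2 - z.2) (z.2 - q.2)).

Lemma gauge_le p q z (e : R) : (gauge p q z <= e) =
  [&& p.1 - z.1 <= e, z.1 - q.1 <= e, p.2 - z.2 <= e & z.2 - q.2 <= e].
Proof. by rewrite /gauge !ge_max -!andbA. Qed.

Lemma gauge_le0 p q z : (gauge p q z <= 0) =
  [&& p.1 <= z.1, z.1 <= q.1, p.2 <= z.2 & z.2 <= q.2].
Proof. by rewrite gauge_le !subr_le0. Qed.

Lemma gauge_eq0 p q z : gauge p q z = 0 ->
  [/\ p.1 <= z.1, z.1 <= q.1, p.2 <= z.2 & z.2 <= q.2] /\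
  [\/ z.1 = p.1, z.1 = q.1, z.2 = p.2 | z.2 = q.2].
Proof.
move=> h; have := gauge_le0 p q z; rewrite h lexx => /esym/and4P[h1 h2 h3 h4]; split=> //.
have : ~~ [&& p.1 < z.1, z.1 < q.1, p.2 < z.2 & z.2 < q.2].
  apply/negP => /and4P[l1 l2 l3 l4].
  have : gauge p q z < 0 by rewrite /gauge !gt_max !subr_lt0 l1 l2 l3 l4.
  by rewrite h ltxx.
rewrite !negb_and -!leNgt => /or4P[] l.
- by apply: Or41; apply/eqP; rewrite eq_le h1 l.
- by apply: Or42; apply/eqP; rewrite eq_le h2 l.
- by apply: Or43; apply/eqP; rewrite eq_le h3 l.
- by apply: Or44; apply/eqP; rewrite eq_le h4 l.
Qed.

Variables (F G : R * R -> R * R).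
Hypotheses (cF : continuous F) (cG : continuous G) (FK : cancel F G) (GK : cancel G F).

Let ray c w (t : R) := (c.1 + t * (w.1 - c.1), c.2 + t * (w.2 - c.2)).

Lemma sqd_ray c w t : sqd c (ray c w t) = t ^+ 2 * sqd c w.
Proof. by rewrite /sqd /=; ring. Qed.

Lemma ray0 c w : ray c w 0 = c.
Proof. by rewrite /ray !mul0r !addr0 -surjective_pairing. Qed.

Lemma ray1 c w : ray c w 1 = w.
Proof. by rewrite /ray !mul1r !subrKC -surjective_pairing. Qed.

Lemma continuous_gauge_ray p q c w : continuous (fun t => gauge p q (G (ray c w t))).
Proof.
have c1 : continuous (fun t => (G (ray c w t)).1).
  by apply: (@cont_path R (fun z => (G z).1)); [exact: cont_fst|exact: cont_affine|exact: cont_affine].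
have c2 : continuous (fun t => (G (ray c w t)).2).
  by apply: (@cont_path R (fun z => (G z).2)); [exact: cont_snd|exact: cont_affine|exact: cont_affine].
have cB (f : R -> R) (a : R) : continuous f -> continuous (fun t => a - f t).
  by move=> cf t; apply: cvgB; [exact: cvg_cst|exact: cf].
have cB' (f : R -> R) (a : R) : continuous f -> continuous (fun t => f t - a).
  by move=> cf t; apply: cvgB; [exact: cf|exact: cvg_cst].
by apply: cont_max; apply: cont_max; (exact: cB || exact: cB').
Qed.

Lemma gauge_ray_ivt p q c w (a b : R) : a <= b -> gauge p q (G (ray c w a)) <= 0 ->
  0 <= gauge p q (G (ray c w b)) -> exists2 t, a <= t <= b & gauge p q (G (ray c w t)) = 0.
Proof.
move=> ab ga gb.
have [|t] := @IVT R (fun t => gauge p q (G (ray c w t))) a b 0 ab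
  (continuous_subspaceT (continuous_gauge_ray (p := p) (q := q) (c := c) (w := w))).
  by rewrite ge_min le_max ga gb orbT.
by rewrite in_itv /= => h ht; exists t.
Qed.

(** Pulled back by [G], the segment from [F x0] to [F z] joins a point of the rectangle to a point
    off its interior and so meets the boundary; distances to [F x0] only decrease along it. *)
Lemma inner_point p q x0 z : gauge p q x0 <= 0 -> 0 <= gauge p q z ->
  exists2 z', gauge p q z' = 0 & sqd (F x0) (F z') <= sqd (F x0) (F z).
Proof.
move=> g0 g1; have [||t /andP[t0 t1] ht] := @gauge_ray_ivt p q (F x0) (F z) 0 1 ler01.
- by rewrite ray0 FK.
- by rewrite ray1 FK.
exists (G (ray (F x0) (F z) t)) => //; rewrite GK sqd_ray ler_piMl ?sqd_ge0//.
by rewrite expr_le1.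
Qed.

Lemma bounded_sqd p q c : exists M, forall z, gauge p q z <= 0 -> sqd c (F z) <= M.
Proof.
pose Q : set (R * R) := `[p.1, q.1]%classic `*` `[p.2, q.2]%classic.
have cQ : compact Q by apply: compact_setX; exact: segment_compact.
have cf : continuous (fun z => sqd c (F z)).
  by move=> z; apply: (@continuous_comp _ _ _ F (sqd c)); [exact: cF|exact: continuous_sqd].
have := continuous_compact (continuous_subspaceT cf) cQ.
move=> /compact_bounded[M [_ hM]]; exists (M + 1) => z; rewrite gauge_le0 => /and4P[h1 h2 h3 h4].
have /hM H : M < M + 1 by rewrite ltrDl.
apply: le_trans (ler_norm _) _; apply: H; exists z => //.
by split; rewrite /= in_itv /= ?h1 ?h2 ?h3 ?h4.
Qed.

(** The ray from [F x0] is continued beyond [F z] until it leaves the compact image of the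
    rectangle. *)
Lemma outer_point p q x0 z : gauge p q z <= 0 -> 0 < sqd (F x0) (F z) ->
  exists2 z', gauge p q z' = 0 & sqd (F x0) (F z) <= sqd (F x0) (F z').
Proof.
move=> g0 s0; have [M hM] := bounded_sqd p q (F x0).
(* Since [T >= 1], [T^2 sqd >= T sqd = sqd + |M| > M]: the end of the ray is outside the image. *)
pose T := 1 + `|M| / sqd (F x0) (F z).
have T1 : 1 <= T by rewrite lerDl divr_ge0// ltW.
have T0 : 0 <= T by apply: le_trans T1.
have [||t /andP[t1 _] ht] := @gauge_ray_ivt p q (F x0) (F z) 1 T T1.
- by rewrite ray1 FK.
- rewrite leNgt; apply/negP => h; have := hM _ (ltW h); rewrite GK sqd_ray.
  apply/negP; rewrite -ltNge; apply: (@lt_le_trans _ _ (T * sqd (F x0) (F z))).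
    rewrite /T mulrDl divfK ?gt_eqF// mul1r; apply: le_lt_trans (ler_norm M) _; lra.
  by rewrite ler_wpM2r ?(ltW s0)// expr2 ler_peMl.
exists (G (ray (F x0) (F z) t)) => //; rewrite GK sqd_ray ler_peMl ?(ltW s0)//.
by rewrite exprn_ege1.
Qed.
End link.

Section osc.
Variable R : realType.

Lemma rect_osc (U : R * R -> R) (p q : R * R) (A : R) : 0 <= A -> p.1 <= q.1 -> p.2 <= q.2 ->
  (forall x x' : R, p.1 <= x -> x <= x' -> x' <= q.1 -> `|U (x', p.2) - U (x, p.2)| <= A) ->
  (forall x x' : R, p.1 <= x -> x <= x' -> x' <= q.1 -> `|U (x', q.2) - U (x, q.2)| <= A) ->
  (forall y y' : R, p.2 <= y -> y <= y' -> y' <= q.2 -> `|U (p.1, y') - U (p.1, y)| <= A) ->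
  (forall y y' : R, p.2 <= y -> y <= y' -> y' <= q.2 -> `|U (q.1, y') - U (q.1, y)| <= A) ->
  forall z, gauge p q z = 0 -> `|U z - U p| <= 2 * A.
Proof.
move=> A0 pq1 pq2 h1 h2 h3 h4 [x y] /gauge_eq0 /= [[l1 l2 l3 l4] H].
have tri (a b : R * R) : `|U a - U b| <= A -> `|U b - U p| <= A -> `|U a - U p| <= 2 * A.
  move=> e1 e2; have := ler_distD (U b) (U a) (U p); lra.
have pE : (p.1, p.2) = p by rewrite -surjective_pairing.
case: H => ->.
- by have := h3 _ _ (lexx _) l3 l4; rewrite pE; lra.
- apply: (tri _ (q.1, p.2)); first exact: h4.
  by have := h1 _ _ (lexx _) pq1 (lexx _); rewrite pE.
- by have := h1 _ _ (lexx _) l1 l2; rewrite pE; lra.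
- apply: (tri _ (p.1, q.2)); first exact: h2.
  by have := h3 _ _ (lexx _) pq2 (lexx _); rewrite pE.
Qed.
End osc.

Section distortion.
Variable R : realType.
Implicit Types (F G : R * R -> R * R).

(* [G] is the inverse of [F] *)
Definition almost_conformal F G (k : R) :=
  [/\ [/\ continuous F, continuous G, cancel F G & cancel G F],
   0 <= k <= 1 / 1000,
   [/\ ACLx (fun z => (F z).1), ACLx (fun z => (F z).2),
       ACLy (fun z => (F z).1) & ACLy (fun z => (F z).2)] &
   {ae lxl R, forall z, conf F k z}].

Lemma almost_conformal_ok F G k : almost_conformal F G k -> {ae lxl R, forall z, all_derivable F z}.
Proof.
move=> [[cF _ _ _] _ [ux vx uy vy] _].
have o1 := ae_derivable (cont_fst cF) ux; have o2 := ae_derivable (cont_snd cF) vx.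
have o3 := ae_derivable_y (cont_fst cF) uy; have o4 := ae_derivable_y (cont_snd cF) vy.
near=> z; split; [apply: (near o1)|apply: (near o2)|apply: (near o3)|apply: (near o4)] => //.
Unshelve. all: by end_near. Qed.

Lemma almost_conformal_layers F G k c r n : almost_conformal F G k -> 0 < r ->
  exists U, layered F c r n U.
Proof.
move=> H; have aok := almost_conformal_ok H.
case: H => -[cF cG FK GK] /andP[k0 k1] [ux vx uy vy] acf r0.
exact: (layers cF cG FK GK k0 k1 aok acf ux vx uy vy).
Qed.

Lemma sqd_eq0 (c z : R * R) : sqd c z = 0 -> z = c.
Proof.
case: z c => [x y] [a b]; rewrite /sqd /= => /eqP.
by rewrite paddr_eq0 ?sqr_ge0// !sqrf_eq0 !subr_eq0 => /andP[/eqP -> /eqP ->].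
Qed.

Lemma sqd_gt0 (c z : R * R) : z <> c -> 0 < sqd c z.
Proof. by move=> h; rewrite lt_neqAle sqd_ge0 andbT eq_sym; apply/eqP => /sqd_eq0. Qed.

Lemma amgm (d t : R) : 0 < t -> `|d| <= (t * d ^+ 2 + t^-1) / 2.
Proof.
move=> t0; have h : 0 <= t^-1 * (t * `|d| - 1) ^+ 2 by rewrite mulr_ge0 ?sqr_ge0// invr_ge0 ltW.
have e : t^-1 * (t * `|d| - 1) ^+ 2 = t * d ^+ 2 + t^-1 - 2 * `|d|.
  rewrite -[d ^+ 2]real_normK ?num_real//; move: `|d| => x.
  by field; rewrite gt_eqF.
by move: h; rewrite e; lra.
Qed.

Lemma rect_box (p q : R * R) (x0 : R * R) (s : R) : x0.1 - s <= p.1 -> q.1 <= x0.1 + s ->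
  x0.2 - s <= p.2 -> q.2 <= x0.2 + s -> rect p q `<=` box x0 s.
Proof.
move=> h1 h2 h3 h4 [x y] [] /=; rewrite !in_itv /= => /andP[a1 a2] /andP[b1 b2].
by rewrite /box /= !ler_distl; split; apply/andP; split; lra.
Qed.

Lemma box_box0 (x0 : R * R) (s : R) : box x0 s `<=` box (0, 0) (`|x0.1| + `|x0.2| + s).
Proof.
move=> [x y]; rewrite /box /= !subr0 => -[h1 h2].
have := ler_distD x0.1 x 0; have := ler_distD x0.2 y 0; rewrite !subr0.
by have := normr_ge0 x0.1; have := normr_ge0 x0.2; split; lra.
Qed.

(** The arithmetic-geometric inequality replaces Cauchy-Schwarz; the weight [t] between energy and
    area is left to the caller. *)
Lemma layered_length (F : R * R -> R * R) c r n U (d : R * R -> R) (x0 : R * R) (s t : R) (D : set (R * R)) :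
  layered F c r n U -> 0 <= s -> 0 < t -> measurable D -> D `<=` box x0 s ->
  measurable_fun setT d -> (forall z, d z ^+ 2 <= grad2 U z) ->
  (\int[lxl R]_(z in D) `|d z|%:E <= ((t * (22 * disc_area R * n%:R) + t^-1 * (4 * s ^+ 2)) / 2)%:E)%E.
Proof.
move=> [[cU Ux Uy] _ _ _ Ue] s0 t0 mD Db md dg.
have mg : measurable_fun D (fun z => (grad2 U z)%:E).
  by apply: measurable_funTS; apply/measurable_EFinP; exact: measurable_grad2.
have t20 : 0 <= t / 2 by rewrite divr_ge0// ltW.
have it20 : 0 <= t^-1 / 2 by rewrite divr_ge0// invr_ge0 ltW.
apply: (@le_trans _ _ (\int[lxl R]_(z in D) ((t / 2)%:E * (grad2 U z)%:E + cst (t^-1 / 2)%:E z))%E).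
  have m1 : measurable_fun D (fun z => `|d z|%:E).
    by apply: measurable_funTS; apply/measurable_EFinP; exact: measurableT_comp.
  have m2 : measurable_fun D (fun z => (t / 2)%:E * (grad2 U z)%:E + cst (t^-1 / 2)%:E z)%E.
    by apply: emeasurable_funD => //; exact: emeasurable_funM.
  apply: ge0_le_integral => //.
  - move=> z _; rewrite -EFinM -EFinD lee_fin.
    apply: le_trans (amgm (d z) t0) _.
    have := dg z; move: (d z ^+ 2) (grad2 U z) => a b ab.
    by rewrite mulrDl lerD2r mulrAC ler_wpM2l.
rewrite ge0_integralD//; last 2 first.
- by move=> z _; rewrite -EFinM lee_fin mulr_ge0// grad2_ge0.
- exact: emeasurable_funM.
rewrite ge0_integralZl//; last by move=> z _; rewrite lee_fin grad2_ge0.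
rewrite integral_cst// mulrDl EFinD; apply: leeD.
  rewrite (_ : t * (22 * disc_area R * n%:R) / 2 = t / 2 * (22 * disc_area R * n%:R)); last by ring.
  rewrite [leRHS]EFinM; apply: lee_wpmul2l; first by rewrite lee_fin.
  apply: (Ue _ (`|x0.1| + `|x0.2| + s)) => //; first by rewrite !addr_ge0.
  exact: subset_trans Db (@box_box0 _ _).
rewrite (_ : t^-1 * (4 * s ^+ 2) / 2 = t^-1 / 2 * (4 * s ^+ 2)); last by ring.
rewrite [leRHS]EFinM; apply: lee_wpmul2l; first by rewrite lee_fin.
by rewrite -(lxl_box x0 s0); apply: le_lxl => //; exact: measurable_box.
Qed.

(** Between the squares of half-sides [h] and [2 h] there are four strips of width [h], and each
    contains a line along which [U] oscillates by at most [A]. These lines bound the rectangle. *)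
Lemma layered_good_rect F c r n U x0 (h : R) : layered F c r n U -> 0 < h ->
  let A := n%:R / 8 + 704 * disc_area R + 1 in
  exists p q : R * R, [/\ x0.1 - 2 * h <= p.1 <= x0.1 - h, x0.1 + h <= q.1 <= x0.1 + 2 * h,
    x0.2 - 2 * h <= p.2 <= x0.2 - h, x0.2 + h <= q.2 <= x0.2 + 2 * h &
    forall z, gauge p q z = 0 -> `|U z - U p| <= 2 * A].
Proof.
move=> LU h0 A; have K0 := disc_area_gt0 R; have [[cU Ux Uy] _ _ _ _] := LU.
have A0 : 0 <= A.
  by rewrite /A; have := ler0n R n; move: (n%:R : R) K0 => N K0 N0; lra.
(* This weight makes the energy term of [B] equal to [h n / 8]. Two boundary points then differ by
   at most [4 A], that is [n / 2] plus a constant. *)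
pose t := h / (88 * disc_area R); have t0 : 0 < t.
  by apply: divr_gt0 => //; apply: mulr_gt0 => //; rewrite ltr0n.
pose B := (t * (22 * disc_area R * n%:R) + t^-1 * (4 * (2 * h) ^+ 2)) / 2.
have h20 : 0 <= 2 * h by rewrite mulr_ge0// ltW.
have BE : B = h * (n%:R / 8 + 704 * disc_area R).
  by rewrite /B /t; field; rewrite !gt_eqF.
have BA : B < A * h by rewrite BE mulrC ltr_pM2r// /A ltrDl.
have gx z : Dx U z ^+ 2 <= grad2 U z by rewrite lerDl sqr_ge0.
have gy z : Dy U z ^+ 2 <= grad2 U z by rewrite lerDr sqr_ge0.
have bx (p q : R * R) : x0.1 - 2 * h <= p.1 -> q.1 <= x0.1 + 2 * h ->
    x0.2 - 2 * h <= p.2 -> q.2 <= x0.2 + 2 * h ->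
    (\int[lxl R]_(z in rect p q) `|Dx U z|%:E <= B%:E)%E.
  move=> h1 h2 h3 h4; apply: (layered_length LU h20 t0 _ _ (measurable_Dx cU) gx).
    exact: measurable_rect.
  exact: (rect_box h1 h2 h3 h4).
have by_ (p q : R * R) : x0.1 - 2 * h <= p.1 -> q.1 <= x0.1 + 2 * h ->
    x0.2 - 2 * h <= p.2 -> q.2 <= x0.2 + 2 * h ->
    (\int[lxl R]_(z in rect p q) `|Dy U z|%:E <= B%:E)%E.
  move=> h1 h2 h3 h4; apply: (layered_length LU h20 t0 _ _ (measurable_Dy cU) gy).
    exact: measurable_rect.
  exact: (rect_box h1 h2 h3 h4).
have hl (a b : R) : b - a = h -> x0.2 - 2 * h <= a -> b <= x0.2 + 2 * h ->
    exists y, [/\ a < y, y <= b & forall x x', x0.1 - 2 * h <= x -> x <= x' -> x' <= x0.1 + 2 * h ->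
    `|U (x', y) - U (x, y)| <= A].
  move=> ab a1 b1; apply: (@good_hline R U (x0.1 - 2 * h, a) (x0.1 + 2 * h, b) B A) => //=.
  - by rewrite -subr_gt0 ab.
  - by lra.
  - exact: bx.
  - by rewrite ab.
have vl (a b : R) : b - a = h -> x0.1 - 2 * h <= a -> b <= x0.1 + 2 * h ->
    exists x, [/\ a < x, x <= b & forall y y', x0.2 - 2 * h <= y -> y <= y' -> y' <= x0.2 + 2 * h ->
    `|U (x, y') - U (x, y)| <= A].
  move=> ab a1 b1; apply: (@good_vline R U (a, x0.2 - 2 * h) (b, x0.2 + 2 * h) B A) => //=.
  - by rewrite -subr_gt0 ab.
  - by lra.
  - exact: by_.
  - by rewrite ab.
have [|||y1 [a1 b1 l1]] := hl (x0.2 - 2 * h) (x0.2 - h); [lra|lra|lra|].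
have [|||y2 [a2 b2 l2]] := hl (x0.2 + h) (x0.2 + 2 * h); [lra|lra|lra|].
have [|||x1 [a3 b3 l3]] := vl (x0.1 - 2 * h) (x0.1 - h); [lra|lra|lra|].
have [|||x2 [a4 b4 l4]] := vl (x0.1 + h) (x0.1 + 2 * h); [lra|lra|lra|].
exists (x1, y1), (x2, y2); rewrite /= (ltW a1) (ltW a2) (ltW a3) (ltW a4) b1 b2 b3 b4; split=> //.
apply: rect_osc => //=; [lra|lra| | | | ] => x x' e1 e2 e3.
- by apply: l1 => //; [exact: le_trans (ltW a3) e1|exact: le_trans e3 b4].
- by apply: l2 => //; [exact: le_trans (ltW a3) e1|exact: le_trans e3 b4].
- by apply: l3 => //; [exact: le_trans (ltW a1) e1|exact: le_trans e3 b2].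
- by apply: l4 => //; [exact: le_trans (ltW a1) e1|exact: le_trans e3 b2].
Qed.

Lemma gauge_num (h x1 x2 b1 b2 c1 c2 d1 d2 e1 e2 : R) : 0 < h ->
  x1 - 2 * h <= d1 -> d1 <= x1 - h -> x1 + h <= e1 -> e1 <= x1 + 2 * h ->
  x2 - 2 * h <= d2 -> d2 <= x2 - h -> x2 + h <= e2 -> e2 <= x2 + 2 * h ->
  x1 - h <= c1 -> c1 <= x1 + h -> x2 - h <= c2 -> c2 <= x2 + h ->
  `|b1 - x1| = 2 * h \/ `|b2 - x2| = 2 * h ->
  [/\ [&& d1 <= x1, x1 <= e1, d2 <= x2 & x2 <= e2], [&& d1 <= c1, c1 <= e1, d2 <= c2 & c2 <= e2] &
      [|| b1 <= d1, e1 <= b1, b2 <= d2 | e2 <= b2]].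
Proof.
move=> h0 k1 k2 k3 k4 k5 k6 k7 k8 l1 l2 l3 l4 hp; split; [apply/and4P; split; lra..|].
case: hp.
  have [e|e] := lerP 0 (b1 - x1) => E; apply/or4P; [apply: Or42|apply: Or41].
    by rewrite ger0_norm// in E; lra.
  by rewrite ltr0_norm// in E; lra.
have [e|e] := lerP 0 (b2 - x2) => E; apply/or4P; [apply: Or44|apply: Or43].
  by rewrite ger0_norm// in E; lra.
by rewrite ltr0_norm// in E; lra.
Qed.

(* The layer function of [N] layers would vary by [N] on the boundary of the
   good rectangle, which its energy forbids for large [N]. *)
Lemma distortion : exists N : nat, forall F G k x0 (h : R) p q,
  almost_conformal F G k -> 0 < h -> box x0 h q ->
  `|p.1 - x0.1| = 2 * h \/ `|p.2 - x0.2| = 2 * h ->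
  sqd (F x0) (F q) <= ((9 / 8) ^+ N) ^+ 2 * sqd (F x0) (F p).
Proof.
(* The bound is chosen to give [4 A < N] for [N] layers: [4 A = N / 2 + 2816 disc_area + 4]. *)
have K0 := disc_area_gt0 R; have [N HN] := bound_nat (5632 * disc_area R + 8).
have {}HN := le_lt_trans (ler_norm _) HN.
exists N => F G k x0 h p q H h0 [q1 q2] hp; rewrite leNgt; apply/negP => hlt.
have [[cF cG FK GK] _ _ _] := H.
have px0 : F p <> F x0.
  move=> /(can_inj FK) px; move: hp; rewrite px !subrr normr0; case; lra.
have sp := sqd_gt0 px0; pose r := Num.sqrt (sqd (F x0) (F p)).
have r0 : 0 < r by rewrite sqrtr_gt0.
have r2 : r ^+ 2 = sqd (F x0) (F p) by rewrite sqr_sqrtr// ltW.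
have [U LU] := almost_conformal_layers (F x0) N H r0.
have [p' [q' [/andP[p1 p2] /andP[p3 p4] /andP[p5 p6] /andP[p7 p8] osc]]] := layered_good_rect x0 LU h0.
move: q1 q2; rewrite !ler_distl => /andP[q1 q2] /andP[q3 q4].
have [g0 gq gp] : [/\ gauge p' q' x0 <= 0, gauge p' q' q <= 0 & 0 <= gauge p' q' p].
  rewrite !gauge_le0 /gauge !le_max -!orbA !subr_ge0.
  move: h0 p1 p2 p3 p4 p5 p6 p7 p8 q1 q2 q3 q4 hp.
  move: {+}x0.1 {+}x0.2 {+}p.1 {+}p.2 {+}q.1 {+}q.2 {+}p'.1 {+}p'.2 {+}q'.1 {+}q'.2 => x1 x2 b1 b2 c1 c2 d1 d2 e1 e2.
  exact: gauge_num.
have sq : 0 < sqd (F x0) (F q).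
  by apply: le_lt_trans hlt; rewrite mulr_ge0 ?sqr_ge0// sqd_ge0.
have [z gz hz] := inner_point cG FK GK g0 gp.
have [z' gz' hz'] := outer_point cF cG FK GK gq sq.
have [_ U0 UN _ _] := LU.
have e0 : U z = 0 by apply: U0; rewrite r2.
have e1 : U z' = N%:R by apply: UN; rewrite exprMn r2; apply: le_trans hz'; exact: ltW.
have := osc _ gz; have := osc _ gz'; rewrite e0 e1.
have := ler_distD (U p') (N%:R) 0; rewrite subr0 ger0_norm// [`|U p' - 0|]distrC.
move: (U p') HN K0 => X; lra.
Qed.
End distortion.

(** * Radial test fields *)

Section radial1.
Variable R : realType.
Implicit Types (a b m r x y t : R).

Lemma max_lip (q x y : R) : `|Num.max q y - Num.max q x| <= `|y - x|.
Proof.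
have := ler_norm (y - x); have := ler_norm (x - y); rewrite [`|x - y|]distrC => h1 h2.
have h3 := normr_ge0 (y - x).
by rewrite ler_norml; case: (leP q y) => h4; case: (leP q x) => h5; apply/andP; split; lra.
Qed.

Lemma normM_le (x y : R) : `|x| * `|y| <= (x ^+ 2 + y ^+ 2) / 2.
Proof.
have : 0 <= (`|x| - `|y|) ^+ 2 by exact: sqr_ge0.
by rewrite sqrrB !real_normK ?num_real// -mulr_natr; lra.
Qed.

(* [x] is either [a] or [b], and [m], [m'] are the denominators at [a], [a'] *)
Lemma quot_lip_num (a a' b x m m' i : R) : 0 < m -> 0 < m' -> m^-1 <= i -> m'^-1 <= i ->
  a ^+ 2 + b ^+ 2 <= m -> a' ^+ 2 + b ^+ 2 <= m' -> x ^+ 2 <= a ^+ 2 + b ^+ 2 ->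
  `|x| * (`|a| + `|a'|) <= m + (m + m') / 2 ->
  `|m' - m| <= `|a' ^+ 2 - a ^+ 2| -> `|x / m' - x / m| <= 2 * i * `|a' - a|.
Proof.
move=> m0 m'0 mi m'i hm hm' hx hxa hmm.
have -> : x / m' - x / m = x * (m - m') / (m * m') by field; rewrite !gt_eqF.
have mm0 : 0 < m * m' by rewrite mulr_gt0.
rewrite normrM normfV [`|m * m'|]gtr0_norm// ler_pdivrMr// normrM distrC.
have e : `|a' ^+ 2 - a ^+ 2| <= (`|a| + `|a'|) * `|a' - a|.
  rewrite subr_sqr normrM mulrC ler_wpM2r// addrC; exact: ler_normD.
have x0 := normr_ge0 x.
have e2 : `|x| * `|m' - m| <= `|x| * (`|a| + `|a'|) * `|a' - a|.
  by rewrite -mulrA ler_wpM2l// (le_trans hmm).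
have e3 : m + (m + m') / 2 <= 2 * i * (m * m').
  have k1 : m' <= i * (m * m').
    by rewrite mulrA ler_peMl ?(ltW m'0)// -ler_pdivrMr// mul1r.
  have k2 : m <= i * (m * m').
    by rewrite [m * _]mulrC mulrA ler_peMl ?(ltW m0)// -ler_pdivrMr// mul1r.
  lra.
apply: le_trans e2 _; rewrite [leRHS]mulrAC ler_wpM2r//; exact: le_trans hxa e3.
Qed.

(* With [z = a + i b], [(a, b) / rden r b a] is the field [z / |z|^2] made linear
   on the disc of radius [r]; its divergence is [2 / r^2] there and 0 outside. *)
Definition rden r b a : R := Num.max (r ^+ 2) (a ^+ 2 + b ^+ 2).

Lemma rden_gt0 r b a : 0 < r -> 0 < rden r b a.
Proof. by move=> r0; rewrite lt_max exprn_gt0. Qed.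

Lemma rden_inv r b a : 0 < r -> (rden r b a)^-1 <= (r ^+ 2)^-1.
Proof. by move=> r0; rewrite lef_pV2 ?posrE ?rden_gt0 ?exprn_gt0// le_max lexx. Qed.

Lemma rden_ge r b a : a ^+ 2 + b ^+ 2 <= rden r b a.
Proof. by rewrite le_max lexx orbT. Qed.

Lemma radial_lip1 r b a a' : 0 < r ->
  `|a' / rden r b a' - a / rden r b a| <= 3 * (r ^+ 2)^-1 * `|a' - a|.
Proof.
move=> r0; set m := rden r b a; set m' := rden r b a'.
have [m0 m'0] : 0 < m /\ 0 < m' by split; exact: rden_gt0.
have [mi m'i] : m^-1 <= (r ^+ 2)^-1 /\ m'^-1 <= (r ^+ 2)^-1 by split; exact: rden_inv.
have [hm hm'] : a ^+ 2 + b ^+ 2 <= m /\ a' ^+ 2 + b ^+ 2 <= m' by split; exact: rden_ge.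
have hmm : `|m' - m| <= `|a' ^+ 2 - a ^+ 2|.
  apply: le_trans (max_lip _ _ _) _; rewrite le_eqVlt; apply/orP; left; apply/eqP; congr (`|_|); ring.
have h : `|a / m' - a / m| <= 2 * (r ^+ 2)^-1 * `|a' - a|.
  apply: (quot_lip_num m0 m'0 mi m'i hm hm' _ _ hmm); first by rewrite lerDl sqr_ge0.
  have := normM_le a a; have := normM_le a a'; have := sqr_ge0 b; rewrite mulrDr; lra.
have -> : a' / m' - a / m = (a' - a) / m' + (a / m' - a / m) by rewrite mulrBl; ring.
apply: le_trans (ler_normD _ _) _.
have : `|(a' - a) / m'| <= (r ^+ 2)^-1 * `|a' - a|.
  by rewrite normrM normfV (gtr0_norm m'0) mulrC ler_wpM2r.
by move: h; move: (r ^+ 2)^-1 => i; lra.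
Qed.

Lemma radial_lip2 r b a a' : 0 < r ->
  `|b / rden r b a' - b / rden r b a| <= 3 * (r ^+ 2)^-1 * `|a' - a|.
Proof.
move=> r0; set m := rden r b a; set m' := rden r b a'.
have [m0 m'0] : 0 < m /\ 0 < m' by split; exact: rden_gt0.
have [mi m'i] : m^-1 <= (r ^+ 2)^-1 /\ m'^-1 <= (r ^+ 2)^-1 by split; exact: rden_inv.
have [hm hm'] : a ^+ 2 + b ^+ 2 <= m /\ a' ^+ 2 + b ^+ 2 <= m' by split; exact: rden_ge.
have hmm : `|m' - m| <= `|a' ^+ 2 - a ^+ 2|.
  apply: le_trans (max_lip _ _ _) _; rewrite le_eqVlt; apply/orP; left; apply/eqP; congr (`|_|); ring.
have h : `|b / m' - b / m| <= 2 * (r ^+ 2)^-1 * `|a' - a|.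
  apply: (quot_lip_num m0 m'0 mi m'i hm hm' _ _ hmm); first by rewrite lerDr sqr_ge0.
  have := normM_le b a; have := normM_le b a'; have := sqr_ge0 b; have := sqr_ge0 a; rewrite mulrDr; lra.
apply: le_trans h _; rewrite ler_wpM2r// ler_wpM2r//; last by lra.
by rewrite invr_ge0 sqr_ge0.
Qed.

(** The derivatives in [a] of [a / rden r b a] and [b / rden r b a] off the circle of radius [r].
    Their values on the circle are a convention: a line meets it in at most two points
    ([ae_off_circle]). *)
Definition dradial1 r b a : R := if a ^+ 2 + b ^+ 2 < r ^+ 2 then (r ^+ 2)^-1
  else (b ^+ 2 - a ^+ 2) / (rden r b a) ^+ 2.
Definition dradial2 r b a : R := if a ^+ 2 + b ^+ 2 < r ^+ 2 then 0
  else - (2 * a * b) / (rden r b a) ^+ 2.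

Lemma radial_bound r b a x : 0 < r -> x ^+ 2 <= a ^+ 2 + b ^+ 2 -> `|x / rden r b a| <= r^-1.
Proof.
move=> r0 hx; have m0 := rden_gt0 b a r0.
rewrite normrM normfV (gtr0_norm m0) ler_pdivrMr// mulrC ler_pdivlMr//.
apply: le_trans (ler_norm _) _.
apply: sqr_le_abs; first exact: ltW.
rewrite exprMn real_normK ?num_real// expr2; apply: ler_pM; rewrite ?sqr_ge0//.
  exact: le_trans (rden_ge _ _ _).
by rewrite /rden le_max lexx.
Qed.

Lemma dradial_num r b a n : 0 < r -> `|n| <= a ^+ 2 + b ^+ 2 -> `|n / rden r b a ^+ 2| <= (r ^+ 2)^-1.
Proof.
move=> r0 hn; have m0 := rden_gt0 b a r0.
rewrite normrM normfV (gtr0_norm (exprn_gt0 _ m0)) ler_pdivrMr ?exprn_gt0//.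
have h := rden_inv b a r0; apply: le_trans hn _; apply: le_trans (rden_ge r b a) _.
rewrite expr2 mulrA ler_peMl ?(ltW m0)//.
by rewrite -ler_pdivrMr// mul1r.
Qed.

Lemma dradial1_bound r b a : 0 < r -> `|dradial1 r b a| <= (r ^+ 2)^-1.
Proof.
move=> r0; rewrite /dradial1; case: ifPn => _; first by rewrite ger0_norm// invr_ge0 sqr_ge0.
apply: dradial_num => //; have := sqr_ge0 a; have := sqr_ge0 b => ? ?.
by rewrite ler_norml; apply/andP; split; lra.
Qed.

Lemma dradial2_bound r b a : 0 < r -> `|dradial2 r b a| <= (r ^+ 2)^-1.
Proof.
move=> r0; rewrite /dradial2; case: ifPn => _; first by rewrite normr0 invr_ge0 sqr_ge0.
apply: dradial_num => //; have := normM_le a b.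
by rewrite normrN -mulrA normrM normrM (ger0_norm (ler0n _ _)); lra.
Qed.

Lemma is_derive_sq (c b x : R) : is_derive (x : R) (1 : R) (fun t : R => (t - c) ^+ 2 + b ^+ 2) (2 * (x - c)).
Proof.
have h : is_derive (x : R) (1 : R) (fun t : R => t - c) 1.
  by have h := is_deriveB (is_derive_id x (1 : R)) (is_derive_cst c x (1 : R)); rewrite subr0 in h.
apply: is_derive_eq; rewrite /GRing.scale /=; ring.
Qed.

Lemma radial_near r b c x : (x - c) ^+ 2 + b ^+ 2 != r ^+ 2 ->
  (\forall t \near x, rden r b (t - c) = if (x - c) ^+ 2 + b ^+ 2 < r ^+ 2 then r ^+ 2 else (t - c) ^+ 2 + b ^+ 2).
Proof.
move=> ne; pose s t := (t - c) ^+ 2 + b ^+ 2.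
have cs : {for x, continuous s}.
  by apply: differentiable_continuous; apply/derivable1_diffP; exact: (@ex_derive _ _ _ _ _ _ _ (is_derive_sq c b x)).
case: (boolP ((x - c) ^+ 2 + b ^+ 2 < r ^+ 2)) => h; near=> t; rewrite /rden.
  by rewrite max_l// ltW//; near: t; exact: (cvgr_lt (s x) cs).
rewrite max_r// ltW//; near: t; apply: (cvgr_gt (s x) cs).
by rewrite lt_neqAle eq_sym ne leNgt.
Unshelve. all: by end_near. Qed.

Lemma radial_derive1 r b c x : 0 < r -> (x - c) ^+ 2 + b ^+ 2 != r ^+ 2 ->
  is_derive (x : R) (1 : R) (fun t : R => (t - c) / rden r b (t - c)) (dradial1 r b (x - c)).
Proof.
move=> r0 ne; have nr := radial_near ne.
have h : is_derive (x : R) (1 : R) (fun t : R => t - c) 1.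
  by have h := is_deriveB (is_derive_id x (1 : R)) (is_derive_cst c x (1 : R)); rewrite subr0 in h.
rewrite /dradial1; case: (boolP ((x - c) ^+ 2 + b ^+ 2 < r ^+ 2)) nr => hr nr.
  have hd : is_derive (x : R) (1 : R) (fun t : R => (t - c) * (r ^+ 2)^-1) ((r ^+ 2)^-1).
    have := is_deriveM h (is_derive_cst ((r ^+ 2)^-1) x (1 : R)).
    by rewrite /GRing.scale /= mulr0 add0r mulr1.
  by apply: near_eq_is_derive hd; apply: filterS nr => t ->.
set s := (x - c) ^+ 2 + b ^+ 2 in ne hr.
have s0 : s != 0 by rewrite gt_eqF// (lt_le_trans (exprn_gt0 2 r0))// leNgt.
have hs := @is_deriveV R (fun t : R => (t - c) ^+ 2 + b ^+ 2) x _ 1 s0 (is_derive_sq c b x).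
have hd := is_deriveM h hs.
have hd' : is_derive (x : R) (1 : R) (fun t : R => (t - c) / ((t - c) ^+ 2 + b ^+ 2)) ((b ^+ 2 - (x - c) ^+ 2) / (rden r b (x - c)) ^+ 2).
  apply: is_derive_eq hd _; rewrite /GRing.scale /= /rden max_r -/s ?leNgt//.
  have -> : b ^+ 2 - (x - c) ^+ 2 = s - 2 * (x - c) ^+ 2 by rewrite /s; ring.
  by field.
by apply: near_eq_is_derive hd'; apply: filterS nr => t ->.
Qed.

Lemma radial_derive2 r b c x : 0 < r -> (x - c) ^+ 2 + b ^+ 2 != r ^+ 2 ->
  is_derive (x : R) (1 : R) (fun t : R => b / rden r b (t - c)) (dradial2 r b (x - c)).
Proof.
move=> r0 ne; have nr := radial_near ne.
rewrite /dradial2; case: (boolP ((x - c) ^+ 2 + b ^+ 2 < r ^+ 2)) nr => hr nr.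
  have hd : is_derive (x : R) (1 : R) (fun t : R => b * (r ^+ 2)^-1) 0 by exact: is_derive_cst.
  by apply: near_eq_is_derive hd; apply: filterS nr => t ->.
set s := (x - c) ^+ 2 + b ^+ 2 in ne hr.
have s0 : s != 0 by rewrite gt_eqF// (lt_le_trans (exprn_gt0 2 r0))// leNgt.
have hs := @is_deriveV R (fun t : R => (t - c) ^+ 2 + b ^+ 2) x _ 1 s0 (is_derive_sq c b x).
have hd := is_deriveM (is_derive_cst b x (1 : R)) hs.
have hd' : is_derive (x : R) (1 : R) (fun t : R => b / ((t - c) ^+ 2 + b ^+ 2)) (- (2 * (x - c) * b) / (rden r b (x - c)) ^+ 2).
  apply: is_derive_eq hd _; rewrite /GRing.scale /= /rden max_r -/s ?leNgt//.
  by field.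
by apply: near_eq_is_derive hd'; apply: filterS nr => t ->.
Qed.

Lemma ae_off_circle (r b c : R) : {ae @leb R, forall x, (x - c) ^+ 2 + b ^+ 2 != r ^+ 2}.
Proof.
apply: ae_lebesgue; pose s := Num.sqrt (r ^+ 2 - b ^+ 2).
exists [set c + s; c - s]; split.
- by apply: measurableU; exact: measurable_set1.
- apply: countable_lebesgue_measure0; apply: finite_set_countable.
  by rewrite finite_setU; split; exact: finite_set1.
- move=> x /= /negP; rewrite negbK => /eqP e.
  have e2 : (x - c) ^+ 2 = s ^+ 2 by rewrite sqr_sqrtr; [lra|have := sqr_ge0 (x - c); lra].
  by move/eqP: e2; rewrite eqf_sqr => /orP[/eqP h|/eqP h]; [left|right]; lra.
Qed.
End radial1.

Section testfield.
Variable R : realType.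
Notation leb := (@leb R).
Notation swp := (@swp R).
Implicit Types (w g gx gy : R * R -> R) (z p q : R * R).

(* test functions for integration by parts in [x], with derivative [gx] *)
Definition xlip g gx := exists B : R,
  [/\ 0 <= B, measurable_fun setT g /\ measurable_fun setT gx,
   (forall z, `|g z| <= B) /\ (forall z, `|gx z| <= B),
   (forall x x' y, x <= x' -> `|g (x', y) - g (x, y)| <= B * (x' - x)) &
   {ae leb, forall y, {ae leb, forall x : R, is_derive (x : R) (1 : R) (fun t : R => g (t, y)) (gx (x, y))}}].

Definition ylip g gy := xlip (g \o swp) (gy \o swp).

Lemma xlip_add g gx h hx : xlip g gx -> xlip h hx ->
  xlip (fun z => g z + h z) (fun z => gx z + hx z).
Proof.
move=> [B [B0 [mg mgx] [bg bgx] lg dg]] [C [C0 [mh mhx] [bh bhx] lh dh]].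
exists (B + C); split.
- exact: addr_ge0.
- by split; exact: measurable_funD.
- by split=> z; apply: le_trans (ler_normD _ _) _; exact: lerD.
- move=> x x' y xx; rewrite opprD addrACA mulrDl; apply: le_trans (ler_normD _ _) _.
  by apply: lerD; [exact: lg|exact: lh].
- apply: filterS2 dg dh => y dg dh; apply: filterS2 dg dh => x h1 h2; exact: (is_deriveD h1 h2).
Qed.

Lemma xlip_scale (a : R) g gx : xlip g gx -> xlip (fun z => a * g z) (fun z => a * gx z).
Proof.
move=> [B [B0 [mg mgx] [bg bgx] lg dg]]; exists (`|a| * B); split.
- exact: mulr_ge0.
- by split; exact: measurable_funM.
- by split=> z; rewrite normrM ler_wpM2l.
- by move=> x x' y xx; rewrite -mulrBr normrM -mulrA ler_wpM2l//; exact: lg.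
- apply: filterS dg => y dg; apply: filterS dg => x h1; exact: (is_deriveZ a h1).
Qed.

Lemma ylip_add g gy h hy : ylip g gy -> ylip h hy ->
  ylip (fun z => g z + h z) (fun z => gy z + hy z).
Proof. by move=> h1 h2; exact: (xlip_add h1 h2). Qed.

Lemma ylip_scale (a : R) g gy : ylip g gy -> ylip (fun z => a * g z) (fun z => a * gy z).
Proof. by move=> h1; exact: (xlip_scale a h1). Qed.

Definition W1 (x0 : R * R) (r : R) z := (z.1 - x0.1) / rden r (z.2 - x0.2) (z.1 - x0.1).
Definition W2 (x0 : R * R) (r : R) z := (z.2 - x0.2) / rden r (z.2 - x0.2) (z.1 - x0.1).
Definition dW1 (x0 : R * R) (r : R) z := dradial1 r (z.2 - x0.2) (z.1 - x0.1).
Definition dW2 (x0 : R * R) (r : R) z := dradial2 r (z.2 - x0.2) (z.1 - x0.1).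

Lemma continuous_fstB (a : R) : continuous (fun z : R * R => z.1 - a).
Proof. by move=> z; apply: cvgB; [exact: cvg_fst|exact: cvg_cst]. Qed.

Lemma continuous_sndB (a : R) : continuous (fun z : R * R => z.2 - a).
Proof. by move=> z; apply: cvgB; [exact: cvg_snd|exact: cvg_cst]. Qed.

Lemma continuous_rden (x0 : R * R) r : continuous (fun z : R * R => rden r (z.2 - x0.2) (z.1 - x0.1)).
Proof.
move=> z; apply: (@continuous_max R _ (fun=> r ^+ 2) (sqd x0)); first exact: cvg_cst.
exact: continuous_sqd.
Qed.

Lemma continuous_rdenV (x0 : R * R) r (n : nat) : 0 < r ->
  continuous (fun z : R * R => (rden r (z.2 - x0.2) (z.1 - x0.1) ^+ n)^-1).
Proof.
move=> r0 z; apply: cvgV; first by rewrite expf_neq0// gt_eqF// rden_gt0.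
apply: (@continuous_comp _ _ _ (fun z : R * R => rden r (z.2 - x0.2) (z.1 - x0.1)) (fun x : R => x ^+ n)).
  exact: continuous_rden.
exact: exprn_continuous.
Qed.

Lemma measurable_sqd_ltb (x0 : R * R) (r : R) : measurable_fun setT (fun z : R * R => (z.1 - x0.1) ^+ 2 + (z.2 - x0.2) ^+ 2 < r ^+ 2).
Proof.
apply: measurable_fun_ltr; last exact: measurable_cst.
by apply: continuous_measurable2; exact: (@continuous_sqd R x0).
Qed.

Lemma xlip_W1 (x0 : R * R) r : 0 < r -> xlip (W1 x0 r) (dW1 x0 r).
Proof.
move=> r0; exists (r^-1 + 3 * (r ^+ 2)^-1).
have i0 : 0 <= r^-1 by rewrite invr_ge0 ltW.
have i20 : 0 <= (r ^+ 2)^-1 by rewrite invr_ge0 sqr_ge0.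
have mi n : measurable_fun setT (fun z : R * R => (rden r (z.2 - x0.2) (z.1 - x0.1) ^+ n)^-1).
  by apply: continuous_measurable2; exact: continuous_rdenV.
have m1 : measurable_fun setT (fun z : R * R => z.1 - x0.1) by apply: continuous_measurable2; exact: continuous_fstB.
have m2 : measurable_fun setT (fun z : R * R => z.2 - x0.2) by apply: continuous_measurable2; exact: continuous_sndB.
split.
- by rewrite addr_ge0// mulr_ge0.
- split; first exact: (measurable_funM m1 (mi 1%N)).
  apply: measurable_fun_ifT; [exact: measurable_sqd_ltb|exact: measurable_cst|].
  apply: measurable_funM; last exact: mi.
  by apply: measurable_funB; apply: measurable_funX.
- split=> z.
    apply: (@le_trans _ _ r^-1); last by rewrite lerDl mulr_ge0.
    by apply: radial_bound => //; rewrite lerDl sqr_ge0.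
  apply: le_trans (dradial1_bound _ _ r0) _; lra.
- move=> x x' y xx; apply: le_trans (radial_lip1 _ _ _ r0) _.
  rewrite /= (_ : x' - x0.1 - (x - x0.1) = x' - x); last by ring.
  by rewrite ger0_norm ?subr_ge0// ler_wpM2r ?subr_ge0// lerDr.
- apply: aeW => y; apply: filterS (ae_off_circle r (y - x0.2) x0.1) => x ne.
  exact: (radial_derive1 r0 ne).
Qed.

Lemma xlip_W2 (x0 : R * R) r : 0 < r -> xlip (W2 x0 r) (dW2 x0 r).
Proof.
move=> r0; exists (r^-1 + 3 * (r ^+ 2)^-1).
have i0 : 0 <= r^-1 by rewrite invr_ge0 ltW.
have i20 : 0 <= (r ^+ 2)^-1 by rewrite invr_ge0 sqr_ge0.
have mi n : measurable_fun setT (fun z : R * R => (rden r (z.2 - x0.2) (z.1 - x0.1) ^+ n)^-1).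
  by apply: continuous_measurable2; exact: continuous_rdenV.
have m1 : measurable_fun setT (fun z : R * R => z.1 - x0.1) by apply: continuous_measurable2; exact: continuous_fstB.
have m2 : measurable_fun setT (fun z : R * R => z.2 - x0.2) by apply: continuous_measurable2; exact: continuous_sndB.
split.
- by rewrite addr_ge0// mulr_ge0.
- split; first exact: (measurable_funM m2 (mi 1%N)).
  apply: measurable_fun_ifT; [exact: measurable_sqd_ltb|exact: measurable_cst|].
  apply: measurable_funM; last exact: mi.
  have m3 := measurable_funM (measurable_funM (measurable_cst (2 : R)) m1) m2.
  exact: (measurableT_comp (@oppr_measurable R setT) m3).
- split=> z.
    apply: (@le_trans _ _ r^-1); last by rewrite lerDl mulr_ge0.
    by apply: radial_bound => //; rewrite lerDr sqr_ge0.
  apply: le_trans (dradial2_bound _ _ r0) _; lra.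
- move=> x x' y xx; apply: le_trans (radial_lip2 _ _ _ r0) _.
  rewrite /= (_ : x' - x0.1 - (x - x0.1) = x' - x); last by ring.
  by rewrite ger0_norm ?subr_ge0// ler_wpM2r ?subr_ge0// lerDr.
- apply: aeW => y; apply: filterS (ae_off_circle r (y - x0.2) x0.1) => x ne.
  exact: (radial_derive2 r0 ne).
Qed.

Lemma rdenC (r a b : R) : rden r a b = rden r b a.
Proof. by rewrite /rden addrC. Qed.

Lemma ylip_W2 (x0 : R * R) r : 0 < r -> ylip (W2 x0 r) (dW1 (swp x0) r \o swp).
Proof.
move=> r0; have := xlip_W1 (swp x0) r0; rewrite /ylip.
rewrite (_ : W1 (swp x0) r = W2 x0 r \o swp).
  by rewrite (_ : (_ \o swp) \o swp = dW1 (swp x0) r)//; apply/funext => -[x y].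
by apply/funext => -[x y]; rewrite /W1 /W2 /= rdenC.
Qed.

Lemma ylip_W1 (x0 : R * R) r : 0 < r -> ylip (W1 x0 r) (dW2 x0 r).
Proof.
move=> r0; have := xlip_W2 (swp x0) r0; rewrite /ylip.
rewrite (_ : W2 (swp x0) r = W1 x0 r \o swp); last first.
  by apply/funext => -[x y]; rewrite /W1 /W2 /= rdenC.
rewrite (_ : dW2 (swp x0) r = dW2 x0 r \o swp)//.
apply/funext => -[x y]; rewrite /dW2 /dradial2 /= rdenC addrC; congr (if _ then _ else _ / _); ring.
Qed.

Lemma div_W (x0 : R * R) r z : dW1 x0 r z + (dW1 (swp x0) r \o swp) z = if sqd x0 z < r ^+ 2 then 2 * (r ^+ 2)^-1 else 0.
Proof.
rewrite /dW1 /dradial1 /sqd /= [(z.2 - x0.2) ^+ 2 + (z.1 - x0.1) ^+ 2]addrC.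
case: ifPn => _; first by rewrite mulr_natl mulr2n.
by rewrite [rden r (z.1 - _) _]rdenC -mulrDl; rewrite (_ : _ + _ = 0) ?mul0r//; ring.
Qed.

Lemma normW_le (x0 : R * R) r z : 0 < r -> W1 x0 r z ^+ 2 + W2 x0 r z ^+ 2 <= (rden r (z.2 - x0.2) (z.1 - x0.1))^-1.
Proof.
move=> r0; rewrite /W1 /W2; have := rden_ge r (z.2 - x0.2) (z.1 - x0.1).
have := rden_gt0 (z.2 - x0.2) (z.1 - x0.1) r0; set d := rden _ _ _ => d0 h.
rewrite !expr_div_n -mulrDl ler_pdivrMr ?exprn_gt0//.
by rewrite expr2 mulrA mulVf ?gt_eqF// mul1r.
Qed.
End testfield.

Section bp.
Variable R : realType.
Notation leb := (@leb R).
Notation swp := (@swp R).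
Implicit Types (w g gx gy : R * R -> R) (z p q : R * R).

Lemma bounded_rect w p q : continuous w -> exists2 M, 0 <= M & forall z, rect p q z -> `|w z| <= M.
Proof.
move=> cw; pose Q : set (R * R) := `[p.1, q.1]%classic `*` `[p.2, q.2]%classic.
have cQ : compact Q by apply: compact_setX; exact: segment_compact.
have := continuous_compact (continuous_subspaceT cw) cQ.
move=> /compact_bounded[M [_ hM]]; exists (`|M| + 1); first by rewrite addr_ge0.
move=> z [z1 z2]; have /hM H : M < `|M| + 1 by apply: le_lt_trans (ler_norm M) _; rewrite ltrDl.
by apply: H; exists z => //; split; exact: subset_itv_oc_cc.
Qed.

Lemma finite_rect p q : (lxl R (rect p q) < +oo)%E.
Proof.
have [n hn] := bound_nat (`|p.1| + `|q.1| + `|p.2| + `|q.2|).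
apply: (@le_lt_trans _ _ (lxl R (box (0, 0) n%:R))); last by rewrite lxl_box// ltry.
apply: le_lxl; [exact: measurable_rect|exact: measurable_box|].
move=> [x y] [] /=; rewrite !in_itv /= => /andP[a1 a2] /andP[b1 b2].
have := le_lt_trans (ler_norm _) hn => {}hn.
have := ler_norm (- p.1); have := ler_norm (- p.2); rewrite !normrN.
have := ler_norm q.1; have := ler_norm q.2.
have := normr_ge0 p.1; have := normr_ge0 q.1; have := normr_ge0 p.2; have := normr_ge0 q.2.
by rewrite /box /= !subr0 !ler_norml => *; split; apply/andP; split; lra.
Qed.

Lemma integrable_dominated (D : set (R * R)) (f1 g w h : R * R -> R) (B M : R) :
  measurable D -> (lxl R D < +oo)%E -> 0 <= B ->
  measurable_fun setT f1 -> measurable_fun setT g -> measurable_fun setT w -> measurable_fun setT h ->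
  (\int[lxl R]_(z in D) `|f1 z|%:E < +oo)%E ->
  (forall z, `|g z| <= B) -> (forall z, `|h z| <= B) -> 0 <= M -> (forall z, D z -> `|w z| <= M) ->
  (lxl R).-integrable D (fun z => (f1 z * g z + w z * h z)%:E).
Proof.
move=> mD fD B0 mf mg mw mh i1 bg bh M0 bw.
have i2 : (lxl R).-integrable D (fun z => (`|f1 z|)%:E).
  apply/integrableP; split.
    by apply: measurable_funTS; apply/measurable_EFinP; exact: measurableT_comp.
  by apply: le_lt_trans i1; apply: ge0_le_integral => //=;
    try (by apply: measurable_funTS; apply/measurable_EFinP; do 2 (apply: measurableT_comp => //)) ;
    move=> z _; rewrite lee_fin normr_id.
have i3 : (lxl R).-integrable D (fun z => B%:E * (`|f1 z|)%:E)%E by exact: integrableZl.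
have i4 : (lxl R).-integrable D (cst (M * B)%:E) 
  by apply/integrableP; split => //=; rewrite integral_cst// lte_mul_pinfty.
apply: le_integrable (integrableD mD i3 i4) => //.
  by apply: measurable_funTS; apply/measurable_EFinP; apply: measurable_funD; exact: measurable_funM.
move=> z Dz /=; rewrite lee_fin.
rewrite [leRHS]ger0_norm; last by rewrite addr_ge0// mulr_ge0.
apply: le_trans (ler_normD _ _) _; rewrite !normrM; apply: lerD.
  by rewrite mulrC ler_wpM2r.
by apply: ler_pM => //; exact: bw.
Qed.

Lemma byparts_xlip w g gx p q : p.1 <= q.1 -> continuous w -> ACLx w -> xlip g gx ->
  (\int[lxl R]_(z in rect p q) `|Dx w z|%:E < +oo)%E ->
  (lxl R).-integrable (rect p q) (fun z => (Dx w z * g z + w z * gx z)%:E) /\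
  (\int[lxl R]_(z in rect p q) (Dx w z * g z + w z * gx z)%:E =
   \int[leb]_(y in `]p.2, q.2]) (w (q.1, y) * g (q.1, y) - w (p.1, y) * g (p.1, y))%:E)%E.
Proof.
move=> pq cw aw [B [B0 [mg mgx] [bg bgx] lg dg]] iw.
have [M M0 wM] := bounded_rect p q cw.
have ii : (lxl R).-integrable (rect p q) (fun z => (Dx w z * g z + w z * gx z)%:E).
  apply: (@integrable_dominated (rect p q) (Dx w) g w gx B M) => //.
  - exact: measurable_rect.
  - exact: finite_rect.
  - exact: measurable_Dx.
  - exact: continuous_measurable2.
by split=> //; exact: (byparts_x pq B0 cw aw mg mgx lg dg ii).
Qed.

Lemma byparts_ylip w g gy p q : p.2 <= q.2 -> continuous w -> ACLy w -> ylip g gy ->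
  (\int[lxl R]_(z in rect p q) `|Dy w z|%:E < +oo)%E ->
  (lxl R).-integrable (rect p q) (fun z => (Dy w z * g z + w z * gy z)%:E) /\
  (\int[lxl R]_(z in rect p q) (Dy w z * g z + w z * gy z)%:E =
   \int[leb]_(x in `]p.1, q.1]) (w (x, q.2) * g (x, q.2) - w (x, p.2) * g (x, p.2))%:E)%E.
Proof.
move=> pq cw aw [B [B0 [mg mgx] [bg bgx] lg dg]] iw.
have [M M0 wM] := bounded_rect p q cw.
have E (f : R * R -> R) : (f \o swp) \o swp = f by apply/funext => z; rewrite /= swpK.
have mg' : measurable_fun setT g by rewrite -[g]E; exact: measurable_fun_swp.
have mgx' : measurable_fun setT gy by rewrite -[gy]E; exact: measurable_fun_swp.
have bg' z : `|g z| <= B by rewrite -[z]swpK; exact: bg.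
have bgx' z : `|gy z| <= B by rewrite -[z]swpK; exact: bgx.
have ii : (lxl R).-integrable (rect p q) (fun z => (Dy w z * g z + w z * gy z)%:E).
  apply: (@integrable_dominated (rect p q) (Dy w) g w gy B M) => //.
  - exact: measurable_rect.
  - exact: finite_rect.
  - exact: measurable_Dy.
  - exact: continuous_measurable2.
split=> //; apply: (byparts_y pq B0 cw aw mg' mgx' _ _ ii) => [y y' x yy|]; first exact: lg.
exact: dg.
Qed.

(** The squared norm of the radial field integrates to at most [disc_area] on the disc of radius
    [r], and to at most [disc_area ((9 / 8)^2 - 1)] on each annulus. The total grows like the
    logarithm of the radius. *)
Lemma radial_energy (x0 : R * R) (r : R) (j : nat) : 0 < r ->
  (\int[lxl R]_(z in [set z | (sqd x0 z < ((9 / 8) ^+ j * r) ^+ 2)%R])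
     ((rden r (z.2 - x0.2) (z.1 - x0.1))^-1)%:E <= (disc_area R * (1 + 17 / 64 * j%:R))%:E)%E.
Proof.
move=> r0; pose e z := (rden r (z.2 - x0.2) (z.1 - x0.1))^-1.
have e0 z : 0 <= e z by rewrite invr_ge0 ltW// rden_gt0.
have me : measurable_fun setT (EFin \o e).
  by apply/measurable_EFinP; apply: continuous_measurable2 => z; have := continuous_rdenV (x0 := x0) (n := 1) r0; exact.
have K0 := disc_area_gt0 R.
elim: j => [|j IH].
  apply: (@le_trans _ _ (\int[lxl R]_(z in [set z | (sqd x0 z < (r ^+ 2))%R]) (cst ((r ^+ 2)^-1)%:E z))%E).
    rewrite expr0 mul1r; apply: ge0_le_integral => //; try exact: measurable_sqd_lt.
    - by move=> z _; rewrite lee_fin; exact: e0.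
    - exact: measurable_funTS.
    - by move=> z _; rewrite lee_fin; exact: rden_inv.
  rewrite integral_cst; last exact: measurable_sqd_lt.
  rewrite [X in (_ * X)%E](lxl_sqd_lt x0 r) -EFinM lee_fin mulr0 addr0 mulr1.
  by rewrite mulrCA mulVf ?mulr1// expf_neq0// gt_eqF.
pose s := (9 / 8) ^+ j * r; have s0 : 0 < s by rewrite mulr_gt0// exprn_gt0.
rewrite (_ : (9 / 8) ^+ j.+1 * r = 9 / 8 * s); last by rewrite exprS mulrA.
have ss : s ^+ 2 <= (9 / 8 * s) ^+ 2.
  by rewrite [(9 / 8 * s) ^+ 2]exprMn ler_peMl ?sqr_ge0// exprn_ege1//; lra.
set A := [set z | (sqd x0 z < (9 / 8 * s) ^+ 2)%R]; pose B := [set z | (sqd x0 z < s ^+ 2)%R].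
have mA : measurable A by exact: measurable_sqd_lt.
have mB : measurable B by exact: measurable_sqd_lt.
have BA : B `<=` A by move=> z /= h; exact: lt_le_trans ss.
have mAB : measurable (A `\` B) by exact: measurableD.
rewrite -(setDUK BA) ge0_integral_setU//; last 3 first.
- exact: measurable_funTS.
- by move=> z _; rewrite lee_fin; exact: e0.
- by apply/disj_setPRL => z [].
have -> : disc_area R * (1 + 17 / 64 * j.+1%:R) = disc_area R * (1 + 17 / 64 * j%:R) + disc_area R * (17 / 64).
  by rewrite -[j.+1%:R]natr1; ring.
rewrite EFinD; apply: leeD; first exact: IH.
apply: (@le_trans _ _ (\int[lxl R]_(z in A `\` B) (cst ((s ^+ 2)^-1)%:E z))%E).
  apply: ge0_le_integral => //.
  - by move=> z _; rewrite lee_fin; exact: e0.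
  - exact: measurable_funTS.
  - move=> z [_ /negP]; rewrite -leNgt => h; rewrite lee_fin lef_pV2 ?posrE ?rden_gt0 ?exprn_gt0//.
    exact: le_trans h (rden_ge _ _ _).
have mD : lxl R (A `\` B) = (disc_area R * (9 / 8 * s) ^+ 2 - disc_area R * s ^+ 2)%:E.
  have h := @measureD _ _ _ (lxl R) A B mA mB; rewrite /= in h; rewrite h.
    by rewrite setIC (setIidl BA) EFinB; congr (_ - _)%E; exact: lxl_sqd_lt.
  by rewrite lxl_sqd_lt ltry.
rewrite integral_cst// [X in (_ * X)%E]mD -EFinM lee_fin le_eqVlt; apply/orP; left; apply/eqP.
by field; rewrite gt_eqF.
Qed.
End bp.

(** * Growth *)

Section realint.
Variable R : realType.
Implicit Types (f g : R * R -> R) (D A : set (R * R)).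

Lemma integrable_add D f g : measurable D ->
  (lxl R).-integrable D (fun z => (f z)%:E) -> (lxl R).-integrable D (fun z => (g z)%:E) ->
  (lxl R).-integrable D (fun z => (f z + g z)%:E) /\
  (\int[lxl R]_(z in D) (f z + g z)%:E = \int[lxl R]_(z in D) (f z)%:E + \int[lxl R]_(z in D) (g z)%:E)%E.
Proof.
move=> mD fi gi; split; first exact: (integrableD mD fi gi).
exact: (integralD mD fi gi).
Qed.

Lemma integrable_scale D f (c : R) : measurable D ->
  (lxl R).-integrable D (fun z => (f z)%:E) ->
  (lxl R).-integrable D (fun z => (c * f z)%:E) /\
  (\int[lxl R]_(z in D) (c * f z)%:E = c%:E * \int[lxl R]_(z in D) (f z)%:E)%E.
Proof.
move=> mD fi; split; first exact: (integrableZl mD c fi).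
exact: (integralZl mD fi).
Qed.

Lemma integrable_nonneg D f (c : R) : measurable D -> measurable_fun setT f -> (forall z, 0 <= f z) ->
  (\int[lxl R]_(z in D) (f z)%:E <= c%:E)%E -> (lxl R).-integrable D (fun z => (f z)%:E).
Proof.
move=> mD mf f0 h; apply/integrableP; split; first by apply: measurable_funTS; exact/measurable_EFinP.
rewrite (eq_integral (fun z => (f z)%:E)); first exact: le_lt_trans h (ltry _).
by move=> z _; rewrite /= ger0_norm.
Qed.

Lemma integrable_indicR D A : measurable D -> measurable A -> A `<=` D -> (lxl R A < +oo)%E ->
  (lxl R).-integrable D (fun z => (\1_A z : R)%:E) /\ (\int[lxl R]_(z in D) (\1_A z : R)%:E = lxl R A)%E.
Proof.
move=> mD mA AD fA; have e : (\int[lxl R]_(z in D) (\1_A z : R)%:E = lxl R A)%E.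
  by rewrite integral_indic// (setIidl AD).
split=> //; apply: (@integrable_nonneg _ _ (fine (lxl R A))) => //.
by rewrite e fineK// fin_numElt fA (lt_le_trans _ (measure_ge0 _ _)).
Qed.

Lemma le_integralR D f g : measurable D -> (lxl R).-integrable D (fun z => (f z)%:E) ->
  (lxl R).-integrable D (fun z => (g z)%:E) -> (forall z, D z -> f z <= g z) ->
  (\int[lxl R]_(z in D) (f z)%:E <= \int[lxl R]_(z in D) (g z)%:E)%E.
Proof. by move=> mD fi gi h; apply: le_integral => // z /set_mem Dz; rewrite lee_fin; exact: h. Qed.

Lemma Dx_subr f (c : R) z : Dx (fun z => f z - c) z = Dx f z.
Proof.
rewrite /Dx; congr (fine (limn_esup _)); apply/funext => n; congr (_%:E); congr (_ * _); ring.
Qed.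

Lemma Dy_subr f (c : R) z : Dy (fun z => f z - c) z = Dy f z.
Proof. exact: Dx_subr. Qed.

Lemma ACLx_subr f (c : R) : ACLx f -> ACLx (fun z => f z - c).
Proof. by move=> h; exact: (ACLx_add h (ACLx_cst (- c))). Qed.

Lemma ACLy_subr f (c : R) : ACLy f -> ACLy (fun z => f z - c).
Proof. by move=> h; exact: (ACLx_subr c h). Qed.
End realint.

Section growth.
Variable R : realType.
Notation swp := (@swp R).

(* [2 a b <= a^2 / 11 + 11 b^2] in both coordinates *)
Lemma field_amgm (a1 a2 b1 b2 e : R) : b1 ^+ 2 + b2 ^+ 2 <= e ->
  a1 * b1 + a2 * b2 <= (a1 ^+ 2 + a2 ^+ 2) / 22 + 11 / 2 * e.
Proof.
have key (a b : R) : a * b <= a ^+ 2 / 22 + 11 / 2 * b ^+ 2.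
  have := sqr_ge0 (a - 11 * b).
  by rewrite (_ : (a - 11 * b) ^+ 2 = a ^+ 2 - 22 * (a * b) + 121 * b ^+ 2); [lra|ring].
by move=> h; have := key a1 b1; have := key a2 b2; lra.
Qed.

(* Test the gradient of [U - n], which vanishes on the boundary of the square,
   against the radial field: its flux [2 disc_area] per layer is paid for by the
   energy of [U] and the logarithmic energy of the field. *)
Lemma layered_growth F c (rho r h : R) n m U (x0 : R * R) : layered F c rho n U -> 0 < r ->
  h = (9 / 8) ^+ m * r ->
  (forall z, sqd x0 z < r ^+ 2 -> sqd c (F z) <= rho ^+ 2) ->
  (forall z, box x0 h z -> `|z.1 - x0.1| = h \/ `|z.2 - x0.2| = h ->
    ((9 / 8) ^+ n * rho) ^+ 2 <= sqd c (F z)) ->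
  2 * n%:R <= 11 + 1461 / 500 * (m%:R + 6) :> R.
Proof.
move=> LU r0 hE Hin Hout; have K0 := disc_area_gt0 R.
have [[cU Ux Uy] U0 Un _ Ue] := LU.
have rh : r <= h by rewrite hE ler_peMl ?(ltW r0)// exprn_ege1//; lra.
have h0 : 0 <= h by apply: le_trans rh; exact: ltW.
pose p : R * R := (x0.1 - h, x0.2 - h); pose q : R * R := (x0.1 + h, x0.2 + h).
have mQ : measurable (rect p q) by exact: measurable_rect.
have Qb : rect p q `<=` box x0 h by apply: rect_box.
have pq1 : p.1 <= q.1 by rewrite /p /q /=; lra.
have pq2 : p.2 <= q.2 by rewrite /p /q /=; lra.
pose V z := U z - n%:R.
have cV : continuous V by move=> z; apply: cvgB; [exact: cU|exact: cvg_cst].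
have bV z : box x0 h z -> `|z.1 - x0.1| = h \/ `|z.2 - x0.2| = h -> V z = 0.
  by move=> b1 b2; rewrite /V Un ?subrr//; exact: Hout.
have gx z : Dx U z ^+ 2 <= grad2 U z by rewrite lerDl sqr_ge0.
have gy z : Dy U z ^+ 2 <= grad2 U z by rewrite lerDr sqr_ge0.
have ix : (\int[lxl R]_(z in rect p q) `|Dx V z|%:E < +oo)%E.
  under eq_integral => z _ do rewrite Dx_subr.
  by apply: le_lt_trans (layered_length LU h0 ltr01 mQ Qb (measurable_Dx cU) gx) (ltry _).
have iy : (\int[lxl R]_(z in rect p q) `|Dy V z|%:E < +oo)%E.
  under eq_integral => z _ do rewrite Dy_subr.
  by apply: le_lt_trans (layered_length LU h0 ltr01 mQ Qb (measurable_Dy cU) gy) (ltry _).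
have [i1 e1] := byparts_xlip pq1 cV (ACLx_subr _ Ux) (xlip_W1 x0 r0) ix.
have [i2 e2] := byparts_ylip pq2 cV (ACLy_subr _ Uy) (ylip_W2 x0 r0) iy.
have e1h (a : R) : `|a + h - a| = h by rewrite (addrC a) addrK ger0_norm.
have e2h (a : R) : `|a - h - a| = h by rewrite (addrC a) addrK normrN ger0_norm.
have e1' : (\int[lxl R]_(z in rect p q) (Dx V z * W1 x0 r z + V z * dW1 x0 r z)%:E = 0)%E.
  rewrite e1 integral0_eq// => y; rewrite /= in_itv /= => /andP[y1 y2].
  have yb : `|y - x0.2| <= h by rewrite ler_distl; apply/andP; split; lra.
  have v1 : V (x0.1 + h, y) = 0 by apply: bV; [split|left]; rewrite /= ?e1h.
  have v2 : V (x0.1 - h, y) = 0 by apply: bV; [split|left]; rewrite /= ?e2h.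
  by congr EFin; rewrite /q /p /= v1 v2 !mul0r subr0.
have e2' : (\int[lxl R]_(z in rect p q) (Dy V z * W2 x0 r z + V z * (dW1 (swp x0) r \o swp) z)%:E = 0)%E.
  rewrite e2 integral0_eq// => x; rewrite /= in_itv /= => /andP[y1 y2].
  have yb : `|x - x0.1| <= h by rewrite ler_distl; apply/andP; split; lra.
  have v1 : V (x, x0.2 + h) = 0 by apply: bV; [split|right]; rewrite /= ?e1h.
  have v2 : V (x, x0.2 - h) = 0 by apply: bV; [split|right]; rewrite /= ?e2h.
  by congr EFin; rewrite /q /p /= v1 v2 !mul0r subr0.
have [i3 e3] := integrable_add mQ i1 i2; rewrite e1' e2' adde0 in e3.
pose A : set (R * R) := [set z | sqd x0 z < r ^+ 2].
have mA : measurable A by exact: measurable_sqd_lt.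
have AQ : A `<=` rect p q.
  move=> [x y]; rewrite /A /sqd /= => s.
  have a1 : (x - x0.1) ^+ 2 < h ^+ 2.
    by apply: lt_le_trans (_ : r ^+ 2 <= _); [have := sqr_ge0 (y - x0.2); lra|rewrite ler_pXn2r ?nnegrE// ltW].
  have a2 : (y - x0.2) ^+ 2 < h ^+ 2.
    by apply: lt_le_trans (_ : r ^+ 2 <= _); [have := sqr_ge0 (x - x0.1); lra|rewrite ler_pXn2r ?nnegrE// ltW].
  have key (t : R) : t ^+ 2 < h ^+ 2 -> - h < t < h.
    by rewrite -ltr_norml -[t ^+ 2]real_normK ?num_real// ltr_pXn2r ?nnegrE.
  have /andP[? ?] := key _ a1; have /andP[? ?] := key _ a2.
  by split; rewrite /= in_itv /=; apply/andP; split; lra.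
have lA : lxl R A = (disc_area R * r ^+ 2)%:E by exact: lxl_sqd_lt.
have [i4 e4] : (lxl R).-integrable (rect p q) (fun z => (\1_A z : R)%:E) /\ (\int[lxl R]_(z in rect p q) (\1_A z : R)%:E = lxl R A)%E.
  by apply: integrable_indicR => //; rewrite lA ltry.
have [i5 e5] := integrable_scale (n%:R * (2 * (r ^+ 2)^-1)) mQ i4.
have [i6 e6] := integrable_add mQ i3 i5.
have ig : (lxl R).-integrable (rect p q) (fun z => (grad2 U z)%:E).
  apply: (@integrable_nonneg _ _ _ (22 * disc_area R * n%:R)) => //; [exact: measurable_grad2|by move=> z; exact: grad2_ge0|].
  by apply: (Ue _ (`|x0.1| + `|x0.2| + h)) => //; [rewrite !addr_ge0|exact: subset_trans Qb (@box_box0 _ _ _)].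
have mD : measurable_fun setT (fun z : R * R => (rden r (z.2 - x0.2) (z.1 - x0.1))^-1).
  by apply: continuous_measurable2 => z; have := continuous_rdenV (x0 := x0) (n := 1) r0; exact.
have D0 (z : R * R) : 0 <= (rden r (z.2 - x0.2) (z.1 - x0.1))^-1 by rewrite invr_ge0 ltW// rden_gt0.
(* Six more annuli pass from the disc of radius [h] to one containing the square:
   [(9 / 8)^6 >= 2]. *)
have eD : (\int[lxl R]_(z in rect p q) ((rden r (z.2 - x0.2) (z.1 - x0.1))^-1)%:E <=
    (disc_area R * (1 + 17 / 64 * (m + 6)%:R))%:E)%E.
  apply: le_trans (radial_energy x0 (m + 6) r0); apply: ge0_subset_integral => //.
  - exact: measurable_sqd_lt.
  - by apply: measurable_funTS; exact/measurable_EFinP.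
  - by move=> z _; rewrite lee_fin.
  - move=> z /Qb[]; rewrite /sqd /= => b1 b2; have := abs_le_sqr b1; have := abs_le_sqr b2 => c1 c2.
    rewrite exprD mulrAC -hE exprMn.
    have k : 4 <= ((9 / 8) ^+ 6) ^+ 2 :> R by rewrite !exprS expr0; lra.
    have h2 : 0 < h ^+ 2 by rewrite exprn_gt0// (lt_le_trans r0).
    have : h ^+ 2 * 4 <= h ^+ 2 * ((9 / 8) ^+ 6) ^+ 2 by rewrite ler_pM2l.
    by move: h2 c1 c2; move: (h ^+ 2) => H; move: (_ * (_ ^+ 6) ^+ 2) => X; lra.
have iD := integrable_nonneg mQ mD D0 eD.
(* With this weight the energy of [U] contributes [disc_area n], half of the flux; the other half
   remains to be compared with the energy of the field. *)
have [i7 e7] := integrable_scale (22^-1) mQ ig.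
have [i8 e8] := integrable_scale (11 / 2) mQ iD.
have [i9 e9] := integrable_add mQ i7 i8.
have LE : (\int[lxl R]_(z in rect p q) (Dx V z * W1 x0 r z + V z * dW1 x0 r z + (Dy V z * W2 x0 r z + V z * (dW1 (swp x0) r \o swp) z) + n%:R * (2 * (r ^+ 2)^-1) * \1_A z)%:E <=
   \int[lxl R]_(z in rect p q) (22^-1 * grad2 U z + 11 / 2 * (rden r (z.2 - x0.2) (z.1 - x0.1))^-1)%:E)%E.
  apply: (le_integralR mQ i6 i9) => z _; rewrite !Dx_subr !Dy_subr.
  have -> : Dx U z * W1 x0 r z + V z * dW1 x0 r z + (Dy U z * W2 x0 r z + V z * (dW1 (swp x0) r \o swp) z) + n%:R * (2 * (r ^+ 2)^-1) * \1_A z =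
     Dx U z * W1 x0 r z + Dy U z * W2 x0 r z + (V z * (dW1 x0 r z + (dW1 (swp x0) r \o swp) z) + n%:R * (2 * (r ^+ 2)^-1) * \1_A z) by ring.
  rewrite div_W indicE; have -> : (z \in A) = (sqd x0 z < r ^+ 2) by apply/idP/idP => [/set_mem//|h1]; exact/mem_set.
  rewrite [X in _ + X](_ : _ = 0) ?addr0.
    by apply: le_trans (field_amgm _ _ (normW_le x0 z r0)) _; rewrite /grad2 [22^-1 * _]mulrC.
  case: ifPn => h1; last by rewrite !mulr0 addr0.
  by rewrite /V (U0 _ (Hin _ h1)) sub0r mulr1 mulNr addNr.
move: LE; rewrite e6 e3 add0e e5 e4 lA e9 e7 e8.
rewrite -EFinM => LE.
have : ((n%:R * (2 * (r ^+ 2)^-1) * (disc_area R * r ^+ 2))%:E <=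
  22^-1%:E * (22 * disc_area R * n%:R)%:E + (11 / 2)%:E * (disc_area R * (1 + 17 / 64 * (m + 6)%:R))%:E)%E.
  apply: le_trans LE _; apply: leeD; apply: lee_wpmul2l; rewrite ?lee_fin ?invr_ge0 ?divr_ge0//.
  by apply: (Ue _ (`|x0.1| + `|x0.2| + h)) => //; [rewrite !addr_ge0|exact: subset_trans Qb (@box_box0 _ _ _)].
rewrite -!EFinM -EFinD lee_fin natrD.
rewrite (_ : n%:R * (2 * (r ^+ 2)^-1) * (disc_area R * r ^+ 2) = disc_area R * (2 * n%:R)); last first.
  by field; rewrite gt_eqF.
rewrite (_ : _ + _ = disc_area R * (n%:R + 11 / 2 * (1 + 17 / 64 * (m%:R + 6)))); last by field.
(* The slope is [11 * 17 / 64], rounded up to 1461/500. *)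
rewrite ler_pM2l//; have := ler0n R m; lra.
Qed.
End growth.

Section growth2.
Variable R : realType.

(** By [layered_growth] there are fewer than 3/2 layers per annulus, up to a constant: [3 p + 15]
    layers do not fit over [2 p] annuli, since [30 > 11 + 6 * 1461 / 500]. So [F z] is close to
    [F x0] for some [z] on the sides of the large square or their extensions, and [distortion]
    passes the bound on to the square of half the size. This is the exponent 3/2. *)
Lemma growth : exists N : nat, forall F G k (x0 : R * R) (r rho : R) (p : nat) q,
  almost_conformal F G k -> 0 < r -> 0 < rho ->
  (forall z, sqd x0 z < r ^+ 2 -> sqd (F x0) (F z) <= rho ^+ 2) ->
  box x0 ((9 / 8) ^+ (2 * p) * r / 2) q ->
  sqd (F x0) (F q) <= ((9 / 8) ^+ (3 * p + N) * rho) ^+ 2.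
Proof.
have [N HN] := distortion R; exists (15 + N)%N => F G k x0 r rho p q H r0 rho0 Hin qb.
have l0 : 0 < 9 / 8 :> R by lra.
pose h := (9 / 8) ^+ (2 * p) * r; have h0 : 0 < h by rewrite mulr_gt0// exprn_gt0.
have h20 : 0 < h / 2 by rewrite divr_gt0.
have [U LU] := almost_conformal_layers (F x0) (3 * p + 15) H rho0.
have [z [zb hz]] : exists z, (`|z.1 - x0.1| = h \/ `|z.2 - x0.2| = h) /\
    sqd (F x0) (F z) < ((9 / 8) ^+ (3 * p + 15) * rho) ^+ 2.
  apply/not_existsP => Hn.
  have := @layered_growth R F (F x0) rho r h (3 * p + 15) (2 * p) U x0 LU r0 erefl Hin.
  have Hout z : box x0 h z -> `|z.1 - x0.1| = h \/ `|z.2 - x0.2| = h ->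
      ((9 / 8) ^+ (3 * p + 15) * rho) ^+ 2 <= sqd (F x0) (F z).
    by move=> _ zb; rewrite leNgt; apply/negP => hz; apply: (Hn z).
  by move=> /(_ Hout); rewrite natrD !natrM; have := ler0n R p; lra.
have h2 : 2 * (h / 2) = h by field.
have := HN F G k x0 (h / 2) z q H h20 qb; rewrite h2 => /(_ zb) h1; apply: le_trans h1 _.
have -> : (9 / 8) ^+ (3 * p + (15 + N)) * rho = (9 / 8) ^+ N * ((9 / 8) ^+ (3 * p + 15) * rho).
  by rewrite addnA exprD mulrA [X in X * rho]mulrC.
rewrite [leRHS]exprMn ler_pM2l ?exprn_gt0//; exact: ltW.
Qed.

(** [distortion] compares the square about [x] with the single point [x + 2 r] on the boundary of
    its double, and there [F] is given by [h]. *)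
Lemma modulus : exists2 L : R, 0 < L & forall F G k (h : R -> R) (x r d : R) q,
  almost_conformal F G k -> 0 < r -> F (x, 0) = (h x, 0) -> F (x + 2 * r, 0) = (h (x + 2 * r), 0) ->
  `|h (x + 2 * r) - h x| <= d -> box (x, 0) r q ->
  sqd (F (x, 0)) (F q) <= (L * d) ^+ 2.
Proof.
have [N HN] := distortion R; exists ((9 / 8) ^+ N); first by rewrite exprn_gt0//; lra.
move=> F G k h x r d q H r0 e1 e2 hd qb.
have := HN F G k (x, 0) r (x + 2 * r, 0) q H r0 qb.
rewrite /= addrAC subrr add0r ger0_norm ?mulr_ge0 ?(ltW r0)// => /(_ (or_introl erefl)) h1.
apply: le_trans h1 _; rewrite [leRHS]exprMn ler_wpM2l ?sqr_ge0// e1 e2 /sqd /= subrr expr0n addr0.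
exact: abs_le_sqr.
Qed.
End growth2.

(** * The kernel of the second difference *)

Section dipole.
Variable R : realType.

(* With [z = X + i Y], the left-hand side is the squared modulus of
   [\sum_i al_i / (z - x_i)] for the second-difference weights [al_i],
   which is [c / \prod_i (z - x_i)] with [c] constant. *)
Lemma dipole_norm (a1 a2 a3 y d1 d2 d3 : R) :
  d1 = a1 ^+ 2 + y ^+ 2 -> d2 = a2 ^+ 2 + y ^+ 2 -> d3 = a3 ^+ 2 + y ^+ 2 ->
  d1 != 0 -> d2 != 0 -> d3 != 0 ->
  ((a2 - a3) * (a1 / d1) + (a3 - a1) * (a2 / d2) + (a1 - a2) * (a3 / d3)) ^+ 2 +
  ((a2 - a3) * (y / d1) + (a3 - a1) * (y / d2) + (a1 - a2) * (y / d3)) ^+ 2 =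
  ((a1 - a2) * (a2 - a3) * (a3 - a1)) ^+ 2 / (d1 * d2 * d3).
Proof.
move=> -> -> -> h1 h2 h3; field; by rewrite h1 h2 h3.
Qed.
End dipole.

(** * The three-point identity *)

Section bple.
Variable R : realType.
Notation leb := (@leb R).
Implicit Types (w g gx gy : R * R -> R) (z p q : R * R).

Lemma integral_itv_le (phi : R -> R) (a b c : R) : a <= b -> 0 <= c -> measurable_fun setT phi ->
  (forall x, a < x -> x <= b -> `|phi x| <= c) ->
  (`|\int[leb]_(x in `]a, b]) (phi x)%:E| <= (c * (b - a))%:E)%E.
Proof.
move=> ab c0 mphi h.
have mp : measurable_fun `]a, b] (fun x => (phi x)%:E) by apply: measurable_funTS; exact/measurable_EFinP.
apply: le_trans (le_abse_integral _ _ mp) _ => //.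
apply: (@le_trans _ _ (\int[leb]_(x in `]a, b]) (cst c%:E x))%E).
  apply: ge0_le_integral => //; first exact: measurableT_comp.
  by move=> x /=; rewrite in_itv /= => /andP[x1 x2]; rewrite lee_fin; exact: h.
rewrite integral_cst// EFinM; apply: lee_wpmul2l; first by rewrite lee_fin.
by rewrite /= leb_itv /= lte_fin; case: ifPn => // _; rewrite lee_fin subr_ge0.
Qed.

Lemma byparts_xlip_le w g gx (x0 : R * R) (H S C : R) : 0 <= H -> 0 <= S -> 0 <= C ->
  let p := (x0.1 - H, x0.2 - H) in let q := (x0.1 + H, x0.2 + H) in
  continuous w -> ACLx w -> xlip g gx ->
  (\int[lxl R]_(z in rect p q) `|Dx w z|%:E < +oo)%E ->
  (forall z, box x0 H z -> `|w z| <= S) ->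
  (forall z, box x0 H z -> `|z.1 - x0.1| = H \/ `|z.2 - x0.2| = H -> `|g z| <= C) ->
  (lxl R).-integrable (rect p q) (fun z => (Dx w z * g z + w z * gx z)%:E) /\
  (`|\int[lxl R]_(z in rect p q) (Dx w z * g z + w z * gx z)%:E| <= (4 * S * C * H)%:E)%E.
Proof.
move=> H0 S0 C0 p q cw aw xg iw bw bg.
have pq : p.1 <= q.1 by rewrite /p /q /=; lra.
have pq2 : p.2 <= q.2 by rewrite /p /q /=; lra.
have [i1 e1] := byparts_xlip pq cw aw xg iw; split=> //; rewrite e1.
have [B [_ [mg _] _ _ _]] := xg.
rewrite (_ : 4 * S * C * H = 2 * (S * C) * (q.2 - p.2)); last by rewrite /p /q /=; ring.
apply: integral_itv_le => //.
- by rewrite mulr_ge0// mulr_ge0.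
- have mw := continuous_measurable2 cw.
  by apply: measurable_funB; apply: measurable_funM; apply: measurable_fun_pair2.
move=> y; rewrite /p /q /= => y1 y2.
have yb : `|y - x0.2| <= H by rewrite ler_distl; apply/andP; split; [exact: ltW|].
have n1 : `|x0.1 + H - x0.1| = H by rewrite (addrC x0.1) addrK ger0_norm.
have n2 : `|x0.1 - H - x0.1| = H by rewrite (addrC x0.1) addrK normrN ger0_norm.
have b1 : box x0 H (x0.1 + H, y) by split; rewrite /= ?n1.
have b2 : box x0 H (x0.1 - H, y) by split; rewrite /= ?n2.
apply: le_trans (ler_normB _ _) _; rewrite !normrM mulr_natl mulr2n.
by apply: lerD; apply: ler_pM => //; (exact: bw || (apply: bg => //; left; rewrite /= ?n1 ?n2)).
Qed.

Lemma byparts_ylip_le w g gy (x0 : R * R) (H S C : R) : 0 <= H -> 0 <= S -> 0 <= C ->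
  let p := (x0.1 - H, x0.2 - H) in let q := (x0.1 + H, x0.2 + H) in
  continuous w -> ACLy w -> ylip g gy ->
  (\int[lxl R]_(z in rect p q) `|Dy w z|%:E < +oo)%E ->
  (forall z, box x0 H z -> `|w z| <= S) ->
  (forall z, box x0 H z -> `|z.1 - x0.1| = H \/ `|z.2 - x0.2| = H -> `|g z| <= C) ->
  (lxl R).-integrable (rect p q) (fun z => (Dy w z * g z + w z * gy z)%:E) /\
  (`|\int[lxl R]_(z in rect p q) (Dy w z * g z + w z * gy z)%:E| <= (4 * S * C * H)%:E)%E.
Proof.
move=> H0 S0 C0 p q cw aw xg iw bw bg.
have pq : p.1 <= q.1 by rewrite /p /q /=; lra.
have pq2 : p.2 <= q.2 by rewrite /p /q /=; lra.
have [i1 e1] := byparts_ylip pq2 cw aw xg iw; split=> //; rewrite e1.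
have [B [_ [mg _] _ _ _]] := xg.
have {}mg : measurable_fun setT g.
  rewrite (_ : g = (g \o @swp R) \o @swp R); first exact: measurable_fun_swp.
  by apply/funext => z; rewrite /= swpK.
rewrite (_ : 4 * S * C * H = 2 * (S * C) * (q.1 - p.1)); last by rewrite /p /q /=; ring.
apply: integral_itv_le => //.
- by rewrite mulr_ge0// mulr_ge0.
- have mw := continuous_measurable2 cw.
  by apply: measurable_funB; apply: measurable_funM; apply: measurable_fun_pair1.
move=> x; rewrite /p /q /= => y1 y2.
have xb : `|x - x0.1| <= H by rewrite ler_distl; apply/andP; split; [exact: ltW|].
have n1 : `|x0.2 + H - x0.2| = H by rewrite (addrC x0.2) addrK ger0_norm.
have n2 : `|x0.2 - H - x0.2| = H by rewrite (addrC x0.2) addrK normrN ger0_norm.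
have b1 : box x0 H (x, x0.2 + H) by split; rewrite /= ?n1.
have b2 : box x0 H (x, x0.2 - H) by split; rewrite /= ?n2.
apply: le_trans (ler_normB _ _) _; rewrite !normrM mulr_natl mulr2n.
by apply: lerD; apply: ler_pM => //; (exact: bw || (apply: bg => //; right; rewrite /= ?n1 ?n2)).
Qed.
End bple.

Section test.
Variable R : realType.

(* Cauchy-Schwarz for the Cauchy-Riemann defect [(e1, e2)] against the field [(b1, b2)] *)
Lemma defect_num (e1 e2 b1 b2 k e A : R) : 0 <= k -> 0 <= e -> e1 ^+ 2 + e2 ^+ 2 <= k ^+ 2 * e ->
  b1 ^+ 2 + b2 ^+ 2 <= A -> `|e1 * b1 + e2 * b2| <= k / 2 * (e + A).
Proof.
move=> k0 e0 he hb; have A0 : 0 <= A by apply: le_trans hb; rewrite addr_ge0 ?sqr_ge0.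
apply: sqr_le_abs; first by rewrite mulr_ge0 ?addr_ge0// divr_ge0.
have h1 : (e1 * b1 + e2 * b2) ^+ 2 <= (e1 ^+ 2 + e2 ^+ 2) * (b1 ^+ 2 + b2 ^+ 2).
  by rewrite -subr_ge0 (_ : _ - _ = (e1 * b2 - e2 * b1) ^+ 2) ?sqr_ge0//; ring.
apply: le_trans h1 _; apply: (@le_trans _ _ (k ^+ 2 * e * A)).
  by apply: ler_pM => //; rewrite addr_ge0 ?sqr_ge0.
rewrite -subr_ge0 (_ : _ - _ = (k / 2 * (e - A)) ^+ 2) ?sqr_ge0//; by field.
Qed.
End test.

(** The divergence of the radial field about [P] with radius [e]; its mass [2 disc_area] is the
    residue. *)
Definition bump (R : realType) (e : R) (P z : R * R) : R :=
  2 * (e ^+ 2)^-1 * \1_[set z | sqd P z < e ^+ 2] z.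

Section comb.
Variable R : realType.
Notation swp := (@swp R).
Variables (al1 al2 al3 e : R) (P1 P2 P3 : R * R).
Hypothesis e0 : 0 < e.
Implicit Types (w dw : R * R -> R -> R * R -> R) (z : R * R).

Definition comb w z := al1 * w P1 e z + al2 * w P2 e z + al3 * w P3 e z.

Lemma xlip_comb w dw : (forall P : R * R, xlip (w P e) (dw P e)) -> xlip (comb w) (comb dw).
Proof. by move=> h; apply: xlip_add; [apply: xlip_add|]; exact: xlip_scale. Qed.

Lemma ylip_comb w dw : (forall P : R * R, ylip (w P e) (dw P e)) -> ylip (comb w) (comb dw).
Proof. by move=> h; apply: ylip_add; [apply: ylip_add|]; exact: ylip_scale. Qed.

(* the derivative of [W2] in [y] *)
Definition eW (P : R * R) (r : R) := dW1 (swp P) r \o swp.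

Lemma div_comb z : comb (@dW1 R) z + comb eW z =
  al1 * bump e P1 z +
  al2 * bump e P2 z +
  al3 * bump e P3 z.
Proof.
have key P : bump e P z = dW1 P e z + eW P e z.
  rewrite /bump div_W indicE; have -> : (z \in [set z | sqd P z < e ^+ 2]) = (sqd P z < e ^+ 2).
    by apply/idP/idP => [/set_mem//|h1]; exact/mem_set.
  by case: ifPn; rewrite ?mulr1 ?mulr0.
by rewrite !key /comb; ring.
Qed.

Let A := (`|al1| + `|al2| + `|al3|) / e.

Lemma comb_bound w z : (forall P : R * R, `|w P e z| <= e^-1) -> `|comb w z| <= A.
Proof.
have key (a : R) P : (forall P : R * R, `|w P e z| <= e^-1) -> `|a * w P e z| <= `|a| / e.
  by move=> h; rewrite normrM ler_wpM2l.
move=> h; rewrite /A /comb !mulrDl; apply: le_trans (ler_normD _ _) _; apply: lerD; last exact: key.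
by apply: le_trans (ler_normD _ _) _; apply: lerD; exact: key.
Qed.

Lemma comb_sq z : comb (@W1 R) z ^+ 2 + comb (@W2 R) z ^+ 2 <= 2 * A ^+ 2.
Proof.
have h1 : `|comb (@W1 R) z| <= A by apply: comb_bound => P; apply: radial_bound => //; rewrite lerDl sqr_ge0.
have h2 : `|comb (@W2 R) z| <= A by apply: comb_bound => P; apply: radial_bound => //; rewrite lerDr sqr_ge0.
by have := abs_le_sqr h1; have := abs_le_sqr h2; lra.
Qed.
End comb.

Lemma abse_le_fin (R : realType) (x : \bar R) (c : R) : (`|x| <= c%:E)%E -> exists2 y, x = y%:E & `|y| <= c.
Proof. by case: x => [y| |] //=; rewrite ?leye_eq // lee_fin => h; exists y. Qed.

Section test.
Variable R : realType.
Notation swp := (@swp R).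
Variables (F G : R * R -> R * R) (k : R).
Hypothesis acF : almost_conformal F G k.
Let u z := (F z).1.
Let v z := (F z).2.

Lemma energy_box c (x0 : R * R) (H S : R) (D : set (R * R)) : 0 <= H -> 0 < S -> measurable D -> D `<=` box x0 H ->
  (forall z, box x0 H z -> sqd c (F z) <= S ^+ 2) ->
  (\int[lxl R]_(z in D) (energy F z)%:E <= (11 / 10 * (disc_area R * (2 * S) ^+ 2))%:E)%E.
Proof.
move=> H0 S0 mD DQ bS; have aok := almost_conformal_ok acF.
have [[cF cG FK GK] /andP[k0 k1] _ acf] := acF.
(* [bS] is a weak inequality and [area_ineq] wants an open set, hence the radius [2 S]. *)
pose O : set (R * R) := [set z | sqd c z < (2 * S) ^+ 2].
have oO : open O by apply: open_lt2; exact: continuous_sqd.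
have DO : D `<=` F @^-1` O.
  move=> z /DQ/bS h; rewrite /O /=; apply: le_lt_trans h _.
  by rewrite [ltRHS]exprMn ltr_pMl ?exprn_gt0// exprn_egt1//; lra.
have := area_ineq cF cG FK GK k0 k1 aok acf oO mD (_ : 0 <= `|x0.1| + `|x0.2| + H) DO.
rewrite lxl_sqd_lt -EFinM; apply; first by rewrite !addr_ge0.
exact: subset_trans DQ (@box_box0 _ _ _).
Qed.

Lemma integrable_partial c (x0 : R * R) (H S : R) (D : set (R * R)) (d : R * R -> R) :
  0 <= H -> 0 < S -> measurable D -> D `<=` box x0 H ->
  (forall z, box x0 H z -> sqd c (F z) <= S ^+ 2) -> measurable_fun setT d ->
  {ae lxl R, forall z, d z ^+ 2 <= 4 * energy F z} ->
  (\int[lxl R]_(z in D) `|d z|%:E < +oo)%E.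
Proof.
move=> H0 S0 mD DQ bS md ad; have E := energy_box H0 S0 mD DQ bS.
have [[cF cG FK GK] /andP[k0 k1] _ acf] := acF.
have me := measurable_energy cF.
have ie := integrable_nonneg mD me (@energy_ge0 _ F) E.
have [i1 e1] := integrable_scale 2 mD ie.
have fD : (lxl R D < +oo)%E.
  apply: (@le_lt_trans _ _ (lxl R (box x0 H))); last by rewrite lxl_box// ltry.
  by apply: le_lxl => //; exact: measurable_box.
have [i2 e2] := integrable_indicR mD mD (@subset_refl _ D) fD.
have [i3 e3] := integrable_add mD i1 i2.
apply: (@le_lt_trans _ _ (\int[lxl R]_(z in D) (2 * energy F z + \1_D z)%:E)%E).
  apply: ae_ge0_le_integral => //.
  - by apply: measurable_funTS; apply/measurable_EFinP; exact: measurableT_comp.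
  - by move=> z _; rewrite lee_fin addr_ge0// mulr_ge0// energy_ge0.
  - by case/integrableP: i3.
  - apply: filterS ad => z h Dz; rewrite lee_fin indicE mem_set//.
    by apply: le_trans (amgm (d z) ltr01) _; rewrite invr1 mul1r; move: h; rewrite [in X in _ -> X]/=; lra.
by have := integrable_fin_num mD i3; rewrite fin_numElt => /andP[].
Qed.
End test.

Section test.
Variable R : realType.
Notation swp := (@swp R).

Lemma bump_integral (D : set (R * R)) (P : R * R) (e : R) : 0 < e -> measurable D ->
  (forall z, sqd P z < e ^+ 2 -> D z) ->
  (lxl R).-integrable D (fun z => (bump e P z)%:E) /\
  (\int[lxl R]_(z in D) (bump e P z)%:E = (2 * disc_area R)%:E)%E.
Proof.
move=> e0 mD PD; pose A : set (R * R) := [set z | sqd P z < e ^+ 2].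
have lA : lxl R A = (disc_area R * e ^+ 2)%:E by exact: lxl_sqd_lt.
have [i1 e1] : (lxl R).-integrable D (fun z => (\1_A z : R)%:E) /\
    (\int[lxl R]_(z in D) (\1_A z : R)%:E = lxl R A)%E.
  by apply: integrable_indicR => //; [exact: measurable_sqd_lt|rewrite lA ltry].
have [i2 e2] := integrable_scale (2 * (e ^+ 2)^-1) mD i1; split=> //.
by rewrite e2 e1 lA -EFinM; congr EFin; field; rewrite gt_eqF.
Qed.

Lemma bump_ge0 (P : R * R) (e : R) z : 0 <= bump e P z.
Proof. by rewrite /bump mulr_ge0// mulr_ge0// invr_ge0 sqr_ge0. Qed.

Lemma bump0 (P : R * R) (e : R) z : ~ sqd P z < e ^+ 2 -> bump e P z = 0.
Proof. by move=> h; rewrite /bump indicE memNset ?mulr0. Qed.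

Lemma dist_itv (t a H : R) : `|t - a| < H -> a - H < t <= a + H.
Proof. by rewrite ltr_distl => /andP[-> /ltW ->]. Qed.

Lemma sum_bound (a b c d X : R) : `|a| <= X -> `|b| <= X -> `|c| <= X -> `|d| <= X ->
  a + b + c + -1 * d <= 4 * X.
Proof.
by rewrite !ler_norml => /andP[? ?] /andP[? ?] /andP[? ?] /andP[? ?]; lra.
Qed.

Lemma add_bound (q Q w a b c a' b' c' : R) : - q <= Q -> a <= w * a' -> b <= w * b' -> c <= w * c' ->
  a + b + c <= q + w * (a' + b' + c') + Q.
Proof. by move=> *; rewrite !mulrDr; lra. Qed.

Lemma disc_num (a h w d T : R) : 0 <= T -> `|w - h| <= d -> a * h * T - `|a| * d * T <= w * (a * T).
Proof.
move=> T0 hw; have : `|a * (w - h)| <= `|a| * d by rewrite normrM ler_wpM2l.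
rewrite ler_norml => /andP[h1 _].
have := ler_wpM2r T0 h1; rewrite mulNr mulrBr mulrBl => h2.
by rewrite (_ : w * (a * T) = a * w * T); [lra|ring].
Qed.

Variables (F G : R * R -> R * R) (k : R).
Hypothesis acF : almost_conformal F G k.
Let u z := (F z).1.
Let v z := (F z).2.

(* Integrating by parts [F - c] against the field [\sum_i al_i W (P_i)]: the
   divergence term is the mean of [u] over the discs of radius [e], and what is
   left is the boundary term and the Cauchy-Riemann defect. *)
Lemma test_ineq (al1 al2 al3 e H S C d : R) (P1 P2 P3 x0 c : R * R) :
  0 < e -> 0 <= H -> 0 < S -> 0 <= C ->
  (forall z, box x0 H z -> sqd c (F z) <= S ^+ 2) ->
  (forall P z, [\/ P = P1, P = P2 | P = P3] -> sqd P z < e ^+ 2 ->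
     [/\ `|z.1 - x0.1| < H, `|z.2 - x0.2| < H & `|u z - u P| <= d]) ->
  (forall z, box x0 H z -> `|z.1 - x0.1| = H \/ `|z.2 - x0.2| = H ->
     `|comb al1 al2 al3 e P1 P2 P3 (@W1 R) z| <= C /\ `|comb al1 al2 al3 e P1 P2 P3 (@W2 R) z| <= C) ->
  2 * disc_area R * (al1 * u P1 + al2 * u P2 + al3 * u P3 - (al1 + al2 + al3) * c.1 -
    (`|al1| + `|al2| + `|al3|) * d) <=
  16 * S * C * H + k / 2 * (11 / 10 * (disc_area R * (2 * S) ^+ 2) +
    2 * ((`|al1| + `|al2| + `|al3|) / e) ^+ 2 * (4 * H ^+ 2)).
Proof.
move=> e0 H0 S0 C0 bS bd bC.
pose p := (x0.1 - H, x0.2 - H); pose q := (x0.1 + H, x0.2 + H).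
have [[cF cG FK GK] /andP[k0 k1] [ux vx uy vy] acf] := acF.
have mQ : measurable (rect p q) by exact: measurable_rect.
have Qb : rect p q `<=` box x0 H by apply: rect_box.
pose u' z := u z - c.1; pose v' z := v z - c.2.
have cu : continuous u by exact: cont_fst.
have cv : continuous v by exact: cont_snd.
have cu' : continuous u' by move=> z; apply: cvgB; [exact: cu|exact: cvg_cst].
have cv' : continuous v' by move=> z; apply: cvgB; [exact: cv|exact: cvg_cst].
have bu z : box x0 H z -> `|u' z| <= S.
  by move=> /bS h; apply: sqr_le_abs; [exact: ltW|apply: le_trans h; rewrite lerDl sqr_ge0].
have bv z : box x0 H z -> `|v' z| <= S.
  by move=> /bS h; apply: sqr_le_abs; [exact: ltW|apply: le_trans h; rewrite lerDr sqr_ge0].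
(* This crude bound makes the partials in [y] square-dominated by the energy, as integration by
   parts needs them integrable. The precise bound in [k] enters only through [defect_num]. *)
have k21 : k ^+ 2 <= 1.
  by rewrite expr_le1//; apply: le_trans k1 _; lra.
have cE z : conf F k z -> (Dy u z + Dx v z) ^+ 2 + (Dy v z - Dx u z) ^+ 2 <= energy F z.
  by move=> h; apply: le_trans h _; rewrite ler_piMl// energy_ge0.
have sqB (x y E1 : R) : x ^+ 2 <= E1 -> (y + x) ^+ 2 <= E1 -> y ^+ 2 <= 4 * E1.
  by move=> h1 h2; have := sqr_ge0 (y + 2 * x); nra.
have fin (w : R * R -> R) : measurable_fun setT w -> {ae lxl R, forall z, w z ^+ 2 <= 4 * energy F z} ->
    (\int[lxl R]_(z in rect p q) `|w z|%:E < +oo)%E.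
  by move=> mw aw; exact: (integrable_partial acF H0 S0 mQ Qb bS mw aw).
have f1 : (\int[lxl R]_(z in rect p q) `|Dx u' z|%:E < +oo)%E.
  under eq_integral => z _ do rewrite Dx_subr.
  apply: fin; [exact: measurable_Dx|apply: aeW => z].
  by rewrite /energy; have := sqr_ge0 (Dx u z); have := sqr_ge0 (Dx v z); rewrite -/u -/v; lra.
have f3 : (\int[lxl R]_(z in rect p q) `|Dx v' z|%:E < +oo)%E.
  under eq_integral => z _ do rewrite Dx_subr.
  apply: fin; [exact: measurable_Dx|apply: aeW => z].
  by rewrite /energy; have := sqr_ge0 (Dx u z); have := sqr_ge0 (Dx v z); rewrite -/u -/v; lra.
have f2 : (\int[lxl R]_(z in rect p q) `|Dy u' z|%:E < +oo)%E.
  under eq_integral => z _ do rewrite Dy_subr.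
  apply: fin; [exact: measurable_Dy|apply: filterS acf => z /cE h].
  apply: (sqB (Dx v z)); first by rewrite /energy lerDr sqr_ge0.
  by apply: le_trans h; rewrite lerDl sqr_ge0.
have f4 : (\int[lxl R]_(z in rect p q) `|Dy v' z|%:E < +oo)%E.
  under eq_integral => z _ do rewrite Dy_subr.
  apply: fin; [exact: measurable_Dy|apply: filterS acf => z /cE h].
  apply: (sqB (- Dx u z)); first by rewrite sqrrN /energy lerDl sqr_ge0.
  by apply: le_trans h; rewrite lerDr sqr_ge0.
pose g1 := comb al1 al2 al3 e P1 P2 P3 (@W1 R).
pose g2 := comb al1 al2 al3 e P1 P2 P3 (@W2 R).
pose g1x := comb al1 al2 al3 e P1 P2 P3 (@dW1 R).
pose g2y := comb al1 al2 al3 e P1 P2 P3 (@eW R).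
pose g2x := comb al1 al2 al3 e P1 P2 P3 (@dW2 R).
have X1 : xlip g1 g1x by apply: xlip_comb => P; exact: xlip_W1.
have X2 : xlip g2 g2x by apply: xlip_comb => P; exact: xlip_W2.
have Y2 : ylip g2 g2y by apply: ylip_comb => P; exact: ylip_W2.
have Y1 : ylip g1 g2x by apply: ylip_comb => P; exact: ylip_W1.
have bC1 z : box x0 H z -> `|z.1 - x0.1| = H \/ `|z.2 - x0.2| = H -> `|g1 z| <= C.
  by move=> h1 h2; have [] := bC z h1 h2.
have bC2 z : box x0 H z -> `|z.1 - x0.1| = H \/ `|z.2 - x0.2| = H -> `|g2 z| <= C.
  by move=> h1 h2; have [] := bC z h1 h2.
have S0' := ltW S0.
(* The field [(g1, g2)] is irrotational: [g2x] is the derivative of [g2] in [x] and of [g1] in [y].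
   In the sum of the first three identities minus the fourth the terms in [v] cancel; the divergence
   against [u] and the Cauchy-Riemann defect remain. *)
have [i1 b1] := byparts_xlip_le H0 S0' C0 cu' (ACLx_subr c.1 ux) X1 f1 bu bC1.
have [i2 b2] := byparts_ylip_le H0 S0' C0 cu' (ACLy_subr c.1 uy) Y2 f2 bu bC2.
have [i3 b3] := byparts_xlip_le H0 S0' C0 cv' (ACLx_subr c.2 vx) X2 f3 bv bC2.
have [i4 b4] := byparts_ylip_le H0 S0' C0 cv' (ACLy_subr c.2 vy) Y1 f4 bv bC1.
rewrite -/p -/q in i1 b1 i2 b2 i3 b3 i4 b4.
have {b1}[r1 e1 b1] := abse_le_fin b1; have {b2}[r2 e2 b2] := abse_le_fin b2.
have {b3}[r3 e3 b3] := abse_le_fin b3; have {b4}[r4 e4 b4] := abse_le_fin b4.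
have [j4 e4'] := integrable_scale (-1) mQ i4; rewrite e4 -EFinM in e4'.
have [j12 e12] := integrable_add mQ i1 i2; rewrite e1 e2 -EFinD in e12.
have [j123 e123] := integrable_add mQ j12 i3; rewrite e12 e3 -EFinD in e123.
have [jf ef] := integrable_add mQ j123 j4; rewrite e123 e4' -EFinD in ef.
have PQ P z : [\/ P = P1, P = P2 | P = P3] -> sqd P z < e ^+ 2 -> rect p q z.
  move=> hP hz; have [h1 h2 _] := bd P z hP hz.
  by split; rewrite /= in_itv /=; exact: dist_itv.
have [t1 s1] := bump_integral e0 mQ (fun z => PQ P1 z (Or31 _ _ erefl)).
have [t2 s2] := bump_integral e0 mQ (fun z => PQ P2 z (Or32 _ _ erefl)).
have [t3 s3] := bump_integral e0 mQ (fun z => PQ P3 z (Or33 _ _ erefl)).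
(* A lower bound for [al * u'] on the disc about [P], where [u] is within [d] of its value at the
   centre. *)
pose be (al : R) P := al * u' P - `|al| * d.
have {t1 s1}[t1 s1] : (lxl R).-integrable (rect p q) (fun z => (be al1 P1 * bump e P1 z)%:E) /\
    (\int[lxl R]_(z in rect p q) (be al1 P1 * bump e P1 z)%:E = (be al1 P1 * (2 * disc_area R))%:E)%E.
  by have [h1 h2] := integrable_scale (be al1 P1) mQ t1; rewrite s1 -EFinM in h2.
have {t2 s2}[t2 s2] : (lxl R).-integrable (rect p q) (fun z => (be al2 P2 * bump e P2 z)%:E) /\
    (\int[lxl R]_(z in rect p q) (be al2 P2 * bump e P2 z)%:E = (be al2 P2 * (2 * disc_area R))%:E)%E.
  by have [h1 h2] := integrable_scale (be al2 P2) mQ t2; rewrite s2 -EFinM in h2.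
have {t3 s3}[t3 s3] : (lxl R).-integrable (rect p q) (fun z => (be al3 P3 * bump e P3 z)%:E) /\
    (\int[lxl R]_(z in rect p q) (be al3 P3 * bump e P3 z)%:E = (be al3 P3 * (2 * disc_area R))%:E)%E.
  by have [h1 h2] := integrable_scale (be al3 P3) mQ t3; rewrite s3 -EFinM in h2.
have [t12 s12] := integrable_add mQ t1 t2; rewrite s1 s2 -EFinD in s12.
have [t123 s123] := integrable_add mQ t12 t3; rewrite s12 s3 -EFinD in s123.
have mg1 : measurable_fun setT g1 by have [? [_ []]] := X1.
have mg2 : measurable_fun setT g2 by have [? [_ []]] := X2.
pose Q z := `|(Dy u z + Dx v z) * g2 z + (Dy v z - Dx u z) * - g1 z|.
have mQf : measurable_fun setT Q.
  apply: measurableT_comp => //; apply: measurable_funD; apply: measurable_funM => //.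
  - by apply: measurable_funD; [exact: measurable_Dy|exact: measurable_Dx].
  - by apply: measurable_funB; [exact: measurable_Dy|exact: measurable_Dx].
  - exact: (measurableT_comp (@oppr_measurable R setT) mg1).
pose A := 2 * ((`|al1| + `|al2| + `|al3|) / e) ^+ 2.
have A0 : 0 <= A by rewrite /A mulr_ge0 ?sqr_ge0.
have E' := energy_box acF H0 S0 mQ Qb bS; have me := measurable_energy cF.
have ie := integrable_nonneg mQ me (@energy_ge0 _ F) E'.
have lQ : (lxl R (rect p q) <= (4 * H ^+ 2)%:E)%E.
  by rewrite -(lxl_box x0 H0); apply: le_lxl => //; exact: measurable_box.
have [n1 m1] := integrable_indicR mQ mQ (@subset_refl _ _) (le_lt_trans lQ (ltry _)).
have [n2 m2] := integrable_scale A mQ n1.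
have [n3 m3] := integrable_add mQ ie n2.
have [n4 m4] := integrable_scale (k / 2) mQ n3.
have k20 : 0 <= k / 2 by rewrite divr_ge0.
have bQ : (\int[lxl R]_(z in rect p q) (Q z)%:E <=
    (k / 2 * (11 / 10 * (disc_area R * (2 * S) ^+ 2) + A * (4 * H ^+ 2)))%:E)%E.
  apply: (@le_trans _ _ (\int[lxl R]_(z in rect p q) (k / 2 * (energy F z + A * \1_(rect p q) z))%:E)%E).
    have mQD : measurable_fun (rect p q) (fun z => (Q z)%:E).
      by apply: measurable_funTS; exact/measurable_EFinP.
    have Q0 z : rect p q z -> (0 <= (Q z)%:E)%E by rewrite lee_fin /Q.
    apply: (ae_ge0_le_integral mQ Q0 mQD).
    - move=> z _; rewrite lee_fin; apply: mulr_ge0 => //; apply: addr_ge0; first exact: energy_ge0.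
      exact: mulr_ge0.
    - by case/integrableP: n4.
    - apply: filterS acf => z hz Dz; rewrite lee_fin indicE mem_set// mulr1.
      apply: defect_num => //; first exact: energy_ge0.
      by rewrite sqrrN addrC; exact: comb_sq.
  rewrite m4 m3 m2 m1 [leRHS]EFinM; apply: lee_wpmul2l; first by rewrite lee_fin.
  rewrite EFinD; apply: leeD => //; rewrite [leRHS]EFinM; apply: lee_wpmul2l => //.
have iQ := integrable_nonneg mQ mQf (fun z => normr_ge0 _) bQ.
have [jt et] := integrable_add mQ jf iQ; rewrite ef in et.
have := le_integralR mQ t123 jt; rewrite s123 et => LE.
have {}LE : ((be al1 P1 * (2 * disc_area R) + be al2 P2 * (2 * disc_area R) + be al3 P3 * (2 * disc_area R))%:E <=
    (r1 + r2 + r3 + -1 * r4)%:E + (k / 2 * (11 / 10 * (disc_area R * (2 * S) ^+ 2) + A * (4 * H ^+ 2)))%:E)%E.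
  apply: le_trans (LE _) (leeD (lexx _) bQ) => z Dz.
  rewrite !Dx_subr !Dy_subr.
  have dc := div_comb al1 al2 al3 e P1 P2 P3 z; rewrite -/g1x -/g2y in dc.
  have key al P : [\/ P = P1, P = P2 | P = P3] -> be al P * bump e P z <= u' z * (al * bump e P z).
    move=> hP; rewrite /be mulrBl.
    have [h|h] := pselect (sqd P z < e ^+ 2); last by rewrite bump0// !mulr0 subrr.
    apply: disc_num; first exact: bump_ge0.
    have [_ _ hd] := bd P z hP h.
    by rewrite /u' (_ : _ - _ = u z - u P)//; ring.
  have := key al1 P1 (Or31 _ _ erefl); have := key al2 P2 (Or32 _ _ erefl).
  have := key al3 P3 (Or33 _ _ erefl).
  have hq : - ((Dy u z + Dx v z) * g2 z + (Dy v z - Dx u z) * - g1 z) <= Q z.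
    by rewrite /Q -normrN ler_norm.
  rewrite (_ : _ + Q z = (Dy u z + Dx v z) * g2 z + (Dy v z - Dx u z) * - g1 z +
    u' z * (g1x z + g2y z) + Q z); last by ring.
  rewrite dc => k3 k2' k1'; exact: (add_bound hq k1' k2' k3).
rewrite -EFinD lee_fin in LE.
apply: le_trans (_ : _ <= r1 + r2 + r3 + -1 * r4 + k / 2 * (11 / 10 * (disc_area R * (2 * S) ^+ 2) + A * (4 * H ^+ 2))) _.
  apply: le_trans LE; rewrite le_eqVlt; apply/orP; left; apply/eqP.
  by rewrite /be /u'; ring.
rewrite lerD2r (_ : 16 * S * C * H = 4 * (4 * S * C * H)); last by ring.
exact: sum_bound b1 b2 b3 b4.
Qed.
End test.

Section threepoint.
Variable R : realType.

Lemma expr98_ge (p : nat) : p%:R / 8 <= (9 / 8) ^+ p :> R.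
Proof.
suff : 1 + p%:R / 8 <= (9 / 8) ^+ p :> R by lra.
elim: p => [|p IH]; first by rewrite expr0; lra.
by rewrite exprS -natr1; have := ler0n R p; move: IH; move: ((9 / 8) ^+ p) => X; lra.
Qed.

Lemma far_sqd (x x2 H : R) (z : R * R) : 0 <= H -> `|x - x2| <= H / 2 ->
  `|z.1 - x2| = H \/ `|z.2 - 0| = H -> H ^+ 2 / 4 <= sqd (x, 0) z.
Proof.
move=> H0 hx hz; have -> : H ^+ 2 / 4 = (H / 2) ^+ 2 by field.
rewrite /sqd /=; have s1 := sqr_ge0 (z.1 - x); have s2 := sqr_ge0 (z.2 - 0).
case: hz => hz.
  apply: le_trans (_ : _ <= (z.1 - x) ^+ 2) _; last by rewrite lerDl.
  rewrite -[leRHS]real_normK ?num_real// ler_pXn2r ?nnegrE ?divr_ge0//.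
  by have := ler_distD x z.1 x2; rewrite hz; lra.
apply: le_trans (_ : _ <= (z.2 - 0) ^+ 2) _; last by rewrite lerDr.
by rewrite -[leRHS]real_normK ?num_real// hz ler_pXn2r ?nnegrE ?divr_ge0//; lra.
Qed.

Lemma far_num (c H d1 d2 d3 : R) : 0 < H -> H ^+ 2 / 4 <= d1 -> H ^+ 2 / 4 <= d2 -> H ^+ 2 / 4 <= d3 ->
  c ^+ 2 / (d1 * d2 * d3) <= (8 * `|c| / H ^+ 3) ^+ 2.
Proof.
move=> H0; set m := H ^+ 2 / 4 => h1 h2 h3.
have m0 : 0 < m by rewrite divr_gt0// exprn_gt0.
have -> : (8 * `|c| / H ^+ 3) ^+ 2 = c ^+ 2 / (m * m * m).
  rewrite -[c ^+ 2]real_normK ?num_real//; move: `|c| => x; rewrite /m; field.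
  by rewrite gt_eqF.
have mm : m * m * m <= d1 * d2 * d3.
  apply: ler_pM => //; [by rewrite mulr_ge0// ltW|exact: ltW|].
  by apply: ler_pM => //; exact: ltW.
have M0 : 0 < m * m * m by rewrite !mulr_gt0.
by rewrite ler_wpM2l ?sqr_ge0// lef_pV2 ?posrE// (lt_le_trans M0).
Qed.

(** Off the discs of radius [e] the fields are exactly [(z - x) / |z - x|^2], so [dipole_norm] gives
    the cubic decay. The sign [s] allows [test_ineq], a one-sided bound, to be used for [D] and
    [- D]. *)
Lemma far_comb (s x1 x2 x3 e H : R) (z : R * R) : `|s| = 1 -> 0 < e -> e <= H / 2 -> 0 < H ->
  (forall x, [\/ x = x1, x = x2 | x = x3] -> H ^+ 2 / 4 <= sqd (x, 0) z) ->
  let c3 := (x1 - x2) * (x2 - x3) * (x3 - x1) in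
  let al1 := s * (x3 - x2) in let al2 := s * (x1 - x3) in let al3 := s * (x2 - x1) in
  `|comb al1 al2 al3 e (x1, 0) (x2, 0) (x3, 0) (@W1 R) z| <= 8 * `|c3| / H ^+ 3 /\
  `|comb al1 al2 al3 e (x1, 0) (x2, 0) (x3, 0) (@W2 R) z| <= 8 * `|c3| / H ^+ 3.
Proof.
move=> s1 e0 eH H0 hz c3 al1 al2 al3.
have H40 : 0 < H ^+ 2 / 4 by rewrite divr_gt0// exprn_gt0.
have dE x : [\/ x = x1, x = x2 | x = x3] -> rden e (z.2 - 0) (z.1 - x) = sqd (x, 0) z.
  move=> /hz h; rewrite /rden max_r//; apply: le_trans h.
  have -> : H ^+ 2 / 4 = (H / 2) ^+ 2 by field.
  by rewrite ler_pXn2r ?nnegrE ?divr_ge0// ltW.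
have d1 := dE x1 (Or31 _ _ erefl); have d2 := dE x2 (Or32 _ _ erefl); have d3 := dE x3 (Or33 _ _ erefl).
have h1 := hz x1 (Or31 _ _ erefl); have h2 := hz x2 (Or32 _ _ erefl); have h3 := hz x3 (Or33 _ _ erefl).
have n1 := lt_le_trans H40 h1; have n2 := lt_le_trans H40 h2; have n3 := lt_le_trans H40 h3.
have ss : s ^+ 2 = 1 by rewrite -real_normK ?num_real// s1 expr1n.
have K : comb al1 al2 al3 e (x1, 0) (x2, 0) (x3, 0) (@W1 R) z ^+ 2 +
         comb al1 al2 al3 e (x1, 0) (x2, 0) (x3, 0) (@W2 R) z ^+ 2 <= (8 * `|c3| / H ^+ 3) ^+ 2.
  rewrite /comb /W1 /W2 /= d1 d2 d3 /al1 /al2 /al3.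
  have D := @dipole_norm R (z.1 - x1) (z.1 - x2) (z.1 - x3) (z.2 - 0) _ _ _ erefl erefl erefl
    (lt0r_neq0 n1) (lt0r_neq0 n2) (lt0r_neq0 n3).
  rewrite -!/(sqd (_, 0) z) in D.
  rewrite (_ : _ + _ = c3 ^+ 2 / (sqd (x1, 0) z * sqd (x2, 0) z * sqd (x3, 0) z)); last first.
    rewrite (_ : c3 ^+ 2 = ((z.1 - x1 - (z.1 - x2)) * (z.1 - x2 - (z.1 - x3)) * (z.1 - x3 - (z.1 - x1))) ^+ 2); last by rewrite /c3; ring.
    rewrite -[RHS]D -[RHS]mul1r -ss.
    move: (_ / sqd _ _) (_ / sqd _ _) (_ / sqd _ _) (_ / sqd _ _) (_ / sqd _ _) (_ / sqd _ _) => *; ring.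
  exact: far_num.
have c0 : 0 <= 8 * `|c3| / H ^+ 3 by apply: divr_ge0; [exact: mulr_ge0|exact/exprn_ge0/ltW].
by split; apply: sqr_le_abs => //; apply: le_trans K; rewrite ?lerDl ?lerDr sqr_ge0.
Qed.
End threepoint.

Section threepoint2.
Variable R : realType.

Lemma mem_three (A B x1 x2 x3 x : R) : A <= x1 -> x1 < x2 -> x2 < x3 -> x3 < B ->
  [\/ x = x1, x = x2 | x = x3] -> [/\ A <= x, x <= B & `|x - x2| <= x3 - x1].
Proof. by move=> h1 h2 h3 h4 [] ->; rewrite ler_norml; split; try apply/andP; try split; lra. Qed.

Lemma half_bounds (e c H : R) : 0 <= e -> 0 <= c -> 2 * e + 2 * c <= H -> e <= H / 2 /\ c <= H / 2.
Proof. by move=> *; split; lra. Qed.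

Lemma dist_lt_add (t x y e c H : R) : 0 < e -> 0 <= c -> `|t - x| <= e -> `|x - y| <= c ->
  2 * e + 2 * c <= H -> `|t - y| < H.
Proof. by move=> e0 c0 h1 h2 h3; have := ler_distD x t y; lra. Qed.

(** The choices are made in the order [eta], [d], [e], [p], and only then [k] with its extension
    [F]; the uniformity of [modulus] and [growth] permits this. The condition [x3 < B] leaves room
    for a real point to the right of each [x_i], where [modulus] reads off the size of [F]. *)
Lemma three_point (h : R -> R) (A B : R) :
  (forall k : R, 0 < k -> exists F G, exists2 k', k' <= k & almost_conformal F G k' /\
     forall x, A <= x -> x <= B -> F (x, 0) = (h x, 0)) ->
  (forall x e, A <= x -> x < B -> 0 < e -> exists2 r, 0 < r & forall t, 0 < t -> t <= r ->
     x + t <= B /\ `|h (x + t) - h x| <= e) ->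
  forall x1 x2 x3, A <= x1 -> x1 < x2 -> x2 < x3 -> x3 < B ->
  (x3 - x2) * h x1 + (x1 - x3) * h x2 + (x2 - x1) * h x3 = 0.
Proof.
move=> HF hc x1 x2 x3 Ax1 x12 x23 x3B; have K0 := disc_area_gt0 R.
have [L L0 HL] := modulus R; have [N HN] := growth R.
set D := _ + _; apply/eqP; rewrite -normr_le0; apply/ler_addgt0Pr => eta eta0; rewrite add0r.
pose S1 := `|x3 - x2| + `|x1 - x3| + `|x2 - x1|.
have S10 : 0 <= S1 by rewrite !addr_ge0.
pose d := eta / (4 * (S1 + 1)); have d0 : 0 < d by rewrite divr_gt0// mulr_gt0// ltr_wpDl.
have S1d : S1 * d <= eta / 4.
  rewrite /d mulrA ler_pdivrMr ?mulr_gt0 ?ltr_wpDl//.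
  by rewrite (_ : eta / 4 * (4 * (S1 + 1)) = S1 * eta + eta); [lra|field].
have dL : 0 < d / L by rewrite divr_gt0.
have Ax2 : A <= x2 by lra. have Ax3 : A <= x3 by lra.
have x1B : x1 < B by lra. have x2B : x2 < B by lra.
have [r1 r10 hr1] := hc x1 (d / L) Ax1 x1B dL.
have [r2 r20 hr2] := hc x2 (d / L) Ax2 x2B dL.
have [r3 r30 hr3] := hc x3 (d / L) Ax3 x3B dL.
(* Half of the radii, because [modulus] uses the real point [x + 2 e]. *)
pose e := Num.min r1 (Num.min r2 r3) / 2.
have e0 : 0 < e by rewrite divr_gt0// !lt_min r10 r20 r30.
have e2 : e * 2 = Num.min r1 (Num.min r2 r3) by rewrite /e divfK.
have [er1 er2 er3] : [/\ 2 * e <= r1, 2 * e <= r2 & 2 * e <= r3].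
  by rewrite mulrC e2 !ge_min !lexx !orbT.
pose c3 := (x1 - x2) * (x2 - x3) * (x3 - x1).
pose l : R := (9 / 8) ^+ N; have l0 : 0 < l by rewrite exprn_gt0//; lra.
(* The first two terms make the square large compared with [e] and [x3 - x1] ([He]); the last makes
   the boundary term at most [disc_area eta / 2] ([SCH]). The factor 8 in the choice of [p] below
   comes from [expr98_ge]. *)
pose M := 4 + 4 * (x3 - x1) / e + 512 * l * d * `|c3| / (e ^+ 2 * (disc_area R * eta)) * 2.
have Mt1 : 0 <= 4 * (x3 - x1) / e by rewrite divr_ge0 ?(ltW e0)// mulr_ge0//; lra.
have q0 : 0 < e ^+ 2 * (disc_area R * eta) by rewrite mulr_gt0 ?exprn_gt0// mulr_gt0.
have c30 : 0 <= 512 * l * d * `|c3|.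
  exact: (mulr_ge0 (mulr_ge0 (mulr_ge0 (ler0n R 512) (ltW l0)) (ltW d0)) (normr_ge0 c3)).
have Mt2 : 0 <= 512 * l * d * `|c3| / (e ^+ 2 * (disc_area R * eta)) by rewrite divr_ge0// ltW.
have [p hp] := bound_nat (8 * M); have {}hp := le_lt_trans (ler_norm _) hp.
pose X : R := (9 / 8) ^+ p; have XM : M <= X by have := expr98_ge R p; rewrite -/X; lra.
have X4 : 4 <= X by move: XM; rewrite /M; lra.
have X0 : 0 < X by lra.
(* In terms of [X], the side [H] is of order [X^2], the bound [S] given by [growth] of order [X^3]
   and the kernel [C] of order [X^-6]. The boundary term [S C H] is of order [X^-1]. *)
pose H := (9 / 8) ^+ (2 * p) * e / 2.
have HE : H = X ^+ 2 * e / 2 by rewrite /H /X -exprM mulnC.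
pose S := (9 / 8) ^+ (3 * p + N) * d.
have SE : S = X ^+ 3 * l * d by rewrite /S /X /l exprD -exprM mulnC.
have H0 : 0 < H by rewrite HE divr_gt0// mulr_gt0// exprn_gt0.
have S0 : 0 < S by rewrite SE; apply: mulr_gt0 => //; apply: mulr_gt0 => //; exact: exprn_gt0.
have He : 2 * e + 2 * (x3 - x1) <= H.
  have t1 : 4 * e + 4 * (x3 - x1) <= X * e.
    rewrite -ler_pdivrMr// mulrDl mulfK ?gt_eqF//; move: XM; rewrite /M.
    by rewrite -[(512 * _ * _ * _ / _)]/(512 * l * d * `|c3| / (e ^+ 2 * (disc_area R * eta))); lra.
  have t2 : X * e <= X ^+ 2 * e by rewrite ler_wpM2r ?(ltW e0)// expr2 ler_peMl ?(ltW X0)//; lra.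
  by rewrite HE; lra.
pose C := 8 * `|c3| / H ^+ 3.
have C0 : 0 <= C by apply: divr_ge0; [exact: mulr_ge0|exact/exprn_ge0/ltW].
have SCH : 16 * S * C * H <= disc_area R * eta / 2.
  have -> : 16 * S * C * H = 512 * l * d * `|c3| / e ^+ 2 / X.
    by rewrite SE /C HE; field; rewrite !gt_eqF.
  rewrite ler_pdivrMr// ler_pdivrMr ?exprn_gt0//.
  have : 512 * l * d * `|c3| / (e ^+ 2 * (disc_area R * eta)) * 2 <= X by move: XM; rewrite /M; lra.
  by rewrite -ler_pdivlMr// ler_pdivrMr// => t; apply: le_trans t _; rewrite le_eqVlt; apply/orP; left; apply/eqP; field.
pose E := 11 / 10 * (disc_area R * (2 * S) ^+ 2) + 2 * (S1 / e) ^+ 2 * (4 * H ^+ 2).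
have E0 : 0 <= E.
  apply: addr_ge0.
    exact: (mulr_ge0 (divr_ge0 (ler0n R 11) (ler0n R 10)) (mulr_ge0 (ltW K0) (sqr_ge0 _))).
  exact: (mulr_ge0 (mulr_ge0 (ler0n R 2) (sqr_ge0 _)) (mulr_ge0 (ler0n R 4) (sqr_ge0 _))).
(* [E] depends only on the scales already fixed, so the defect term [k / 2 * E] can be made small by
   the choice of the extension. *)
pose kk := disc_area R * eta / (E + 1); have kk0 : 0 < kk by rewrite divr_gt0 ?mulr_gt0// ltr_wpDl.
have [F [G [k kkk [acF Fh]]]] := HF kk kk0.
have kE : k / 2 * E <= disc_area R * eta / 2.
  have k0 : 0 <= k by have [_ /andP[]] := acF.
  have : k * (E + 1) <= disc_area R * eta by rewrite -ler_pdivlMr// ltr_wpDl.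
  by lra.
have inAB x : [\/ x = x1, x = x2 | x = x3] -> [/\ A <= x, x <= B, `|x - x2| <= x3 - x1 &
    x + 2 * e <= B /\ `|h (x + 2 * e) - h x| <= d / L].
  have e20 : 0 < 2 * e by rewrite mulr_gt0.
  move=> hx; have [y1 y2 y3] := mem_three Ax1 x12 x23 x3B hx; split => //.
  case: hx => ->; [exact: hr1|exact: hr2|exact: hr3].
have x310 : 0 <= x3 - x1 by rewrite subr_ge0 ltW// (lt_trans x12).
have [eH xH] : e <= H / 2 /\ x3 - x1 <= H / 2 by exact: (half_bounds (ltW e0) x310 He).
have near x z : [\/ x = x1, x = x2 | x = x3] -> sqd (x, 0) z < e ^+ 2 ->
    sqd (F (x, 0)) (F z) <= d ^+ 2 /\ box (x, 0) e z.
  move=> hx hz; have zb : box (x, 0) e z.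
    by split; apply: sqr_le_abs; rewrite ?(ltW e0)//; apply: le_trans (ltW hz); rewrite /sqd /= ?lerDl ?lerDr sqr_ge0.
  split=> //; have [a1 a2 _ [a3 a4]] := inAB x hx.
  have := HL F G k h x e (d / L) z acF e0 (Fh x a1 a2) _ a4 zb.
  rewrite [L * _]mulrC divfK ?gt_eqF//; apply; apply: Fh => //.
  by apply: le_trans a1 _; rewrite lerDl mulr_ge0// ltW.
have key (s : R) : `|s| = 1 -> 2 * disc_area R * (s * D - S1 * d) <= disc_area R * eta.
  move=> s1.
  have := @test_ineq R F G k acF (s * (x3 - x2)) (s * (x1 - x3)) (s * (x2 - x1)) e H S C d
    (x1, 0) (x2, 0) (x3, 0) (x2, 0) (F (x2, 0)) e0 (ltW H0) S0 C0.
  rewrite !normrM s1 !mul1r -/S1 -/E.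
  rewrite (_ : _ * (F (x1, 0)).1 + _ + _ - _ = s * D); last first.
    by rewrite !Fh ?(ltW x1B) ?(ltW x2B) ?(ltW x3B)// /D /=; ring.
  move=> T; apply: le_trans (T _ _ _) _.
  - move=> z zb; exact: (HN F G k (x2, 0) e d p z acF e0 d0 (fun z hz => (near x2 z (Or32 _ _ erefl) hz).1) zb).
  - move=> P z hP hz.
    have [x hx PE] : exists2 x, [\/ x = x1, x = x2 | x = x3] & P = (x, 0).
      by case: hP => ->; eexists; [apply: Or31|reflexivity|apply: Or32|reflexivity|apply: Or33|reflexivity].
    rewrite PE in hz *; have [n1 [n2 n3]] := near x z hx hz; have [_ _ a3 _] := inAB x hx.
    rewrite /= in n2 n3 *; split.
    + exact: (dist_lt_add e0 x310 n2 a3 He).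
    + by apply: (dist_lt_add e0 x310 n3 _ He); rewrite subrr normr0.
    + by apply: sqr_le_abs; [exact: ltW|apply: le_trans n1; rewrite /sqd lerDl sqr_ge0].
  - move=> z zb hz; apply: far_comb => //.
    move=> x hx; apply: (@far_sqd R x x2 H z (ltW H0) _ hz).
    by have [_ _ a3 _] := inAB x hx; exact: le_trans xH.
  have : disc_area R * eta = disc_area R * eta / 2 + disc_area R * eta / 2 by field.
  by move=> ->; apply: lerD.
have half (y : R) : 2 * disc_area R * (y - S1 * d) <= disc_area R * eta -> y <= eta.
  rewrite -[leLHS]mulrA mulrCA ler_pM2l// => t; move: S1d t eta0; clear; move=> *; lra.
have k1 := half _ (key 1 (normr1 _)).
have k2 := half _ (key (- 1) (normrN1 _)).
rewrite mul1r in k1; rewrite mulN1r in k2.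
by rewrite ler_norml lerNl k2 k1.
Qed.
End threepoint2.

(** * Quasiconformal maps as maps of the real plane *)

Section complexplane.
Variable R : realType.
Local Notation C := R[i]^o.
Local Open Scope complex_scope.
Implicit Types (F : C -> C) (z : R * R).

Definition toC z : R[i] := z.1 +i* z.2.
Definition toP (c : R[i]) : R * R := (complex.Re c, complex.Im c).

Lemma toCK : cancel toC toP. Proof. by case. Qed.

Lemma toPK : cancel toP toC. Proof. by case. Qed.

Definition planar F z : R * R := toP (F (toC z)).

Lemma Re_le_normc (c : R[i]) : `|complex.Re c| <= Normc.normc c.
Proof.
case: c => x y /=; rewrite -sqrtr_sqr ler_wsqrtr// lerDl sqr_ge0//.
Qed.

Lemma Im_le_normc (c : R[i]) : `|complex.Im c| <= Normc.normc c.
Proof.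
case: c => x y /=; rewrite -sqrtr_sqr ler_wsqrtr// lerDr sqr_ge0//.
Qed.

Lemma normc_le (c : R[i]) : Normc.normc c <= `|complex.Re c| + `|complex.Im c|.
Proof.
case: c => x y /=; apply: (@le_trans _ _ (Num.sqrt ((`|x| + `|y|) ^+ 2))).
  rewrite ler_wsqrtr// sqrrD !real_normK ?num_real//.
  have : 0 <= `|x| * `|y| *+ 2 by rewrite mulrn_wge0// mulr_ge0.
  lra.
by rewrite sqrtr_sqr ger0_norm// addr_ge0.
Qed.

Lemma normCE (c : R[i]) : `|c| = (Normc.normc c)%:C.
Proof. by []. Qed.

Lemma continuous_planar F : continuous F -> continuous (planar F).
Proof.
move=> cF z.
have key (e : R) : 0 < e -> \forall w \near z, Normc.normc (F (toC z) - F (toC w)) < e.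
  move=> e0; have e0' : 0 < (e%:C : R[i]) by rewrite ltcR.
  have /cvgrPdist_lt cF' : F w @[w --> (toC z : C)] --> F (toC z) by exact: cF.
  have /nbhs_ballP[r /= r0 hr] := cF' _ e0'.
  have rE : r = (complex.Re r)%:C.
    by rewrite RRe_real// ger0_real// ltW.
  have rr : 0 < complex.Re r by move: r0; rewrite {1}rE ltcR.
  have h2 : 0 < complex.Re r / 2 by rewrite divr_gt0.
  exists (ball z.1 (complex.Re r / 2), ball z.2 (complex.Re r / 2)) => /=.
    by split; exact: nbhsx_ballx.
  move=> [x y] [/= b1 b2]; rewrite -ltcR; apply: hr.
  rewrite /ball /= normCE rE ltcR; apply: le_lt_trans (normc_le _) _ => /=.
  by rewrite /ball /= in b1 b2; rewrite (splitr (complex.Re r)) ltrD.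
apply: (@cvg_pair _ _ _ (nbhs z) (nbhs (complex.Re (F (toC z)))) (nbhs (complex.Im (F (toC z)))) _ _ _
  (fun z => complex.Re (F (toC z))) (fun z => complex.Im (F (toC z)))).
  apply/cvgrPdist_lt => e e0; apply: filterS (key e e0) => w h.
  by apply: le_lt_trans h; apply: le_trans (Re_le_normc _); case: (F _) (F _) => [? ?] [? ?].
apply/cvgrPdist_lt => e e0; apply: filterS (key e e0) => w h.
by apply: le_lt_trans h; apply: le_trans (Im_le_normc _); case: (F _) (F _) => [? ?] [? ?].
Qed.

Lemma abs_continuous_AC (a b : R) (f : R -> R[i]) (w : R -> R) :
  (forall x y, `|w x - w y| <= Normc.normc (f x - f y)) -> abs_continuous a b f -> AC a b w.
Proof.
move=> wf af e /af[d d0 hd]; exists d => // s /andP[/allP fs /(pairwiseP (0, 0)) ps] ts.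
pose I (i : 'I_(size s)) := nth (0, 0) s i.
have := hd (size s) (fun i => (I i).2) (fun i => (I i).1) _ _ _.
have sumE (phi : R * R -> R) : \sum_(J <- s) phi J = \sum_i phi (I i).
  by rewrite (big_nth (0, 0)) big_mkord.
move=> H; apply: le_lt_trans (_ : _ <= \sum_i Normc.normc (f (I i).1 - f (I i).2)) _.
  by rewrite /total_increment sumE; apply: ler_sum => i _; exact: wf.
apply: H.
- by move=> i; have /and3P[] := fs _ (mem_nth (0, 0) (ltn_ord i)).
- move=> i j ij; have [lt|lt|/val_inj e'] := ltngtP i j.
  + by have := ps i j (ltn_ord i) (ltn_ord j) lt; rewrite /nonoverlap => /orP[]; [left|right].
  + by have := ps j i (ltn_ord j) (ltn_ord i) lt; rewrite /nonoverlap => /orP[]; [right|left].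
  + by rewrite e' eqxx in ij.
- by rewrite -(sumE (fun J => J.1 - J.2)).
Qed.

Lemma ACL_planar F : ACL F ->
  [/\ ACLx (fun z => (planar F z).1), ACLx (fun z => (planar F z).2),
      ACLy (fun z => (planar F z).1) & ACLy (fun z => (planar F z).2)].
Proof.
move=> aF.
(* [ACL] speaks of nondegenerate rectangles, hence [n + 1]; the case [n = 0] of [ACLx] follows by
   restriction. *)
have n0 (n : nat) : - n.+1%:R < n.+1%:R :> R by have := ltr0Sn R n; lra.
have nn (n : nat) : - n.+1%:R <= - n%:R :> R by rewrite lerN2 ler_nat.
have nn' (n : nat) : n%:R <= n.+1%:R :> R by rewrite ler_nat.
have hx : {ae @leb R, forall y, forall n m : nat, - m.+1%:R <= y <= m.+1%:R ->
    abs_continuous (- n.+1%:R) n.+1%:R (fun x => F (x +i* y))}.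
  apply: ae_lebesgue; apply: ae_foralln => n; apply: ae_foralln => m.
  by have [h _] := aF _ _ _ _ (n0 n) (n0 m).
have hy : {ae @leb R, forall x, forall n m : nat, - m.+1%:R <= x <= m.+1%:R ->
    abs_continuous (- n.+1%:R) n.+1%:R (fun y => F (x +i* y))}.
  apply: ae_lebesgue; apply: ae_foralln => n; apply: ae_foralln => m.
  by have [_ h] := aF _ _ _ _ (n0 m) (n0 n).
have itv (y : R) : exists m : nat, - m.+1%:R <= y <= m.+1%:R.
  have [m hm] := bound_nat y; exists m; rewrite -ler_norml; apply: le_trans (ltW hm) _; exact: nn'.
have dR (c d : R[i]) : `|complex.Re c - complex.Re d| <= Normc.normc (c - d).
  by apply: le_trans (Re_le_normc _); case: c d => [? ?] [? ?].
have dI (c d : R[i]) : `|complex.Im c - complex.Im d| <= Normc.normc (c - d).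
  by apply: le_trans (Im_le_normc _); case: c d => [? ?] [? ?].
split.
- apply: filterS hx => y h n; have [m hm] := itv y.
  apply: (AC_subinterval (nn n) (nn' n)); apply: (abs_continuous_AC _ (h n m hm)) => x x'; exact: dR.
- apply: filterS hx => y h n; have [m hm] := itv y.
  apply: (AC_subinterval (nn n) (nn' n)); apply: (abs_continuous_AC _ (h n m hm)) => x x'; exact: dI.
- apply: filterS hy => y h n; have [m hm] := itv y.
  apply: (AC_subinterval (nn n) (nn' n)); apply: (abs_continuous_AC _ (h n m hm)) => x x'; exact: dR.
- apply: filterS hy => y h n; have [m hm] := itv y.
  apply: (AC_subinterval (nn n) (nn' n)); apply: (abs_continuous_AC _ (h n m hm)) => x x'; exact: dI.
Qed.
End complexplane.

Section dilatation.
Variable R : realType.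
Local Notation C := R[i]^o.
Local Open Scope complex_scope.
Implicit Types (F : C -> C).

(** Since [F_z = F_x - F_zbar], the dilatation inequality yields [2 |F_zbar| <= (K - 1) |F_x|], and
    [2 F_zbar = F_x + i F_y] is the Cauchy-Riemann defect. *)
Lemma dilatation_num (K ux vx uy vy : R) : 1 <= K ->
  Normc.normc (((ux +i* vx) + 'i * (uy +i* vy)) / 2%:R) <=
    (K - 1) / (K + 1) * Normc.normc (((ux +i* vx) - 'i * (uy +i* vy)) / 2%:R) ->
  (uy + vx) ^+ 2 + (vy - ux) ^+ 2 <= (K - 1) ^+ 2 * (ux ^+ 2 + vx ^+ 2).
Proof.
move=> K1; set p := ux +i* vx; set q := uy +i* vy.
set zb := (p + 'i * q) / 2%:R => h.
have h2 : (2%:R : R[i]) != 0 by rewrite pnatr_eq0.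
have pz : (p - 'i * q) / 2%:R = p - zb by rewrite /zb; field.
have tri : Normc.normc (p - zb) <= Normc.normc p + Normc.normc zb.
  by apply: le_trans (le_normcD _ _) _; rewrite normcN.
rewrite pz in h.
have K0 : 0 < K + 1 by lra.
have k0 : 0 <= (K - 1) / (K + 1) by rewrite divr_ge0 ?subr_ge0// ltW.
have h3 : 2 * Normc.normc zb <= (K - 1) * Normc.normc p.
  have := le_trans h (ler_wpM2l k0 tri); rewrite mulrAC ler_pdivlMr//; lra.
have np : Normc.normc p ^+ 2 = ux ^+ 2 + vx ^+ 2 by rewrite /= sqr_sqrtr ?addr_ge0 ?sqr_ge0.
have nz : (2 * Normc.normc zb) ^+ 2 = (uy + vx) ^+ 2 + (vy - ux) ^+ 2.
  have -> : 2 * Normc.normc zb = Normc.normc (p + 'i * q).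
    have -> : p + 'i * q = zb *+ 2 by rewrite /zb -mulr_natr divfK.
    by rewrite normcMn mulr_natl.
  rewrite /p /q /= sqr_sqrtr ?addr_ge0 ?sqr_ge0//; ring.
rewrite -nz -np -exprMn ler_pXn2r ?nnegrE//.
  by rewrite mulr_ge0// /Normc.normc; case: (zb) => ? ?; rewrite sqrtr_ge0.
by rewrite mulr_ge0 ?subr_ge0// /Normc.normc /p sqrtr_ge0.
Qed.

Lemma quasiconformal_almost_conformal K F : K <= 1 + 1 / 1000 -> K_quasiconformal K F ->
  exists G, almost_conformal (planar F) G (K - 1).
Proof.
move=> K2 [K1 [cF [G [cG FK GK]]] aF dF].
have cP := continuous_planar cF.
have [ux vx uy vy] := ACL_planar aF.
exists (planar G); split.
- split => //; first exact: continuous_planar.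
    by move=> z; rewrite /planar toPK FK toCK.
  by move=> z; rewrite /planar toPK GK toCK.
- by apply/andP; split; lra.
- by split.
have o1 := ae_derivable (cont_fst cP) ux; have o2 := ae_derivable (cont_snd cP) vx.
have o3 := ae_derivable_y (cont_fst cP) uy; have o4 := ae_derivable_y (cont_snd cP) vy.
have dF' := ae_lebesgue2 dF; near=> z.
have h1 : dx_ok (fun z => (planar F z).1) z by apply: (near o1).
have h2 : dx_ok (fun z => (planar F z).2) z by apply: (near o2).
have h3 : dy_ok (fun z => (planar F z).1) z by apply: (near o3).
have h4 : dy_ok (fun z => (planar F z).2) z by apply: (near o4).
have h : Normc.normc (partial_zbar F z.1 z.2) <=
      (K - 1) / (K + 1) * Normc.normc (partial_z F z.1 z.2) by apply: (near dF').
have d1 (f : R -> R) (x l : R) : is_derive x 1 f l -> derive1 f x = l.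
  by move=> fl; rewrite derive1E; exact: (@derive_val _ _ _ _ _ _ _ fl).
have px : partial_x F z.1 z.2 = Dx (fun z => (planar F z).1) z +i* Dx (fun z => (planar F z).2) z.
  by rewrite /partial_x; congr Complex; exact: d1.
have py : partial_y F z.1 z.2 = Dy (fun z => (planar F z).1) z +i* Dy (fun z => (planar F z).2) z.
  by rewrite /partial_y; congr Complex; exact: d1.
rewrite /partial_z /partial_zbar px py in h.
exact: (dilatation_num K1 h).
Unshelve. all: by end_near. Qed.

(** [teich_dist] and [max_dilatation] are both infima: one approximation provides [F], a second one
    an admissible [K < 1 + e]. The cap 1/1000 is the range of [almost_conformal]. *)
Lemma teich_dist0 (T : set R) (h : R -> R) : teich_dist T h = 0%E ->
  forall k : R, 0 < k -> exists (F G : R * R -> R * R), exists2 k', k' <= k & almost_conformal F G k' /\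
     forall x, T x -> F (x, 0) = (h x, 0).
Proof.
move=> hT k k0; pose e := Num.min k (1 / 1000).
have e0 : 0 < e by rewrite lt_min k0; lra.
have l0 : (teich_dist T h < (ln (1 + e))%:E)%E by rewrite hT lte_fin ln_gt0//; lra.
have [_ [F [[K0 qF] hF] <-]] := ereal_inf_lt l0; rewrite lte_fin => lnF.
have iF1 : 1 <= max_dilatation F.
  by apply: lb_le_inf; [exists K0|move=> K [K1 _ _ _]].
have : max_dilatation F < 1 + e by rewrite -ltr_ln ?posrE//; lra.
move=> /inf_lt[|K qK Ke]; first by exists K0.
have Kle : K <= 1 + 1 / 1000.
  by apply: le_trans (ltW Ke) _; rewrite lerD2l ge_min lexx orbT.
have [G acF] := quasiconformal_almost_conformal Kle qK.
exists (planar F), G, (K - 1).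
  by rewrite lerBlDl; apply: le_trans (ltW Ke) _; rewrite lerD2l ge_min lexx.
split=> // x Tx; rewrite /planar /toC /=.
by have := hF x Tx; rewrite /real_complex_def /= => ->.
Qed.
End dilatation.

(** * The conjugacy is affine *)

Section affine.
Variable R : realType.

Lemma Ck1_affine (m b : R) : Ck 1 (fun t : R => m * t + b).
Proof.
have d (x : R) : is_derive x (1 : R) (fun t : R => m * t + b) m.
  have h := is_deriveD (is_deriveZ m (is_derive_id x (1 : R))) (is_derive_cst b x (1 : R)).
  by apply: is_derive_eq h _; rewrite addr0 /GRing.scale /= mulr1.
split=> [x|]; first exact: (@ex_derive _ _ _ _ _ _ _ (d x)).
rewrite (_ : derive1 _ = cst m); first exact: cst_continuous.
by apply/funext => x; rewrite derive1E; exact: (@derive_val _ _ _ _ _ _ _ (d x)).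
Qed.

Lemma affine_Ck_diffeo (A B : set R) (h v : R -> R) (m b : R) : m != 0 ->
  inverse_on A B h v -> (forall x, A x -> h x = m * x + b) -> Ck_diffeo 1 A B h.
Proof.
move=> m0 inv hE; exists v; have [hAB vBA vh hv] := inv; split=> //.
  by exists (fun t : R => m * t + b); [exact: Ck1_affine|].
exists (fun t : R => m^-1 * t + - (m^-1 * b)); first exact: Ck1_affine.
move=> y By; have := hv y By; rewrite (hE _ (vBA y By)) => e.
by rewrite -mulrBr -{2}e addrK mulKf.
Qed.

Lemma within_continuous_eps (A B : R) (h : R -> R) : {within `[A, B], continuous h} ->
  forall x e, A <= x -> x <= B -> 0 < e -> exists2 r, 0 < r & forall y, A <= y -> y <= B ->
    `|y - x| < r -> `|h y - h x| < e.
Proof.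
move=> ch x e Ax xB e0.
have Dx : `[A, B]%classic x by rewrite /= in_itv /= Ax xB.
have /cvgrPdist_lt/(_ e e0) H := ch x.
have : nbhs_subspace (x : subspace `[A, B]) [set y | `|h x - h y| < e] by exact: H.
rewrite -(nbhs_subspace_in Dx) => /nbhs_ballP[r /= r0 hr]; exists r => // y Ay yB yx.
rewrite distrC; apply: hr; first by rewrite /ball /= distrC.
by rewrite /= in_itv /= Ay yB.
Qed.

(** [A] and the midpoint [M] determine the line. The identity stops short of [B], where the value
    follows by continuity. *)
Lemma three_point_affine (A B : R) (h : R -> R) : A < B -> {within `[A, B], continuous h} ->
  (forall x1 x2 x3, A <= x1 -> x1 < x2 -> x2 < x3 -> x3 < B ->
    (x3 - x2) * h x1 + (x1 - x3) * h x2 + (x2 - x1) * h x3 = 0) ->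
  exists m b, forall x, A <= x -> x <= B -> h x = m * x + b.
Proof.
move=> AB ch H; have ce := within_continuous_eps ch.
pose M := (A + B) / 2; have AM : A < M by rewrite /M; lra.
have MB : M < B by rewrite /M; lra.
pose m := (h M - h A) / (M - A); pose b := h A - m * A; exists m, b.
have MA0 : M - A != 0 by rewrite subr_eq0 gt_eqF.
have hM : m * (M - A) = h M - h A by rewrite /m divfK.
have lt x : A <= x -> x < B -> h x = m * x + b.
  move=> Ax xB; rewrite /b; have [xA|xA] := leP x A; first by rewrite (_ : x = A); [ring|lra].
  apply: (mulfI MA0); have [xM|xM|->] := ltgtP x M; last by rewrite mulrC; nra.
    have := H A x M (lexx A) xA xM MB.
    have -> : h M = h A + m * (M - A) by rewrite hM; ring.
    by move=> e; apply/eqP; rewrite -subr_eq0 -oppr_eq0 -[X in _ == X]e; apply/eqP; ring.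
  have := H A M x (lexx A) AM xM xB.
  have -> : h M = h A + m * (M - A) by rewrite hM; ring.
  by move=> e; apply/eqP; rewrite -subr_eq0 -[X in _ == X]e; apply/eqP; ring.
move=> x Ax; rewrite le_eqVlt => /predU1P[->|]; last exact: lt.
apply/eqP; rewrite -subr_eq0 -normr_le0; apply/ler_addgt0Pr => e e0; rewrite add0r.
have e20 : 0 < e / 2 by rewrite divr_gt0.
have [r r0 hr] := ce B (e / 2) (ltW AB) (lexx B) e20.
have n0 : 0 < `|m| + 1 by rewrite ltr_wpDl.
pose t := Num.min (B - A) (Num.min (r / 2) (e / 2 / (`|m| + 1))).
have t0 : 0 < t by rewrite !lt_min subr_gt0 AB !divr_gt0.
have [t1 t2 t3] : [/\ t <= B - A, t <= r / 2 & t <= e / 2 / (`|m| + 1)].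
  by rewrite !ge_min !lexx !orbT.
have y1 : A <= B - t by lra.
have y2 : B - t < B by lra.
have yr : `|B - t - B| < r by rewrite addrAC subrr add0r normrN gtr0_norm//; lra.
have := hr (B - t) y1 (ltW y2) yr; rewrite (lt _ y1 y2) => k1.
have k2 : `|m| * t <= e / 2.
  have : (`|m| + 1) * t <= e / 2 by rewrite mulrC -ler_pdivlMr.
  by rewrite mulrDl mul1r; lra.
have -> : h B - (m * B + b) = - (m * (B - t) + b - h B) - m * t by ring.
by apply: le_trans (ler_normB _ _) _; rewrite normrN normrM (gtr0_norm t0); lra.
Qed.
End affine.

Theorem mainTheorem2 (R : realType) (f g : unimodal_map R)
    (hf : quasi_quadratic f) (hg : quasi_quadratic g)
    (ff : is_fibonacci_map f) (fg : is_fibonacci_map g)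
    (h : R -> R) (hfg : qs_conjugacy f g h)
    (hdist : teich_dist (dom f) h = 0%E) :
  Ck_diffeo 1 (dom f) (dom g) h.
Proof.
have [[[v [inv ch cv]] _] _] := hfg.
have /andP[lc cr] := unimodal_crit f; have AB := lt_trans lc cr.
have domE x : lend f <= x -> x <= rend f -> dom f x by move=> h1 h2; rewrite /dom /= in_itv /= h1 h2.
have HF := teich_dist0 hdist.
have [|m [b hE]] := three_point_affine AB ch.
  apply: three_point => [k /HF[F [G [k' kk [acF Fh]]]]|x e Ax xB e0].
    by exists F, G, k' => //; split=> // x h1 h2; apply: Fh; exact: domE.
  have [r r0 hr] := within_continuous_eps ch Ax (ltW xB) e0.
  exists (Num.min (r / 2) (rend f - x)); first by rewrite lt_min subr_gt0 xB divr_gt0.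
  move=> t t0; rewrite le_min => /andP[t1 t2]; split; first by lra.
  apply: ltW; apply: hr; [lra|lra|]; rewrite addrAC subrr add0r gtr0_norm//; lra.
apply: (@affine_Ck_diffeo R _ _ h v m b _ inv) => [|x].
  (* If [m = 0], [h] takes the same value at both ends of [dom f], against the existence of the
     inverse [v]. *)
  apply/eqP => m0; have [_ _ vh _] := inv.
  have := vh _ (domE _ (lexx _) (ltW AB)); have := vh _ (domE _ (ltW AB) (lexx _)).
  rewrite !hE ?(ltW AB)// m0 !mul0r => -> e; by move: AB; rewrite e ltxx.
by rewrite /dom /= in_itv /= => /andP[]; exact: hE.
Qed.
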